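(* Let $a,b\ge2$ be integers. Let $V,W$ be independent non-negative random variables with $\mathbb{E}(V)=\mathbb{E}(W)=1$, $h_V:=\mathbb{E}(V\log V)<\log a$ and $h_W:=\mathbb{E}(W\log W)<\log b$. Let $\widetilde{M}_{V,a}$ and $\widetilde{M}_{W,b}$ be the classical Mandelbrot cascade measures on $[0,1]$ (built from independent families of weights). If $\log a/\log b$ is irrational, then almost surely conditioned on $\widetilde{M}_{V,a}([0,1])\cdot\widetilde{M}_{W,b}([0,1])>0$, $$\dim \widetilde{M}_{V,a}*\widetilde{M}_{W,b}=\min\{1,\dim \widetilde{M}_{V,a}+\dim \widetilde{M}_{W,b}\}=\min\Big\{1,2-\frac{h_V}{\log a}-\frac{h_W}{\log b}\Big\}.$$
   Context: Let $\Sigma_a^+=\{1,\dots,a\}^{\mathbb{N}}$, let $\ell_a$ be the uniform measure on it (i.i.d. uniform letters), and let $\Sigma_a^{+,*}$ be the set of finite words in the letters $1,\dots,a$. Let $\{V_u:u\in\Sigma_a^{+,*}\}$ be i.i.d. copies of $V$. For $k\ge1$ put $\widetilde\ell_{a,k}(\mathrm{d}\bm{i}^+)=V_{i_1}V_{i_1i_2}\cdots V_{i_1\cdots i_k}\,\ell_a(\mathrm{d}\bm{i}^+)$, and let $\widetilde\ell_a$ be the almost sure weak limit as $k\to\infty$. Let $\bm{I}_a=\{f_i(x)=a^{-1}x+(i-1)a^{-1}\}_{i=1}^a$ and $\Phi_{\bm{I}_a}(i_1i_2\cdots)=\lim_{n\to\infty}f_{i_1}\circ\cdots\circ f_{i_n}(0)\in[0,1]$.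 Then $\widetilde{M}_{V,a}=\widetilde\ell_a\circ\Phi_{\bm{I}_a}^{-1}$. The measure $\widetilde{M}_{W,b}$ is defined in the same way with $b$ and i.i.d. copies $\{W_v\}$ of $W$, the family $\{W_v\}$ being independent of $\{V_u\}$. $*$ denotes convolution of measures on $\mathbb{R}$; $0\log0=0$. A (finite Borel) measure $\lambda$ is exact-dimensional with dimension $D$, written $\dim\lambda=D$, if $\lim_{r\to0}\frac{\log\lambda(B(x,r))}{\log r}=D$ for $\lambda$-a.e. $x$; writing $\dim\lambda$ asserts that $\lambda$ is exact-dimensional. *)

(* Defs.v *)
From HB Require Import structures.
From mathcomp Require Import all_boot all_order all_algebra.
From mathcomp Require Import all_classical all_reals all_analysis.
From mathcomp Require Import measurable_realfun lra.

Set Implicit Arguments.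
Unset Strict Implicit.
Unset Printing Implicit Defensive.

Import Order.TTheory GRing.Theory Num.Theory.
Import numFieldNormedType.Exports.

Local Open Scope classical_set_scope.
Local Open Scope ring_scope.

(* The alphabet {0, ..., a - 1}, letter [i] standing for [i + 1] in the usual
   numbering {1, ..., a}. For [0 < a] one has [a.-1.+1 = a]; the successor only
   makes the type pointed, as [measurableType] requires. *)
Definition letter (a : nat) := 'I_a.-1.+1.
HB.instance Definition _ a := Finite.on (letter a).
HB.instance Definition _ a := isPointed.Build (letter a) ord0.

Definition word (a : nat) := seq (letter a).

Definition seq_topology (a : nat) :=
  prod_topology (fun _ : nat => discrete_topology (letter a)).
HB.instance Definition _ a := Topological.on (seq_topology a).
HB.instance Definition _ a := Pointed.on (seq_topology a).

(* Infinite sequences of letters with the Borel sigma-algebra of the product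
   topology. *)
Definition seq_space (a : nat) := g_sigma_algebraType (@open (seq_topology a)).

Definition prefix_word (a : nat) (i : seq_space a) (k : nat) : word a :=
  [seq (i j : letter a) | j <- iota 0 k].

Definition cylinder (a : nat) (w : word a) : set (seq_space a) :=
  [set i | prefix_word i (size w) = w].

Section independence.
Context {R : realType} {d : measure_display} {T : measurableType d}.
Variable P : probability T R.
Local Open Scope ereal_scope.

Definition independent_RV2 (X Y : T -> R) :=
  forall A B : set R, measurable A -> measurable B ->
    P (X @^-1` A `&` Y @^-1` B) = P (X @^-1` A) * P (Y @^-1` B).

Definition mutually_independent {I : choiceType} (X : I -> T -> R) :=
  forall (s : seq I) (B : I -> set R),
    uniq s -> (forall i, measurable (B i)) ->
    P (\bigcap_(i in [set` s]) (X i @^-1` B i)) =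
    \prod_(i <- s) P (X i @^-1` B i).

Definition sigma_generated {I : Type} (X : I -> T -> R) : set (set T) :=
  <<s \bigcup_i preimage_set_system [set: T] (X i) (@measurable _ R) >>.

Definition independent_families {I J : Type}
    (X : I -> T -> R) (Y : J -> T -> R) :=
  forall A B : set T, sigma_generated X A -> sigma_generated Y B ->
    P (A `&` B) = P A * P B.

End independence.

(* [X] and [Y] may live on different probability spaces. *)
Definition same_law {R : realType} {d d' : measure_display}
    {T : measurableType d} {T' : measurableType d'}
    (P : probability T R) (P' : probability T' R)
    (X : {RV P >-> R}) (Y : {RV P' >-> R}) :=
  forall A : set R, measurable A -> distribution P X A = distribution P' Y A.

Definition iid_copies {R : realType} {d d' : measure_display}
    {T : measurableType d} {T' : measurableType d'}
    (P : probability T R) (P' : probability T' R) {I : choiceType}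
    (X : I -> {RV P >-> R}) (Y : {RV P' >-> R}) :=
  mutually_independent P (fun i => X i : T -> R) /\
  forall i, same_law (X i) Y.

(* [ln 0 = 0] in the library, and in any case [0 * ln 0 = 0]. *)
Definition entropy {R : realType} {d : measure_display} {T : measurableType d}
    (P : probability T R) (X : {RV P >-> R}) : \bar R :=
  'E_P[fun t => X t * ln (X t)].

Section cascade.
Context {R : realType}.
Variable a : nat.
Local Open Scope ereal_scope.

(* The letters are i.i.d. and uniform; this determines [ell], cylinders being a
   generating pi-system. *)
Definition uniform_measure (ell : probability (seq_space a) R) :=
  forall w : word a, ell (cylinder w) = ((a%:R ^- size w)%R)%:E.

Definition cascade_density (V : word a -> R) (k : nat) (i : seq_space a) : R :=
  (\prod_(1 <= j < k.+1) V (prefix_word i j))%R.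

(* A measure as soon as the weights are nonnegative, hence almost surely for
   copies of a nonnegative random variable; [integral] accepts set functions. *)
Definition cascade_step (ell : probability (seq_space a) R) (V : word a -> R)
    (k : nat) : set (seq_space a) -> \bar R :=
  fun A => \int[ell]_(i in A) (cascade_density V k i)%:E.

Definition weakly_converges (m : nat -> set (seq_space a) -> \bar R)
    (mu : {finite_measure set (seq_space a) -> \bar R}) :=
  forall f : seq_topology a -> R,
    continuous f -> (exists M : R, forall i, (`|f i| <= M)%R) ->
    (fun k => \int[m k]_i (f i)%:E) @ \oo --> \int[mu]_i (f i)%:E.

Definition ifs_map (c : letter a) (x : R) : R := (a%:R^-1 * x + c%:R * a%:R^-1)%R.

Definition coding (i : seq_space a) : R :=
  limn (fun n => foldr ifs_map 0%R (prefix_word i n)).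

End cascade.

Lemma measurable_letter (R : realType) a (j : nat) :
  measurable_fun [set: seq_space a] (fun i : seq_space a => (i j : letter a)%:R : R).
Proof.
move=> _ B mB; rewrite setTI; apply: sub_sigma_algebra.
rewrite (_ : _ @^-1` _ = (proj j : seq_topology a -> discrete_topology (letter a)) @^-1` [set c | B (c%:R)])//.
apply: open_comp => [x _|]; last exact: discrete_open.
exact: (@proj_continuous nat (fun=> discrete_topology (letter a)) j).
Qed.

Lemma ifs_map_itv (R : realType) a (c : letter a) (x : R) : 0 <= x <= 1 -> 0 <= ifs_map c x <= 1.
Proof.
move=> /andP[x0 x1]; rewrite /ifs_map; case: a c => [|a] c.
  by rewrite invr0 mul0r mulr0 addr0 lexx ler01.
rewrite addr_ge0 ?mulr_ge0 ?invr_ge0//= mulrC -mulrDl ler_pdivrMr ?ltr0n// mul1r.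
have : (c%:R : R) <= a%:R by rewrite ler_nat -ltnS; exact: (ltn_ord c).
by rewrite -natr1; lra.
Qed.

Lemma ifs_map_le (R : realType) a (c : letter a) (x y : R) : x <= y -> ifs_map c x <= ifs_map c y.
Proof. by move=> xy; rewrite lerD2r ler_wpM2l ?invr_ge0. Qed.

Lemma coding_cvg (R : realType) a (i : seq_space a) :
  (fun n => foldr (@ifs_map R a) 0 (prefix_word i n)) @ \oo --> (coding i : R).
Proof.
have H01 (s : word a) : 0 <= foldr (@ifs_map R a) 0 s <= 1.
  by elim: s => [|c s ih]/=; [rewrite lexx ler01|exact: ifs_map_itv].
apply: nondecreasing_is_cvgn.
  apply/nondecreasing_seqP => n.
  rewrite /prefix_word -addn1 iotaD map_cat foldr_cat /=.
  have : 0 <= ifs_map (i (0 + n)%N : letter a) (0 : R).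
    by have /andP[] := @ifs_map_itv R a (i (0+n)%N) 0 ltac:(by rewrite lexx ler01).
  move: (iota 0 n) (ifs_map _ 0) => s y y0; elim: s => //= k s ih; exact: ifs_map_le.
by exists 1 => _ [n _ <-]; case/andP: (H01 (prefix_word i n)).
Qed.

Lemma measurable_coding (R : realType) a : measurable_fun [set: seq_space a] (@coding R a).
Proof.
apply: (@measurable_fun_cvg _ _ _ _ (fun n i => foldr (@ifs_map R a) 0 (prefix_word i n))); last first.
  by move=> i _; exact: coding_cvg.
move=> n; rewrite /prefix_word; elim: (iota 0 n) => [|k s ih] /=; first exact: measurable_cst.
apply: measurable_funD; apply: measurable_funM => //.
exact: measurable_letter.
Qed.

Section cascade_measure.
Context {R : realType} {a : nat}.
Variable mu : {finite_measure set (seq_space a) -> \bar R}.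
Local Open Scope ereal_scope.

Definition cascade_measure : set R -> \bar R := pushforward mu (@coding R a).

Let cascade_measure0 : cascade_measure set0 = 0.
Proof. by rewrite /cascade_measure /pushforward preimage_set0 measure0. Qed.

Let cascade_measure_ge0 A : 0 <= cascade_measure A.
Proof. by rewrite /cascade_measure /pushforward measure_ge0. Qed.

Let cascade_measure_sigma_additive : semi_sigma_additive cascade_measure.
Proof.
move=> F mF tF mUF.
exact: (@measure_semi_sigma_additive _ _ _
  (measure_function_pushforward__canonical__measure_function_Measure mu
     (@measurable_coding R a))).
Qed.

HB.instance Definition _ := isMeasure.Build _ _ _ cascade_measure
  cascade_measure0 cascade_measure_ge0 cascade_measure_sigma_additive.

Let cascade_measure_fin : fin_num_fun cascade_measure.
Proof.
move=> A mA; apply: fin_num_measure.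
by rewrite -[X in measurable X]setTI; exact: measurable_coding.
Qed.

HB.instance Definition _ := Measure_isFinite.Build _ _ _ cascade_measure
  cascade_measure_fin.

End cascade_measure.

Section convolution.
Context {R : realType}.
Variables m1 m2 : {finite_measure set R -> \bar R}.
Local Open Scope ereal_scope.

Definition convolution : set R -> \bar R :=
  pushforward (m1 \x m2) (fun z : R * R => (z.1 + z.2)%R).

Let convolution0 : convolution set0 = 0.
Proof. by rewrite /convolution /pushforward preimage_set0 measure0. Qed.

Let convolution_ge0 A : 0 <= convolution A.
Proof. by rewrite /convolution /pushforward measure_ge0. Qed.

Let convolution_sigma_additive : semi_sigma_additive convolution.
Proof.
move=> F mF tF mUF.
have mD : measurable_fun [set: R * R] (fun z : R * R => (z.1 + z.2)%R).
  by apply: measurable_funD; [exact: measurable_fst|exact: measurable_snd].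
exact: (@measure_semi_sigma_additive _ _ _
  (measure_function_pushforward__canonical__measure_function_Measure
     (m1 \x m2) mD)).
Qed.

HB.instance Definition _ := isMeasure.Build _ _ _ convolution
  convolution0 convolution_ge0 convolution_sigma_additive.

End convolution.

Definition exact_dim {R : realType} (m : {measure set R -> \bar R}) (D : R) :=
  {ae m, forall x : R,
    (fun r : R => ln (fine (m (ball x r))) / ln r) @ 0^'+ --> D}.

(* Main.v *)
(** Let [Q_u] be the product of the weights along the path to the word [u]. Weighting the
    probability by [Q_u] (Peyriere) makes the weights along [u] independent with the size-biased
    law of [V], so the law of large numbers gives [Q_{u|m} <= C e^{m (h_V + e)}] for all [m] at
    once, with probability close to 1 and [C] independent of [u]. Given the weights along [u], a
    word [u'] that branches off [u] at level [m] has expected weight [Q_{u|m}], as the weights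
    beyond the branching have mean 1. Seen from a typical point, the expected mass of a ball of
    radius [r] for the convolution is therefore at most the sum over branching levels [m, m'] of
    [e^{m (h_V + e)} e^{m' (h_W + e)}] times the uniform mass of the pairs of sequences that agree
    with the given pair up to [m] and [m'] and whose codings have a sum within [O(r)] of the given
    one. Up to constants this mass is at most [min (A B, r A, r B)] with [A = a^-m], [B = b^-m'],
    hence at most [A^{1 - s1} B^{1 - s2} r^{s1 + s2}] when [s1, s2 >= 0] and [s1 + s2 <= 1]. For
    [s1 < 1 - h_V / log a] and [s2 < 1 - h_W / log b] the sum is geometric and of order
    [r^{s1 + s2}], and a Borel-Cantelli argument bounds the local dimension from below by
    [min {1, D_V + D_W}]. From above, the size-biased law of large numbers shows that typical
    cylinders are not too light, which yields [D_V], [D_W], and [D_V + D_W] because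
    [B(x, r/2) + B(y, r/2)] lies in [B(x + y, r)]; the bound 1 holds for every finite measure on a
    bounded interval. *)
Require Import Defs.
From HB Require Import structures.
From mathcomp Require Import all_boot all_order all_algebra.
From mathcomp Require Import all_classical all_reals all_analysis.
From mathcomp Require Import measurable_realfun lra ring zify.
Import Order.TTheory GRing.Theory Num.Theory.
Import numFieldNormedType.Exports.
Set Implicit Arguments.
Unset Strict Implicit.
Unset Printing Implicit Defensive.
Local Open Scope classical_set_scope.
Local Open Scope ring_scope.

(** * Expectation and independence *)

(** The weights have only a finite [x ln x] moment, so under the size-biased law the logarithm of a
    weight is in general merely integrable from above. An exponential Markov inequality is available
    only after capping it; what the cap removes is handled by a weak law over dyadic blocks.
    Downwards the size bias itself supplies the exponential moment: [x * expR (- ln x / 2)] is the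
    square root of [x], which is bounded near 0. The limit masses of cylinders are known only as
    limits of finite-level masses. Every estimate, including the one showing that cylinders are not
    too light, is therefore an upper bound on an expectation, which passes to the limit by Fatou.
    Balls are replaced by sets of words with close left endpoints, so bad events become finite sums
    over words, measurable in the sample. Prefixes of [k] letters serve the scale [2^-k] in every
    base, since [a^-k <= 2^-k]. Both sequences are thus cut at the same length, and a pair of them
    becomes one sequence over the product alphabet. *)

Lemma measurable_limn_einf {R : realType} {d} {T : measurableType d} (f : nat -> T -> \bar R) :
  (forall n, measurable_fun setT (f n)) ->
  measurable_fun setT (fun t => limn_einf (fun n => f n t)).
Proof.
move=> mf; rewrite (_ : (fun t => _) = (fun t => - limn_esup (fun n => - f n t))%E)//.
by apply: measurableT_comp => //; apply: measurable_fun_limn_esup => n; exact: measurableT_comp.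
Qed.

Lemma limn_einf_le {R : realType} (u : nat -> \bar R) (c : \bar R) :
  (forall n, (u n <= c)%E) -> (limn_einf u <= c)%E.
Proof.
move=> uc; rewrite limn_einf_lim; apply: lime_le; first exact: is_cvg_einfs.
by apply: nearW => n; apply: le_trans (uc n); apply: ereal_inf_lbound; exists n => /=.
Qed.

Lemma limn_einf_ge {R : realType} (u : nat -> \bar R) (c : \bar R) :
  (forall n, (c <= u n)%E) -> (c <= limn_einf u)%E.
Proof.
move=> uc; rewrite limn_einf_lim; apply: lime_ge; first exact: is_cvg_einfs.
by apply: nearW => n; apply: le_ereal_inf_tmp => _ [k _ <-].
Qed.

Lemma limn_einf_mono {R : realType} (u v : nat -> \bar R) :
  (forall n, (u n <= v n)%E) -> (limn_einf u <= limn_einf v)%E.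
Proof.
move=> uv; rewrite !limn_einf_lim; apply: lee_lim; [exact: is_cvg_einfs|exact: is_cvg_einfs|].
apply: nearW => n; apply: le_ereal_inf_tmp => _ [k /= nk <-].
by apply: le_trans (uv k); apply: ereal_inf_lbound; exists k.
Qed.

Section expectation_nonneg.
Context {R : realType} {d : measure_display} {T : measurableType d}.
Variable P : {measure set T -> \bar R}.
Local Open Scope ereal_scope.

Implicit Types f g : T -> R.

Definition Ex (f : T -> R) : \bar R := \int[P]_t (f t)%:E.

Lemma Ex_ge0 f : (forall t, 0 <= f t)%R -> 0 <= Ex f.
Proof. by move=> f0; apply: integral_ge0 => t _; rewrite lee_fin. Qed.

Lemma Ex_le f g : measurable_fun setT f -> measurable_fun setT g ->
  (forall t, 0 <= f t)%R -> (forall t, f t <= g t)%R -> Ex f <= Ex g.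
Proof.
move=> mf mg f0 fg; apply: ge0_le_integral => //.
- by move=> t _; rewrite lee_fin.
- exact/measurable_EFinP.
- exact/measurable_EFinP.
- by move=> t _; rewrite lee_fin.
Qed.

Lemma ExZ (c : R) f : measurable_fun setT f -> (forall t, 0 <= f t)%R -> (0 <= c)%R ->
  Ex (fun t => c * f t)%R = c%:E * Ex f.
Proof.
move=> mf f0 c0; rewrite /Ex; under eq_integral do rewrite EFinM.
rewrite ge0_integralZl//; first exact/measurable_EFinP.
by move=> t _; rewrite lee_fin.
Qed.

Lemma ExD f g : measurable_fun setT f -> measurable_fun setT g ->
  (forall t, 0 <= f t)%R -> (forall t, 0 <= g t)%R ->
  Ex (fun t => f t + g t)%R = Ex f + Ex g.
Proof.
move=> mf mg f0 g0; rewrite /Ex; under eq_integral do rewrite EFinD.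
rewrite ge0_integralD//; try exact/measurable_EFinP.
- by move=> t _; rewrite lee_fin.
- by move=> t _; rewrite lee_fin.
Qed.

Lemma Ex_sum (J : Type) (s : seq J) (p : pred J) (f : J -> T -> R) :
  (forall j, measurable_fun setT (f j)) -> (forall j t, 0 <= f j t)%R ->
  Ex (fun t => \sum_(j <- s | p j) f j t)%R = \sum_(j <- s | p j) Ex (f j).
Proof.
move=> mf f0; rewrite /Ex -big_filter; under eq_integral do rewrite -big_filter -sumEFin.
rewrite ge0_integral_sum//.
- by move=> j; exact/measurable_EFinP.
- by move=> j t _; rewrite lee_fin.
Qed.

Lemma eq_Ex f g : (forall t, f t = g t) -> Ex f = Ex g.
Proof. by move=> fg; congr Ex; apply/funext. Qed.

Lemma fatou_le (f_ : nat -> T -> R) (f : T -> R) (c : \bar R) :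
  (forall n, measurable_fun setT (f_ n)) -> (forall n t, 0 <= f_ n t)%R ->
  measurable_fun setT f ->
  {ae P, forall t, f_ n t @[n --> \oo] --> f t} ->
  (\forall n \near \oo, Ex (f_ n) <= c) -> Ex f <= c.
Proof.
move=> mf_ f_0 mf ff le_c.
have -> : Ex f = \int[P]_t limn_einf (fun n => (f_ n t)%:E).
  apply: ae_eq_integral => //.
  - exact/measurable_EFinP.
  - by apply: measurable_limn_einf => n; exact/measurable_EFinP.
  case: ff => A [mA A0 fA]; exists A; split => // t /= tA; apply: fA => /= ft; apply: tA => _.
  have /cvg_limn_einf_sup[-> _] // : (f_ n t)%:E @[n --> \oo] --> (f t)%:E.
  by apply: cvg_EFin; [exact: nearW|exact: ft].
apply: (le_trans (fatou _ _ _ _)) => //.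
- by move=> n; exact/measurable_EFinP.
- by move=> n t _; rewrite lee_fin.
rewrite limn_einf_lim; apply: lime_le; first exact: is_cvg_einfs.
case: le_c => N _ le_c; exists N => // n /= Nn.
by apply: (le_trans _ (le_c n Nn)); apply: ereal_inf_lbound; exists n => /=.
Qed.

End expectation_nonneg.

Section factorization.
Context {R : realType} {d : measure_display} {T : measurableType d}.
Variable P : probability T R.
Local Open Scope ereal_scope.

(** Independence identifies the joint law of [F] and [G] with the product of their laws, and Tonelli
    then separates the two variables. *)
Lemma Ex_indep (F G : T -> R) : measurable_fun setT F -> measurable_fun setT G ->
  (forall t, 0 <= F t)%R -> (forall t, 0 <= G t)%R ->
  independent_RV2 P F G -> Ex P (fun t => F t * G t)%R = Ex P F * Ex P G.
Proof.
move=> mF mG F0 G0 FG.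
pose F' := MeasurableFun.Pack (MeasurableFun.Class (isMeasurableFun.Build _ _ _ _ F mF)).
pose G' := MeasurableFun.Pack (MeasurableFun.Class (isMeasurableFun.Build _ _ _ _ G mG)).
pose mFG : measurable_fun setT (fun t => (F t, G t)) := measurable_fun_pair mF mG.
pose FG' := MeasurableFun.Pack (MeasurableFun.Class (isMeasurableFun.Build _ _ _ _ _ mFG)).
pose Q : {measure set (R * R) -> \bar R} := distribution P FG'.
have key X : measurable X -> (distribution P F' \x distribution P G') X = Q X.
  apply: product_measure_unique => A B mA mB.
  by rewrite /Q /= /distribution /pushforward /= -FG.
(* Clipping at 0 makes the integrand nonnegative on all of [R], as the change of variables and
   Tonelli require; it does not alter the values of [F] and [G]. *)
pose h (x : R) := Num.max x 0%R.
have mh : measurable_fun setT h by apply: measurable_maxr => //.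
have h0 x : (0 <= h x)%R by rewrite /h le_max lexx orbT.
have hF t : h (F t) = F t by apply/max_idPl.
have hG t : h (G t) = G t by apply/max_idPl.
have -> : Ex P (fun t => F t * G t)%R =
    \int[Q]_z (h z.1 * h z.2)%:E.
  rewrite /Q ge0_integral_distribution//.
  - by apply: eq_integral => t _ /=; rewrite hF hG.
  - apply/measurable_EFinP; apply: measurable_funM; apply: measurableT_comp => //.
  - by move=> z; rewrite lee_fin mulr_ge0.
have -> : Ex P F = \int[distribution P F']_x (h x)%:E.
  rewrite ge0_integral_distribution//.
  - by apply: eq_integral => t _ /=; rewrite hF.
  - exact/measurable_EFinP.
have -> : Ex P G = \int[distribution P G']_x (h x)%:E.
  rewrite ge0_integral_distribution//.
  - by apply: eq_integral => t _ /=; rewrite hG.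
  - exact/measurable_EFinP.
have -> : \int[Q]_z (h z.1 * h z.2)%:E =
    \int[distribution P F' \x distribution P G']_z (h z.1 * h z.2)%:E.
  by apply: eq_measure_integral => A mA _; rewrite -key.
rewrite fubini_tonelli1//=; last 2 first.
- by apply/measurable_EFinP; apply: measurable_funM; apply: measurableT_comp.
- by move=> z; rewrite lee_fin mulr_ge0.
rewrite /fubini_F/=.
under eq_integral => x _.
  under eq_integral do rewrite EFinM.
  rewrite ge0_integralZl//; last 3 first.
  - exact/measurable_EFinP.
  - by move=> *; rewrite lee_fin.
  - by rewrite lee_fin.
  over.
rewrite ge0_integralZr//.
- exact/measurable_EFinP.
- by move=> *; rewrite lee_fin.
- by apply: integral_ge0 => *; rewrite lee_fin.
Qed.

End factorization.

Section sub_sigma_algebra.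
Context {R : realType} {d : measure_display} {T : measurableType d}.
Variable P : probability T R.
Local Open Scope ereal_scope.

Section family.
Context {I : choiceType}.
Variable X : I -> T -> R.

Definition sigma_sys (A : set I) : set (set T) :=
  \bigcup_(i in A) preimage_set_system [set: T] (X i) (@measurable _ R).

(** Dependence on the variables indexed by [A] alone, phrased as measurability for the sigma-algebra
    that they generate, so that the closure rules for sums, products and comparisons apply as they
    stand. *)
Definition sigma_fun (A : set I) (F : T -> R) :=
  measurable_fun [set: g_sigma_algebraType (sigma_sys A)] F.

Hypothesis mX : forall i, measurable_fun setT (X i).

Lemma sigma_sys_measurable A E : <<s sigma_sys A>> E -> measurable E.
Proof.
move=> /(_ measurable); apply; split.
- exact: sigma_algebra_measurable.
- by move=> _ [i Ai [B mB <-]]; rewrite setTI -[X in measurable X]setTI; exact: mX.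
Qed.

Lemma sigma_fun_measurable A F : sigma_fun A F -> measurable_fun setT F.
Proof.
move=> mF _ B mB; apply: (@sigma_sys_measurable A).
exact: (mF measurableT B mB).
Qed.

Lemma sigma_fun_sub A A' F : A `<=` A' -> sigma_fun A F -> sigma_fun A' F.
Proof.
move=> AA' mF _ B mB; have := mF measurableT B mB.
by apply: sub_sigma_algebra2 => E [i Ai ?]; exists i => //; exact: AA'.
Qed.

Lemma sigma_fun_var A i : A i -> sigma_fun A (X i).
Proof.
move=> Ai _ B mB; apply: sub_sigma_algebra; exists i => //.
by exists B.
Qed.

(** A uniqueness argument on a pi-system: events given by finitely many variables of [A] are stable
    under intersection and generate, and on them the identity is mutual independence with [j] added
    to the list of indices. *)
Lemma mutually_independent_sigma A j E B : mutually_independent P X ->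
  ~ A j -> <<s sigma_sys A>> E -> measurable B ->
  P (E `&` X j @^-1` B) = P E * P (X j @^-1` B).
Proof.
move=> iX Aj AE mB.
pose G : set (set T) := [set E | exists (s : seq I) (C : I -> set R),
  [/\ uniq s, (forall i, measurable (C i)), (forall i, i \in s -> A i) &
      E = \bigcap_(i in [set` s]) (X i @^-1` C i)]].
have sG : <<s sigma_sys A>> = <<s G>>.
  apply/seteqP; split.
    apply: smallest_sub; first exact: smallest_sigma_algebra.
    move=> _ [i Ai [C mC <-]]; apply: sub_sigma_algebra.
    exists [:: i], (fun=> C); split => //; first by move=> k; rewrite inE => /eqP->.
    by rewrite setTI; apply/seteqP; split => t /= h; [move=> k /=; rewrite inE => /eqP -> //|apply:
      (h i); rewrite /= inE].
  apply: smallest_sub; first exact: smallest_sigma_algebra.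
  move=> _ [s [C [_ mC sA ->]]].
  have -> : \bigcap_(i in [set` s]) (X i @^-1` C i) = \bigcap_(i in [set` s])
    (X i @^-1` C i : set (g_sigma_algebraType (sigma_sys A))) by [].
  apply: (@fin_bigcap_measurable _ (g_sigma_algebraType (sigma_sys A))) => // i /= /sA Ai.
  by rewrite -[X in measurable X]setTI; exact: (sigma_fun_var Ai).
have IG : setI_closed G.
  move=> _ _ [s1 [C1 [_ mC1 s1A ->]]] [s2 [C2 [_ mC2 s2A ->]]].
  exists (undup (s1 ++ s2)), (fun i => (if i \in s1 then C1 i else setT) `&`
    (if i \in s2 then C2 i else setT)); split.
  - exact: undup_uniq.
  - by move=> i; apply: measurableI; case: ifP.
  - by move=> i; rewrite mem_undup mem_cat => /orP[/s1A|/s2A].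
  - apply/seteqP; split => t /=.
    + by move=> [h1 h2] i /= _; split; case: ifP => // ?; [exact: h1|exact: h2].
    + move=> h; split => i /= si; have := h i; rewrite /= mem_undup mem_cat si ?orbT => /(_ isT)
      []//.
have [mE mXB] : measurable E /\ measurable (X j @^-1` B).
  split; first exact: sigma_sys_measurable AE.
  by rewrite -[X in measurable X]setTI; exact: mX.
have mid : @measurable_fun _ _ T (g_sigma_algebraType G) setT id.
  move=> _ C; rewrite setTI preimage_id -[_ C]/(<<s G>> C) -sG; exact: sigma_sys_measurable.
(* Both sides of the claim, as functions of [E], are turned into measures on the generated
   sigma-algebra by pushing forward along the identity. *)
pose m1 : {measure set (g_sigma_algebraType G) -> \bar R} :=
  measure_function_pushforward__canonical__measure_function_Measure (mrestr P mXB) mid.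
have c0 : (0 <= fine (P (X j @^-1` B)))%R by exact: fine_ge0.
pose m2 : {measure set (g_sigma_algebraType G) -> \bar R} :=
  measure_function_pushforward__canonical__measure_function_Measure (mscale (NngNum c0) P) mid.
have /= : m1 E = m2 E.
  apply: (@measure_unique _ R (g_sigma_algebraType G) G (fun=> setT) _ _ _ _ m1 m2) => //.
  - move=> _; exists [::], (fun=> setT); split => //.
    by apply/seteqP; split => // t _ i.
  - by rewrite bigcup_const//; exists 0%N.
  - move=> _ [s [C [us mC sA ->]]].
    rewrite /= /pushforward /mrestr /mscale /= preimage_id.
    (* Since [s] is contained in [A] and [j] is not in [A], the list [j :: s] has no repetition and
       the families [C] and [C'] agree on [s]. *)
    pose C' i := if i == j then B else C i.
    have js : j \notin s by apply/negP => /sA.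
    have C's i : i \in s -> C' i = C i.
      by move=> si; rewrite /C'; case: eqP => // ij; rewrite -ij si in js.
    have := iX (j :: s) C'; rewrite /= js us => /(_ isT).
    have mC' i : measurable (C' i) by rewrite /C'; case: ifP.
    move=> /(_ mC'); rewrite big_cons {2}/C' eqxx.
    have -> : \bigcap_(i in [set` j :: s]) X i @^-1` C' i =
              (\bigcap_(i in [set` s]) X i @^-1` C i) `&` X j @^-1` B.
      apply/seteqP; split => t /=.
        move=> h; split; last by have := h j; rewrite /= inE eqxx /C' eqxx; exact.
        by move=> i /= si; rewrite -C's//; apply: h; rewrite /= inE si orbT.
      move=> [h1 h2] i /=; rewrite inE => /orP[/eqP->|si]; first by rewrite /C' eqxx.
      by rewrite C's//; exact: h1.
    move=> ->; rewrite fineK ?fin_num_measure//; congr (_ * _).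
    have -> : \prod_(i <- s) P (X i @^-1` C' i) = \prod_(i <- s) P (X i @^-1` C i).
      by rewrite !big_seq; apply: eq_bigr => i si; rewrite C's.
    by rewrite iX.
  - move=> _; rewrite /= /pushforward /mrestr preimage_setT setTI.
    by rewrite (le_lt_trans (probability_le1 P mXB))// ltry.
  - by rewrite -[_ E]/(<<s G>> E) -sG.
by rewrite /pushforward /mrestr /mscale /= preimage_id fineK ?fin_num_measure// muleC.
Qed.

Lemma Ex_sigma A j F (g : R -> R) : mutually_independent P X ->
  ~ A j -> sigma_fun A F -> (forall t, 0 <= F t)%R ->
  measurable_fun setT g -> (forall x, 0 <= g x)%R ->
  Ex P (fun t => F t * g (X j t))%R = Ex P F * Ex P (fun t => g (X j t)).
Proof.
move=> iX Aj mF F0 mg g0; apply: Ex_indep => //.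
- exact: sigma_fun_measurable mF.
- exact: measurableT_comp.
move=> B C mB mC; rewrite -[(fun t => g (X j t)) @^-1` C]/(X j @^-1` (g @^-1` C)).
apply: (mutually_independent_sigma iX Aj).
- by have := mF measurableT B mB; rewrite setTI.
- by rewrite -[X in measurable X]setTI; exact: mg.
Qed.

Lemma Ex_prod (s : seq I) (g : I -> R -> R) : mutually_independent P X -> uniq s ->
  (forall i, measurable_fun setT (g i)) -> (forall i x, 0 <= g i x)%R ->
  Ex P (fun t => \prod_(i <- s) g i (X i t))%R =
  \prod_(i <- s) Ex P (fun t => g i (X i t)).
Proof.
move=> iX + mg g0; elim: s => [_|j s ih /= /andP[js us]].
  rewrite big_nil /Ex; under eq_integral do rewrite big_nil.
  by rewrite integral_cst// mul1e; exact: probability_setT.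
rewrite big_cons -ih// muleC -(@Ex_sigma [set` s] j)//=.
- by apply: eq_Ex => t; rewrite big_cons mulrC.
- exact/negP.
- apply: measurable_prod => i si; apply: measurableT_comp => //; exact: sigma_fun_var.
- by move=> t; apply: prodr_ge0.
Qed.

End family.

Lemma Ex_independent_families {I J : choiceType} (X : I -> T -> R) (Y : J -> T -> R) F G :
  (forall i, measurable_fun setT (X i)) -> (forall j, measurable_fun setT (Y j)) ->
  independent_families P X Y ->
  sigma_fun X setT F -> sigma_fun Y setT G ->
  (forall t, 0 <= F t)%R -> (forall t, 0 <= G t)%R ->
  Ex P (fun t => F t * G t)%R = Ex P F * Ex P G.
Proof.
move=> mX mY XY mF mG F0 G0; apply: Ex_indep => //.
- exact: sigma_fun_measurable mF.
- exact: sigma_fun_measurable mG.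
move=> B C mB mC; apply: XY.
- by have := mF measurableT B mB; rewrite setTI.
- by have := mG measurableT C mC; rewrite setTI.
Qed.

End sub_sigma_algebra.

Lemma same_law_Ex {R : realType} {d d' : measure_display}
    {T : measurableType d} {T' : measurableType d'}
    (P : probability T R) (P' : probability T' R)
    (X : {RV P >-> R}) (Y : {RV P' >-> R}) (g : R -> R) :
  same_law X Y -> measurable_fun setT g -> (forall x, 0 <= g x) ->
  Ex P (fun t => g (X t)) = Ex P' (fun t => g (Y t)).
Proof.
move=> XY mg g0.
have mg' : measurable_fun setT (EFin \o g) by exact/measurable_EFinP.
have g0' x : (0 <= (EFin \o g) x)%E by rewrite lee_fin.
rewrite /Ex -[LHS](ge0_integral_distribution X mg' g0').
rewrite -[RHS](ge0_integral_distribution Y mg' g0').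
by apply: eq_measure_integral => A mA _; exact: XY.
Qed.

(** * Size-biased weights along a path *)

Definition path_weight {R : realType} {L : Type} {T : Type} (X : seq L -> T -> R) (u : seq L)
  (t : T) : R :=
  \prod_(1 <= j < (size u).+1) X (take j u) t.

Section tree.
Context {R : realType} {d : measure_display} {T : measurableType d}.
Variable P : probability T R.
Context {L : choiceType}.
Variable X : seq L -> T -> R.
Hypothesis mX : forall u, measurable_fun setT (X u).
Hypothesis X0 : forall u t, 0 <= X u t.
Hypothesis iX : mutually_independent P X.
Hypothesis X1 : forall u, Ex P (X u) = 1%E.

Local Notation Q := (path_weight X).

Lemma path_weight_ge0 u t : 0 <= Q u t.
Proof. by apply: prodr_ge0. Qed.

Lemma path_weight0 t : Q [::] t = 1.
Proof. by rewrite /path_weight big_geq. Qed.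

Lemma path_weight_take k u t : (k <= size u)%N ->
  Q (take k u) t = \prod_(1 <= j < k.+1) X (take j u) t.
Proof.
move=> ku; rewrite /path_weight size_takel// !big_nat.
by apply: eq_bigr => j /andP[_ jk]; rewrite take_takel.
Qed.

Lemma path_weightS k u t : (k < size u)%N ->
  Q (take k.+1 u) t = Q (take k u) t * X (take k.+1 u) t.
Proof. by move=> ku; rewrite !path_weight_take ?(ltnW ku)// big_nat_recr. Qed.

Lemma path_weight_cat u v t :
  Q (u ++ v) t = Q u t * \prod_((size u).+1 <= j < (size (u ++ v)).+1) X (take j (u ++ v)) t.
Proof.
rewrite {1}/path_weight (@big_cat_nat _ _ _ (size u).+1)//=; last by rewrite ltnS size_cat leq_addr.
congr (_ * _); rewrite /path_weight !big_nat; apply: eq_bigr => j /andP[_ ju].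
by rewrite takel_cat.
Qed.

Lemma sigma_path_weight (A : set (seq L)) u :
  (forall j, (0 < j <= size u)%N -> A (take j u)) -> sigma_fun X A (Q u).
Proof.
move=> uA; rewrite /sigma_fun /path_weight.
apply: measurable_prod => j; rewrite mem_index_iota ltnS => /uA; exact: sigma_fun_var.
Qed.

Lemma measurable_path_weight u : measurable_fun setT (Q u).
Proof. by apply: measurable_prod. Qed.

(* The weights of the prefixes of [u] outside [A] integrate to 1 one at a time, starting
   from the longest. *)
Lemma Ex_path_weight_take (A : set (seq L)) F u m : sigma_fun X A F -> (forall t, 0 <= F t) ->
  (m <= size u)%N -> (forall j, (m < j <= size u)%N -> ~ A (take j u)) ->
  Ex P (fun t => F t * Q u t) = Ex P (fun t => F t * Q (take m u) t).
Proof.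
move=> mF F0 mu Au.
suff : forall k, (m <= k <= size u)%N ->
    Ex P (fun t => F t * Q (take k u) t) = Ex P (fun t => F t * Q (take m u) t).
  by move/(_ (size u)); rewrite mu leqnn take_size; exact.
elim=> [|k ih]; first by rewrite leqn0 => /andP[/eqP -> _].
rewrite leq_eqVlt => /andP[/orP[/eqP <-//|mk] ku]; rewrite -ih; last by rewrite (ltnW ku) -ltnS mk.
pose A' := A `|` [set w | exists2 j, (j <= k)%N & w = take j u].
transitivity (Ex P (fun t => F t * Q (take k u) t * `|X (take k.+1 u) t|)).
  by apply: eq_Ex => t; rewrite path_weightS// mulrA ger0_norm.
rewrite (@Ex_sigma _ _ _ _ _ _ mX A' (take k.+1 u) _ (fun x => `|x|))//.
- have -> : Ex P (fun t => `|X (take k.+1 u) t|) = Ex P (X (take k.+1 u)).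
    by apply: eq_Ex => t; rewrite ger0_norm.
  by rewrite X1 mule1.
- move=> [|[j jk /(congr1 size)]]; first by apply: Au; rewrite mk.
  by rewrite !size_takel// ?(leq_trans jk) ?(ltnW ku)//; lia.
- apply: measurable_funM; first by apply: sigma_fun_sub mF; exact: subsetUl.
  apply: sigma_path_weight => j; rewrite size_takel ?(ltnW ku)// => /andP[_ jk].
  by right; exists j => //; rewrite take_takel.
- by move=> t; rewrite mulr_ge0// path_weight_ge0.
Qed.

Lemma Ex_path_weight u : Ex P (Q u) = 1%E.
Proof.
transitivity (Ex P (fun t => 1 * Q u t)); first by apply: eq_Ex => t; rewrite mul1r.
rewrite (@Ex_path_weight_take set0 (fun=> 1) u 0)//; [|exact: measurable_cst|by move=> j _ []].
transitivity (Ex P (fun=> 1)).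
  by apply: eq_Ex => t; rewrite take0 path_weight0 mulr1.
by rewrite /Ex integral_cst// mul1e; exact: probability_setT.
Qed.

(** The prefixes of [u] have distinct lengths, so their weights are independent, and the factor of
    [Q u] at each prefix can be grouped with the matching [g]: this is the size-biased law along the
    path. *)
Lemma Ex_spine u (g : nat -> R -> R) : (forall j, measurable_fun setT (g j)) ->
  (forall j x, 0 <= g j x) ->
  Ex P (fun t => Q u t * \prod_(1 <= j < (size u).+1) g j (X (take j u) t)) =
  (\prod_(1 <= j < (size u).+1) Ex P (fun t => (X (take j u) t * g j (X (take j u) t))%R))%E.
Proof.
move=> mg g0.
pose s := [seq take j u | j <- index_iota 1 (size u).+1].
have us : uniq s.
  rewrite map_inj_in_uniq ?iota_uniq// => i j; rewrite !mem_index_iota !ltnS => /andP[_ iu]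
    /andP[_ ju].
  by move=> /(congr1 size); rewrite !size_takel.
(* The index of a prefix is recovered as its length. The absolute value only makes the factor
   nonnegative on all of [R]. *)
have := @Ex_prod _ _ _ P _ X mX s (fun w x => `|x| * g (size w) x) iX us.
rewrite !big_map.
under eq_Ex do rewrite big_map.
have e : forall j t, (0 < j < (size u).+1)%N -> `|X (take j u) t| * g (size (take j u))
  (X (take j u) t) =
   X (take j u) t * g j (X (take j u) t).
  by move=> j t /andP[_ ju]; rewrite size_takel// ger0_norm.
under eq_Ex => t do rewrite (eq_big_nat _ _ (e^~ t)).
under [RHS]eq_big_nat => j hj do under eq_Ex => t do rewrite (e j t hj)//.
move=> <-.
- by apply: eq_Ex => t; rewrite -big_split.
- move=> w; apply: measurable_funM => //; exact: measurableT_comp.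
- by move=> w x; rewrite mulr_ge0.
Qed.

End tree.

(** * Elementary inequalities for the exponential and the logarithm *)

Section real_inequalities.
Context {R : realType}.
Implicit Types x y t : R.

(** Both cases multiply a first-order bound for [expR y - 1] by [y]: for [y >= 0] the bound
    [y * expR y], and for [y < 0] the bound [y], where the inequality reverses and no exponential is
    lost. *)
Lemma expR_le_quadratic y : expR y <= 1 + y + y ^+ 2 * expR `|y|.
Proof.
have h : expR y - 1 <= y * expR y.
  have := expR_ge1Dx (- y); rewrite -(ler_pM2l (expR_gt0 y)) expRxMexpNx_1 mulrDr; lra.
have e1 := expR_ge1Dx y.
have [y0|y0] := leP 0 y.
  have : y * (expR y - 1) <= y * (y * expR y) by rewrite ler_wpM2l.
  by rewrite ger0_norm// expr2; lra.
have : y * (expR y - 1) <= y * y by rewrite ler_nM2l//; lra.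
have : y ^+ 2 <= y ^+ 2 * expR `|y|.
  rewrite ler_peMr ?sqr_ge0//; have := expR_ge1Dx `|y|; have := normr_ge0 y; lra.
rewrite !expr2; lra.
Qed.

Lemma mul_ln_ge x : 0 <= x -> x - 1 <= x * ln x.
Proof.
rewrite le_eqVlt => /orP[/eqP<-|x0]; first by rewrite mul0r; lra.
have : ln (x^-1) <= x^-1 - 1.
  have := @le_ln1Dx R (x^-1 - 1); rewrite (_ : 1 + (x^-1 - 1) = x^-1); [apply|ring].
  have : 0 < x^-1 by rewrite invr_gt0.
  lra.
rewrite lnV ?posrE// => h.
have : x * - ln x <= x * (x^-1 - 1) by rewrite ler_pM2l.
rewrite mulrBr mulfV ?gt_eqF// mulr1 mulrN; lra.
Qed.

(** For [x >= 1] the capped logarithm lies in [[0, K]]. For [x < 1], with [y = - ln x], the left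
    side is [y^2 e^(-y/2)]; the constant 16 comes from [y / 4 <= e^(y/4)] squared. *)
Lemma truncated_ln_moment (K : R) x : 0 <= K -> 0 <= x ->
  x * Num.min (ln x) K ^+ 2 * expR (`|Num.min (ln x) K| / 2) <=
  (16 + K ^+ 2 * expR (K / 2)) * (1 + x).
Proof.
move=> K0; rewrite le_eqVlt => /orP[/eqP<-|x0].
  by rewrite !mul0r addr0 mulr1 addr_ge0// mulr_ge0 ?sqr_ge0 ?expR_ge0.
have [x1|x1] := leP 1 x.
  have l0 := ln_ge0 x1.
  have m0 : 0 <= Num.min (ln x) K by rewrite le_min l0 K0.
  have mK : Num.min (ln x) K <= K by rewrite ge_min lexx orbT.
  rewrite ger0_norm// -mulrA.
  have : Num.min (ln x) K ^+ 2 * expR (Num.min (ln x) K / 2) <= K ^+ 2 * expR (K / 2).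
    apply: ler_pM; rewrite ?sqr_ge0 ?expR_ge0//.
      by rewrite ler_sqr ?nnegrE.
    by rewrite ler_expR ler_pM2r.
  set A := Num.min _ _ ^+ 2 * _; set B := K ^+ 2 * _ => AB.
  have : x * A <= x * B by rewrite ler_pM2l.
  have : 0 <= B by rewrite mulr_ge0 ?sqr_ge0 ?expR_ge0.
  nra.
have l0 : ln x < 0 by apply: ln_lt0; rewrite x0 x1.
have -> : Num.min (ln x) K = ln x by apply/min_idPl; lra.
rewrite ltr0_norm//.
set y := - ln x; have xy : x = expR (- y) by rewrite /y opprK lnK.
have y0 : 0 < y by rewrite /y; lra.
have -> : ln x ^+ 2 = y ^+ 2 by rewrite /y sqrrN.
rewrite {1}xy mulrAC -expRD.
have -> : - y + y / 2 = - (y / 2) by lra.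
have h : y ^+ 2 <= 16 * expR (y / 2).
  have h4 := expR_ge1Dx (y / 4).
  have -> : expR (y / 2) = expR (y / 4) * expR (y / 4) by rewrite -expRD; congr expR; lra.
  have : (y / 4) * (y / 4) <= expR (y / 4) * expR (y / 4) by apply: ler_pM; lra.
  rewrite expr2; lra.
have : expR (- (y / 2)) * y ^+ 2 <= 16.
  apply: (@le_trans _ _ (expR (- (y / 2)) * (16 * expR (y / 2)))).
    by rewrite ler_pM2l ?expR_gt0.
  by rewrite mulrCA (mulrC (expR (- _))) expRxMexpNx_1 mulr1.
have : 0 <= K ^+ 2 * expR (K / 2) by rewrite mulr_ge0 ?sqr_ge0 ?expR_ge0.
nra.
Qed.

End real_inequalities.

(** * One weight under the size-biased law *)

Section weight.
Context {R : realType} {d : measure_display} {T : measurableType d}.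
Variable P : probability T R.
Variable V : T -> R.
Hypothesis mV : measurable_fun setT V.
Hypothesis V0 : forall t, 0 <= V t.
Hypothesis V1 : Ex P V = 1%E.

Lemma V_integrable : P.-integrable setT (EFin \o V).
Proof.
apply/integrableP; split; first exact/measurable_EFinP.
under eq_integral => t _ do rewrite /= ger0_norm//.
by rewrite -[X in (X < _)%E]/(Ex P V) V1 ltry.
Qed.

Lemma Ex_Rintegral f : P.-integrable setT (EFin \o f) ->
  Ex P f = (\int[P]_t f t)%:E.
Proof.
by move=> fi; rewrite /Rintegral fineK//; apply: integrable_fin_num.
Qed.

(** The size-biased moment generating function of [phi - c] has derivative [m - c < 0] at 0, and the
    moment hypothesis bounds the second-order remainder, so a small [t > 0] brings it below 1. *)
Lemma chernoff (phi : R -> R) (c B : R) :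
  measurable_fun setT phi -> 0 <= B ->
  (forall x, 0 <= x -> x * phi x ^+ 2 * expR (`|phi x| / 2) <= B * (1 + x)) ->
  P.-integrable setT (EFin \o (fun t => V t * phi (V t))) ->
  \int[P]_t (V t * phi (V t)) < c ->
  exists t theta : R, [/\ 0 < t, 0 < theta < 1 &
    (Ex P (fun w => V w * expR (t * (phi (V w) - c)))%R <= theta%:E)%E].
Proof.
move=> mphi B0 phiB ip; set m := \int[P]_t _ => mc.
(* The bound [1/2] matches the exponent in the moment hypothesis; the other bound keeps the
   quadratic term [2 t^2 B] below half of the linear gain [t (c - m)]. *)
pose t := Num.min (2^-1) ((c - m) / (4 * (B + 1))).
have t0 : 0 < t by rewrite lt_min invr_gt0 ltr0n/= divr_gt0 ?subr_gt0// mulr_gt0//; lra.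
have t12 : t <= 2^-1 by rewrite ge_min lexx.
have tB : t * (4 * (B + 1)) <= c - m.
  by rewrite -ler_pdivlMr ?ge_min ?lexx ?orbT// mulr_gt0//; lra.
(* The factor 2 is the mean of [1 + V], and [theta] results from [1 + z <= expR z]. *)
exists t, (expR (t * (m - c) + 2 * t ^+ 2 * B)); split=> //.
  rewrite expR_gt0 expR_lt1; nra.
have pt x : 0 <= x -> x * expR (t * (phi x - c)) <=
    expR (- (t * c)) * (x + t * (x * phi x) + t ^+ 2 * B * (1 + x)).
  move=> x0; rewrite mulrBr addrC expRD mulrCA ler_pM2l ?expR_gt0//.
  apply: (@le_trans _ _ (x * (1 + t * phi x + (t * phi x) ^+ 2 * expR `|t * phi x|))).
    by rewrite ler_wpM2l// expR_le_quadratic.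
  have : x * phi x ^+ 2 * expR `|t * phi x| <= B * (1 + x).
    apply: le_trans (phiB x x0); apply: ler_wpM2l; first by rewrite mulr_ge0 ?sqr_ge0.
    by rewrite ler_expR normrM (gtr0_norm t0) mulrC ler_wpM2l.
  rewrite -(ler_pM2l (exprn_gt0 2 t0)) exprMn; lra.
have i1 : P.-integrable setT (EFin \o (fun w => t * (V w * phi (V w)))).
  by have := integrableZl measurableT t ip; apply: eq_integrable.
have i2 : P.-integrable setT (EFin \o (fun w => 1 + V w)).
  have := integrableD measurableT (finite_measure_integrable_cst P 1 measurableT) V_integrable.
  by apply: eq_integrable.
have i3 : P.-integrable setT (EFin \o (fun w => t ^+ 2 * B * (1 + V w))).
  by have := integrableZl measurableT (t ^+ 2 * B) i2; apply: eq_integrable.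
have i4 : P.-integrable setT (EFin \o (fun w => V w + t * (V w * phi (V w)))).
  by have := integrableD measurableT V_integrable i1; apply: eq_integrable.
have i5 : P.-integrable setT (EFin \o (fun w => V w + t * (V w * phi (V w)) + t ^+ 2 * B * (1 + V
  w))).
  by have := integrableD measurableT i4 i3; apply: eq_integrable.
have IV : \int[P]_w V w = 1 by apply: EFin_inj; rewrite -Ex_Rintegral ?V1//; exact: V_integrable.
have I5 : \int[P]_w (V w + t * (V w * phi (V w)) + t ^+ 2 * B * (1 + V w)) =
    1 + t * m + t ^+ 2 * B * 2.
  rewrite (RintegralD measurableT i4 i3) (RintegralD measurableT V_integrable i1).
  rewrite (RintegralZl _ measurableT ip) (RintegralZl _ measurableT i2) IV.
  rewrite (RintegralD measurableT (finite_measure_integrable_cst P 1 measurableT) V_integrable).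
  rewrite IV Rintegral_cst//; have -> : fine (P setT) = 1 by rewrite probability_setT.
  by rewrite mulr1.
apply: (@le_trans _ _ (Ex P (fun w => expR (- (t * c)) * (V w + t * (V w * phi (V w)) + t ^+ 2 * B
  * (1 + V w)))%R)).
  apply: Ex_le => //.
  - apply: measurable_funM => //; apply: measurableT_comp => //.
    apply: measurable_funM => //; apply: measurable_funB => //; exact: measurableT_comp.
  - apply: measurable_funM => //; apply/measurable_EFinP; exact: (measurable_int _ i5).
  - by move=> w; rewrite mulr_ge0// expR_ge0.
  - by move=> w; exact: pt.
have i6 : P.-integrable setT (EFin \o (fun w => expR (- (t * c)) * (V w + t * (V w * phi (V w)) + t
  ^+ 2 * B * (1 + V w)))).
  by have := integrableZl measurableT (expR (- (t * c))) i5; apply: eq_integrable.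
rewrite Ex_Rintegral// RintegralZl// I5 lee_fin.
have -> : t * (m - c) + 2 * t ^+ 2 * B = - (t * c) + (t * m + t ^+ 2 * B * 2) by ring.
rewrite expRD ler_pM2l ?expR_gt0//.
by rewrite -addrA; exact: expR_ge1Dx.
Qed.

(** Only the positive part depends on the hypothesis: [x ln x >= x - 1 >= -1] bounds the negative
    part by 1. *)
Lemma mul_ln_integrable : (\int[P]_t (V t * ln (V t))%:E < +oo)%E ->
  P.-integrable setT (EFin \o (fun t => V t * ln (V t))).
Proof.
have mf : measurable_fun setT (fun t => V t * ln (V t)).
  by apply: measurable_funM => //; apply: measurableT_comp => //; exact: measurable_ln.
set f := (fun t => (V t * ln (V t))%:E) => foo.
have mf' : measurable_fun setT f by exact/measurable_EFinP.
have neg1 : (\int[P]_t f^\- t <= 1)%E.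
  have -> : (1 = \int[P]_t (cst 1 t))%E by rewrite integral_cst// mul1e;
    exact/esym/probability_setT.
  apply: ge0_le_integral => //.
  - exact: measurable_funeneg.
  - move=> t _; rewrite funenegE /f /= ge_max !lee_fin ler01 andbT.
    have := mul_ln_ge (V0 t); have := V0 t; lra.
have pos1 : (\int[P]_t f^\+ t < +oo)%E.
  move: foo; rewrite integralE.
  have n0 : (0 <= \int[P]_t f^\- t)%E by apply: integral_ge0.
  have : (\int[P]_t f^\- t)%E \is a fin_num.
    by rewrite ge0_fin_numE// (le_lt_trans neg1)// ltry.
  case: (\int[P]_t f^\- t)%E => // r _.
  by case: (\int[P]_t f^\+ t)%E => [p _|//|//]; rewrite ltry.
apply/integrableP; split; first exact/measurable_EFinP.
have -> : (\int[P]_x `|(EFin \o (fun t : T => V t * ln (V t))%R) x| = \int[P]_x (f^\+ x + f^\-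
  x))%E.
  by apply: eq_integral => t _; rewrite -[RHS]/((f^\+ \+ f^\-) t)%E -fune_abse.
rewrite ge0_integralD//.
- by rewrite lte_add_pinfty// (le_lt_trans neg1)// ltry.
- exact: measurable_funepos.
- exact: measurable_funeneg.
Qed.

Hypothesis VlnV : P.-integrable setT (EFin \o (fun t => V t * ln (V t))).
Local Notation h := (\int[P]_t (V t * ln (V t))).

(** Integrating [x - 1 <= x ln x] with mean 1 gives the sign; it is what keeps the dimension of a
    single cascade at most 1. *)
Lemma entropy_ge0 : 0 <= h.
Proof.
have -> : 0 = \int[P]_t (V t - 1).
  rewrite RintegralB//; [|exact: V_integrable|exact: finite_measure_integrable_cst].
  have -> : \int[P]_w V w = 1 by apply: EFin_inj; rewrite -Ex_Rintegral ?V1//; exact: V_integrable.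
  rewrite Rintegral_cst//; have -> : fine (P setT) = 1 by rewrite probability_setT.
  by rewrite mulr1 subrr.
apply: le_Rintegral => //.
- have := integrableB measurableT V_integrable (finite_measure_integrable_cst P 1 measurableT).
  by apply: eq_integrable.
- by move=> t _; exact: mul_ln_ge.
Qed.

Lemma abs_truncated_ln (K : R) x : 0 <= K -> `|Num.min (ln x) K| <= `|ln x|.
Proof.
move=> K0; have [h|h] := leP (ln x) K; first by [].
by rewrite !ger0_norm//; lra.
Qed.

Lemma measurable_truncated_ln (K : R) : measurable_fun setT (fun x : R => Num.min (ln x) K).
Proof. by apply: measurable_minr => //; exact: measurable_ln. Qed.

Lemma truncated_ln_integrable (K : R) : 0 <= K ->
  P.-integrable setT (EFin \o (fun t => V t * Num.min (ln (V t)) K)).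
Proof.
move=> K0; apply: (le_integrable measurableT _ _ VlnV).
  apply/measurable_EFinP; apply: measurable_funM => //.
  exact: (measurableT_comp (measurable_truncated_ln K) mV).
move=> t _ /=; rewrite lee_fin !normrM ler_wpM2l//; exact: abs_truncated_ln.
Qed.

Lemma truncated_ln_close (e : R) : 0 < e -> exists2 K : R, 0 <= K &
  h - e < \int[P]_t (V t * Num.min (ln (V t)) K) <= h.
Proof.
move=> e0.
pose f_ (n : nat) t := (V t * Num.min (ln (V t)) n%:R)%:E.
have := @dominated_convergence _ T R P setT measurableT f_ (fun t => (V t * ln (V t))%:E)
  (fun t => `|(V t * ln (V t))%:E|%E).
case=> //.
- by move=> n; apply: (measurable_int _ (truncated_ln_integrable _)).
- exact: (measurable_int _ VlnV).
- apply: aeW => t _.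
  have [N lnN] : exists N : nat, ln (V t) <= N%:R.
    by exists (Num.truncn `|ln (V t)|).+1; rewrite (le_trans (ler_norm _))// ltW// truncnS_gt.
  apply: cvg_near_cst; exists N => // n /= Nn; rewrite /f_.
  by congr (_ * _)%:E; apply/min_idPl; rewrite (le_trans lnN)// ler_nat.
- by apply: integrable_abse VlnV.
- apply: aeW => t n _; rewrite /f_ !abse_EFin lee_fin !normrM ler_wpM2l//; exact: abs_truncated_ln.
move=> _ _ cv.
have {}cv : (\int[P]_t (V t * Num.min (ln (V t)) n%:R)) @[n --> \oo] --> h.
  by apply: fine_cvg; rewrite -Ex_Rintegral.
have := cvgr_gt _ cv (h - e); rewrite ltrBlDr ltrDl => /(_ _ e0)[N _ /(_ N (leqnn N)) hN].
exists N%:R => //; apply/andP; split; first exact: hN.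
apply: le_Rintegral => //; first exact: truncated_ln_integrable.
by move=> t _; rewrite ler_wpM2l// ge_min lexx.
Qed.

End weight.

(** * Tails, dyadic sums and geometric sums *)

Section sums.
Context {R : realType}.
Implicit Types y : R.

Lemma tail_small (t : nat -> R) (B eta : R) : (forall k, 0 <= t k) ->
  (forall n, \sum_(0 <= k < n) t k <= B) -> 0 < eta ->
  exists k0, forall n, \sum_(k0 <= k < n) t k <= eta.
Proof.
move=> t0 tB eta0.
pose E := [set \sum_(0 <= k < n) t k | n in setT].
have hE : has_sup E.
  split; first by exists (\sum_(0 <= k < 0) t k), 0%N.
  by exists B => _ [n _ <-].
have [_ [k0 _ <-] hk0] := sup_adherent eta0 hE.
exists k0 => n; have [nk|kn] := leqP n k0; first by rewrite big_geq// ltW.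
have : \sum_(0 <= k < n) t k <= sup E by apply: sup_ubound; [exact: hE.2|exists n].
by rewrite (@big_cat_nat _ _ _ k0)//=; [lra|exact: ltnW].
Qed.

(** This and the next inequality sum the costs of large jumps and of variances over dyadic
    truncation levels; both totals are linear in [y], so a first moment controls them. *)
Lemma dyadic_below y n : 0 <= y ->
  \sum_(0 <= k < n) 2 ^+ k * (2 ^+ k < y)%R%:R <= 2 * y.
Proof.
move=> y0.
pose s n : R := \sum_(0 <= k < n) 2 ^+ k * (2 ^+ k < y)%R%:R.
(* The second bound carries the induction: when the term [2^n < y] is added, the new sum is at most
   [2 * 2^n], hence below [2 * y]. *)
suff [] : s n <= 2 * y /\ s n <= 2 ^+ n by [].
elim: n => [|n [ih1 ih2]].
  by rewrite /s big_geq// expr0; split; [rewrite mulr_ge0|exact: ler01].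
have n0 : 0 < 2 ^+ n :> R by rewrite exprn_gt0.
rewrite /s big_nat_recr//= -/(s n) exprS; case: ltP => h /=; rewrite ?mulr1 ?mulr0; split; lra.
Qed.

Lemma dyadic_above y n : 0 <= y ->
  \sum_(0 <= k < n) (if y <= 2 ^+ k then y else 0) ^+ 2 / 2 ^+ k <= 2 * y.
Proof.
move=> y0; pose s n : R := \sum_(0 <= k < n) (if y <= 2 ^+ k then y else 0) ^+ 2 / 2 ^+ k.
(* The added term [2 * (y^2 / 2^n)] is the full geometric tail still to come, so the invariant is
   preserved once [2^n] has passed [y]; before that the sum is 0. *)
rewrite -[leLHS]/(s n); suff : s n = 0 \/ s n + 2 * (y ^+ 2 / 2 ^+ n) <= 2 * y.
  case=> [->|]; first by rewrite mulr_ge0.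
  have : 0 <= y ^+ 2 / 2 ^+ n by rewrite divr_ge0 ?sqr_ge0 ?exprn_ge0.
  lra.
elim: n => [|n ih]; first by left; rewrite /s big_geq.
have e : y ^+ 2 / 2 ^+ n.+1 = (y ^+ 2 / 2 ^+ n) / 2.
  by rewrite (exprS 2 n) invfM mulrA mulrAC.
rewrite e /s big_nat_recr//= -/(s n); case: leP => h; last first.
  rewrite expr0n/= mul0r addr0; case: ih => [->|ih]; [by left|right].
  have : 0 <= y ^+ 2 / 2 ^+ n by rewrite divr_ge0 ?sqr_ge0 ?exprn_ge0.
  lra.
right; case: ih => [->|]; last lra.
have : y ^+ 2 / 2 ^+ n <= y by rewrite ler_pdivrMr ?exprn_gt0// expr2 ler_wpM2l.
lra.
Qed.

Lemma geometric_le (theta : R) n : 0 <= theta < 1 ->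
  \sum_(0 <= k < n) theta ^+ k <= (1 - theta)^-1.
Proof.
move=> /andP[t0 t1].
rewrite -[leRHS]mul1r ler_pdivlMr ?subr_gt0//.
suff -> : (\sum_(0 <= k < n) theta ^+ k) * (1 - theta) = 1 - theta ^+ n.
  have := exprn_ge0 n t0; lra.
elim: n => [|n ih]; first by rewrite big_geq// mul0r expr0 subrr.
by rewrite big_nat_recr//= mulrDl ih exprS; ring.
Qed.

End sums.

Lemma measurable_bool_R {R : realType} {d : measure_display} {T : measurableType d} (D : T ->
  bool) : measurable_fun setT D ->
  measurable_fun setT (fun t => (D t)%:R : R).
Proof.
move=> mD; rewrite (_ : (fun t => _) = (fun t => if D t then 1 else 0 : R)).
  exact: measurable_fun_ifT.
by apply/funext => t; case: (D t).
Qed.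

Lemma measurable_has {d : measure_display} {T : measurableType d} (D : nat -> T -> bool)
  (s : seq nat) :
  (forall m, measurable_fun setT (D m)) -> measurable_fun setT (fun t => has (D^~ t) s).
Proof.
move=> mD; elim: s => [|m s ih] /=; first exact: measurable_cst.
exact: measurable_or.
Qed.

Lemma measurable_sum_nat {R : realType} {d : measure_display} {T : measurableType d} (f : nat ->
  T -> R) (m n : nat) :
  (forall j, (m <= j < n)%N -> measurable_fun setT (f j)) ->
  measurable_fun setT (fun t => \sum_(m <= j < n) f j t).
Proof.
move=> mf; under eq_fun do rewrite big_nat big_mkcond/=.
apply: measurable_sum => j; have [/mf //|_] := boolP (m <= j < n)%N.
exact: measurable_cst.
Qed.

(** * Growth of the products of weights along one path *)

Section spine.
Context {R : realType} {d d0 : measure_display} {T : measurableType d} {T0 : measurableType d0}.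
Variables (P : probability T R) (P0 : probability T0 R).
Context {L : choiceType}.
Variable X : seq L -> T -> R.
Variable V : T0 -> R.
Hypothesis mX : forall u, measurable_fun setT (X u).
Hypothesis X0 : forall u t, 0 <= X u t.
Hypothesis iX : mutually_independent P X.
Hypothesis mV : measurable_fun setT V.
Hypothesis V0 : forall t, 0 <= V t.
Hypothesis V1 : Ex P0 V = 1%E.
Hypothesis lawX : forall u (g : R -> R), measurable_fun setT g -> (forall x, 0 <= g x) ->
  Ex P (fun t => g (X u t)) = Ex P0 (fun t => g (V t)).

Local Notation Q := (path_weight X).

Lemma law_mul u (g : R -> R) : measurable_fun setT g -> (forall x, 0 <= g x) ->
  Ex P (fun t => X u t * g (X u t)) = Ex P0 (fun t => V t * g (V t)).
Proof.
move=> mg g0; transitivity (Ex P (fun t => `|X u t| * g (X u t))).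
  by apply: eq_Ex => t; rewrite ger0_norm.
rewrite (lawX u (g := fun x => `|x| * g x)).
- by apply: eq_Ex => t; rewrite ger0_norm.
- by apply: measurable_funM => //; exact: measurableT_comp.
- by move=> x; rewrite mulr_ge0.
Qed.

Lemma Ex_X u : Ex P (X u) = 1%E.
Proof.
transitivity (Ex P (fun t => X u t * 1)); first by apply: eq_Ex => t; rewrite mulr1.
rewrite (law_mul u (g := fun=> 1))// -V1.
by apply: eq_Ex => t; rewrite mulr1.
Qed.

Lemma size_biased_prod u (g : nat -> R -> R) : (forall j, measurable_fun setT (g j)) ->
  (forall j x, 0 <= g j x) ->
  Ex P (fun t => Q u t * \prod_(1 <= j < (size u).+1) g j (X (take j u) t)) =
  (\prod_(1 <= j < (size u).+1) Ex P0 (fun t => (V t * g j (V t))%R))%E.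
Proof.
move=> mg g0; rewrite Ex_spine//.
by apply: eq_bigr => j _; exact: law_mul.
Qed.

(** The products along a path form a martingale: for an event decided by the first [m] weights, the
    later factors integrate to 1. *)
Lemma size_biased_take u m (F : T -> R) : (m <= size u)%N ->
  sigma_fun X [set w | exists2 j, (j <= m)%N & w = take j u] F -> (forall t, 0 <= F t) ->
  Ex P (fun t => Q u t * F t) = Ex P (fun t => Q (take m u) t * F t).
Proof.
move=> mu mF F0.
transitivity (Ex P (fun t => F t * Q u t)); first by apply: eq_Ex => t; rewrite mulrC.
rewrite (Ex_path_weight_take mX X0 iX Ex_X mF F0 mu).
  by apply: eq_Ex => t; rewrite mulrC.
move=> j /andP[mj ju] [k km /(congr1 size)]; rewrite !size_takel// ?(leq_trans km)//.
by lia.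
Qed.

(** With the convention [ln 0 = 0] the formula would fail at a vanishing weight, which a nonzero
    product excludes. *)
Lemma path_weight_expR u t : Q u t != 0 ->
  Q u t = expR (\sum_(1 <= j < (size u).+1) ln (X (take j u) t)).
Proof.
move=> Q0; rewrite expR_sum /path_weight !big_nat; apply: eq_bigr => j hj.
rewrite lnK// posrE lt_neqAle X0 andbT eq_sym.
apply: contra_neq Q0 => Xj0; rewrite /path_weight (bigD1_seq j) ?iota_uniq ?mem_index_iota//=.
by rewrite Xj0 mul0r.
Qed.

Lemma path_weight_neq0_take u m t : (m <= size u)%N -> Q u t != 0 -> Q (take m u) t != 0.
Proof.
move=> mu; apply: contra_neq => Q0.
by rewrite -[u in LHS](cat_take_drop m) path_weight_cat Q0 mul0r.
Qed.

(** Exponential Markov inequality under the size-biased law, where the moment generating function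
    factorizes. The shift [C] yields the factor [expR (- (s * C))], which later makes the sum over
    all [m] as small as desired. *)
Lemma spine_chernoff (phi : R -> R) (c s theta C : R) u m :
  measurable_fun setT phi -> (m <= size u)%N -> 0 < s -> 0 <= theta ->
  (Ex P0 (fun w => V w * expR (s * (phi (V w) - c)))%R <= theta%:E)%E ->
  (Ex P (fun t => Q u t * (C + m%:R * c <= \sum_(1 <= j < m.+1) phi (X (take j u) t))%R%:R)%R
    <= (expR (- (s * C)) * theta ^+ m)%:E)%E.
Proof.
move=> mphi mu s0 th0 le_th.
have mX' j : measurable_fun setT (fun t => phi (X (take j u) t)) by exact: measurableT_comp.
pose G t := \prod_(1 <= j < m.+1) expR (s * (phi (X (take j u) t) - c)).
have mg : measurable_fun setT (fun x => expR (s * (phi x - c))).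
  apply: measurableT_comp => //; apply: measurable_funM => //.
  exact: measurable_funB.
have mG : measurable_fun setT G.
  apply: measurable_prod => j _; exact: (measurableT_comp mg (mX _)).
have G0 t : 0 <= G t by apply: prodr_ge0 => j _; exact: expR_ge0.
have mQ := @measurable_path_weight _ _ _ _ _ mX.
have Q0 := path_weight_ge0 X0.
apply: (@le_trans _ _ (Ex P (fun t => expR (- (s * C)) * (Q u t * G t)))).
  apply: Ex_le.
  - apply: measurable_funM => //; apply: measurable_bool_R.
    apply: measurable_fun_ler => //; exact: measurable_sum.
  - by apply: measurable_funM => //; exact: measurable_funM.
  - by move=> t; rewrite mulr_ge0 ?ler0n.
  - move=> t; case: (leP (C + m%:R * c)) => h /=; last by rewrite mulr0 !mulr_ge0// expR_ge0.
    rewrite mulr1 mulrCA ler_peMr// /G -expR_sum -expRD -[leLHS]expR0 ler_expR.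
    rewrite -mulr_sumr sumrB sumr_const_nat subn1/= -mulrN -mulrDr mulr_ge0 ?(ltW s0)//.
    by rewrite -(mulr_natl c); move: h; set S := \sum_(_ <= _ < _) _; lra.
have mQG : measurable_fun setT (fun t => Q u t * G t) by exact: measurable_funM.
have QG0 t : 0 <= Q u t * G t by rewrite mulr_ge0.
rewrite (ExZ P mQG QG0 (expR_ge0 _)) EFinM lee_wpmul2l ?lee_fin ?expR_ge0//.
rewrite (@size_biased_take u m)//; last first.
  apply: measurable_prod => j; rewrite mem_index_iota ltnS => /andP[_ jm].
  apply: (measurableT_comp mg); apply: sigma_fun_var; by exists j.
pose gg (x : R) := expR (s * (phi x - c)).
have -> : Ex P (fun t => Q (take m u) t * G t) =
    (\prod_(1 <= j < m.+1) Ex P0 (fun t => V t * gg (V t))%R)%E.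
  rewrite -{2}(size_takel mu) -(@size_biased_prod (take m u) (fun=> gg))//.
    apply: eq_Ex => t; rewrite /G size_takel// !big_nat; congr (_ * _).
    by apply: eq_bigr => j /andP[_ jm]; rewrite take_takel.
  by move=> j x; exact: expR_ge0.
have -> : theta ^+ m = \prod_(1 <= j < m.+1) theta by rewrite prodr_const_nat subn1.
rewrite -prodEFin; suff : (0 <= \prod_(1 <= j < m.+1) Ex P0 (fun t => (V t * gg (V t))%R) <=
  \prod_(1 <= j < m.+1) theta%:E)%E by case/andP.
elim/big_rec2 : _ => [|j x y _ /andP[y0 xy]]; first by rewrite lee01 lexx.
have z0 : (0 <= Ex P0 (fun t => (V t * gg (V t))%R))%E.
  by apply: Ex_ge0 => t; rewrite mulr_ge0 ?expR_ge0.
by rewrite mule_ge0//= lee_pmul.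
Qed.

Hypothesis VlnV : P0.-integrable setT (EFin \o (fun t => V t * ln (V t))).
Local Notation h := (\int[P0]_t (V t * ln (V t))).

(** Capping the logarithm from above only decreases the sum, so an atypically small product forces
    an atypically small capped sum. The size-biased mean of the capped logarithm exceeds [h - e] for
    large [K], and the Chernoff bound applies to its opposite. *)
Lemma spine_lower (e : R) : 0 < e -> exists2 theta : R, 0 < theta < 1 &
  forall u, (Ex P (fun t => Q u t * (Q u t <= expR ((size u)%:R * (h - e)))%R%:R)%R
    <= (theta ^+ size u)%:E)%E.
Proof.
move=> e0; have [K K0 /andP[hK Kh]] := truncated_ln_close mV V0 VlnV e0.
have mK := measurable_truncated_ln K.
have [|||||s [theta [s0 th le_th]]] := @chernoff _ _ _ P0 V mV V0 V1 (fun x => - Num.min (ln x) K)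
  (- (h - e)) (16 + K ^+ 2 * expR (K / 2)).
- exact: measurableT_comp.
- by rewrite addr_ge0// mulr_ge0 ?sqr_ge0 ?expR_ge0.
- by move=> x x0; rewrite sqrrN normrN; exact: truncated_ln_moment.
- have := integrableN (truncated_ln_integrable mV VlnV K0).
  by apply: eq_integrable => // t _ /=; rewrite mulrN.
- rewrite (_ : \int[P0]_t _ = - \int[P0]_t (V t * Num.min (ln (V t)) K)) ?ltrN2//.
  transitivity (\int[P0]_t ((-1) * (V t * Num.min (ln (V t)) K))).
    by apply: eq_Rintegral => t _; rewrite mulrN mulN1r.
  by rewrite RintegralZl ?mulN1r//; exact: truncated_ln_integrable.
exists theta => // u.
have mmK : measurable_fun setT (fun x : R => - Num.min (ln x) K) by exact: measurableT_comp.
have th0 : 0 <= theta by case/andP: th => /ltW.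
have := @spine_chernoff (fun x => - Num.min (ln x) K) (- (h - e)) s theta 0 u (size u) mmK
  (leqnn _) s0 th0 le_th.
rewrite mulr0 oppr0 expR0 mul1r; apply: le_trans.
have mQ := @measurable_path_weight _ _ _ _ _ mX.
have Q0 := path_weight_ge0 X0.
apply: Ex_le.
- apply: measurable_funM => //; apply: measurable_bool_R; exact: measurable_fun_ler.
- apply: measurable_funM => //; apply: measurable_bool_R; apply: measurable_fun_ler => //.
  by apply: measurable_sum => j; exact: (measurableT_comp mmK (mX _)).
- by move=> t; rewrite mulr_ge0 ?ler0n.
- move=> t; have [->|Qn0] := eqVneq (Q u t) 0; first by rewrite !mul0r.
  apply: ler_wpM2l => //; rewrite ler_nat; case: (leP (Q u t)) => //=.
  rewrite {1}(path_weight_expR Qn0) ler_expR => le_h; rewrite lt0b add0r.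
  rewrite mulrN sumrN lerN2; apply: le_trans le_h; apply: ler_sum => j _.
  by rewrite ge_min lexx.
Qed.

Section chebyshev.
Variables (y : R -> R) (delta : R).
Hypothesis my : measurable_fun setT y.
Hypothesis y0 : forall x, 0 <= y x.
Hypothesis Ey : (Ex P0 (fun t => V t * y (V t))%R <= delta%:E)%E.

(** Values above [N] are dropped rather than clipped: they are counted separately as jumps, and
    without jumps the capped sum equals the original one. *)
Definition cap (N : nat) (x : R) : R := if y x <= N%:R then y x else 0.

Lemma measurable_cap N : measurable_fun setT (cap N).
Proof. by apply: measurable_fun_ifT => //; exact: measurable_fun_ler. Qed.

Lemma cap_ge0 N x : 0 <= cap N x.
Proof. by rewrite /cap; case: ifP. Qed.

Lemma cap_le N x : cap N x <= N%:R.
Proof. by rewrite /cap; case: ifP. Qed.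

Lemma cap_le_y N x : cap N x <= y x.
Proof. by rewrite /cap; case: ifP. Qed.

(** Off the diagonal this is size-biased independence. On the diagonal the moment is [v], and
    [dl ^+ 2] is slack that gives both cases the same formula. *)
Lemma size_biased_pair (z : R -> R) (v dl : R) u i j :
  measurable_fun setT z -> (forall x, 0 <= z x) ->
  Ex P0 (fun t => V t * z (V t)) = dl%:E ->
  Ex P0 (fun t => V t * z (V t) ^+ 2) = v%:E ->
  (0 < i <= size u)%N -> (0 < j <= size u)%N ->
  (Ex P (fun t => Q u t * (z (X (take i u) t) * z (X (take j u) t)))%R <=
    (dl ^+ 2 + v *+ (i == j))%:E)%E.
Proof.
move=> mz z0 Ez Ez2 iu ju.
have v0 : 0 <= v by rewrite -lee_fin -Ez2; apply: Ex_ge0 => t; rewrite mulr_ge0 ?sqr_ge0.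
pose g l (x : R) := (if l == i then z x else 1) * (if l == j then z x else 1).
have -> : Ex P (fun t => Q u t * (z (X (take i u) t) * z (X (take j u) t))) =
    Ex P (fun t => Q u t * \prod_(1 <= l < (size u).+1) g l (X (take l u) t)).
  apply: eq_Ex => t; rewrite /g big_split /= -!big_mkcond /= !big_nat1_eq.
  by rewrite !ltnS iu ju.
rewrite size_biased_prod.
- rewrite [leLHS](_ : _ = \prod_(1 <= l < (size u).+1)
     (if i == j then if l == i then v else 1
      else (if l == i then dl else 1) * (if l == j then dl else 1))%:E)%E.
    rewrite prodEFin lee_fin; case: eqP => [ij|/eqP ij].
      by rewrite -big_mkcond big_nat1_eq ltnS iu mulr1n ler_wpDl ?sqr_ge0.
    by rewrite big_split/= -!big_mkcond /= !big_nat1_eq !ltnS iu ju mulr0n addr0 expr2.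
  apply: eq_bigr => l _; rewrite /g; case: (eqVneq i j) => [<-|ij].
    by case: eqP => _; [rewrite -Ez2; apply: eq_Ex => t; rewrite expr2|rewrite -V1;
      apply: eq_Ex => t; rewrite !mulr1].
  case: (eqVneq l i) => [li|_].
    by rewrite li (negbTE ij) mulr1 -Ez; apply: eq_Ex => t; rewrite mulr1.
  case: (eqVneq l j) => _; first by rewrite (mul1r dl) -Ez; apply: eq_Ex => t; rewrite mul1r.
  by rewrite (mulr1 1) -V1; apply: eq_Ex => t; rewrite !mulr1.
- by move=> l; apply: measurable_funM; case: (_ == _).
- by move=> l x; rewrite mulr_ge0//; case: (_ == _).
Qed.

Lemma size_biased_single (z : R -> R) u j :
  measurable_fun setT z -> (forall x, 0 <= z x) -> (0 < j <= size u)%N ->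
  Ex P (fun t => Q u t * z (X (take j u) t)) = Ex P0 (fun t => V t * z (V t)).
Proof.
move=> mz z0 ju.
pose g l (x : R) := (if l == j then z x else 1).
have -> : Ex P (fun t => Q u t * z (X (take j u) t)) =
    Ex P (fun t => Q u t * \prod_(1 <= l < (size u).+1) g l (X (take l u) t)).
  by apply: eq_Ex => t; rewrite /g -!big_mkcond /= !big_nat1_eq ltnS ju.
rewrite size_biased_prod.
- rewrite (bigD1_seq j) ?iota_uniq ?mem_index_iota ?ltnS//= big1 ?mule1.
    by rewrite /g eqxx.
  by move=> l lj; rewrite /g (negbTE lj) -V1; apply: eq_Ex => t; rewrite mulr1.
- by move=> l; rewrite /g; case: (_ == _).
- by move=> l x; rewrite /g; case: ifP.
Qed.

(** Expanding the square, the off-diagonal products cancel against the squared mean, and each of the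
    [size u] diagonal terms leaves [v]. *)
Lemma size_biased_variance (z : R -> R) (v dl : R) u :
  measurable_fun setT z -> (forall x, 0 <= z x) ->
  Ex P0 (fun t => V t * z (V t)) = dl%:E ->
  Ex P0 (fun t => V t * z (V t) ^+ 2) = v%:E ->
  (Ex P (fun t => Q u t * (\sum_(1 <= j < (size u).+1) z (X (take j u) t) - (size u)%:R * dl) ^+
    2)%R <=
    ((size u)%:R * v)%:E)%E.
Proof.
move=> mz z0 Ez Ez2; set n := size u.
have mQ := @measurable_path_weight _ _ _ _ _ mX.
have Q0 := path_weight_ge0 X0.
have mz' j : measurable_fun setT (fun t => z (X (take j u) t)) by exact:
  (measurableT_comp mz (mX _)).
have dl0 : 0 <= dl by rewrite -lee_fin -Ez; apply: Ex_ge0 => t; rewrite mulr_ge0.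
pose S t := \sum_(1 <= j < n.+1) z (X (take j u) t).
have mS : measurable_fun setT S by exact: measurable_sum.
have S0 t : 0 <= S t by exact: sumr_ge0.
pose c := n%:R * dl; have c0 : 0 <= c by rewrite mulr_ge0.
have ES : Ex P (fun t => Q u t * S t) = c%:E.
  transitivity (Ex P (fun t => \sum_(j <- [seq j <- index_iota 1 n.+1 | (0 < j <= n)%N]) Q u t * z
    (X (take j u) t))).
    apply: eq_Ex => t; rewrite /S mulr_sumr (_ : [seq _ <- _ | _] = index_iota 1 n.+1)//.
    by apply/all_filterP/allP => j; rewrite mem_index_iota ltnS.
  rewrite Ex_sum; last 2 first.
  - by move=> j; exact: measurable_funM.
  - by move=> j t; rewrite mulr_ge0.
  rewrite big_filter (eq_bigr (fun=> dl%:E)); last by move=> j ju; rewrite size_biased_single.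
  rewrite sumEFin -big_filter (_ : [seq _ <- _ | _] = index_iota 1 n.+1).
    by rewrite sumr_const_nat subn1 /c mulr_natl.
  by apply/all_filterP/allP => j; rewrite mem_index_iota ltnS.
have ES2 : (Ex P (fun t => Q u t * S t ^+ 2)%R <= (n%:R ^+ 2 * dl ^+ 2 + n%:R * v)%:E)%E.
  have -> : Ex P (fun t => Q u t * S t ^+ 2) =
     Ex P (fun t => \sum_(1 <= i < n.+1) \sum_(1 <= j < n.+1) Q u t * (z (X (take i u) t) * z (X
       (take j u) t))).
    apply: eq_Ex => t; rewrite /S expr2 mulr_suml mulr_sumr; apply: eq_bigr => i _.
    by rewrite !mulr_sumr.
  have mQz i j : measurable_fun setT (fun t => Q u t * (z (X (take i u) t) * z (X (take j u) t))).
    by apply: measurable_funM => //; exact: measurable_funM.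
  have Qz0 i j t : 0 <= Q u t * (z (X (take i u) t) * z (X (take j u) t)) by rewrite !mulr_ge0.
  rewrite Ex_sum; last 2 first.
  - by move=> i; exact: measurable_sum.
  - by move=> i t; exact: sumr_ge0.
  have -> : n%:R ^+ 2 * dl ^+ 2 + n%:R * v = \sum_(1 <= i < n.+1) (n%:R * dl ^+ 2 + v).
    by rewrite sumr_const_nat subn1/= -mulr_natl; ring.
  rewrite -sumEFin !big_nat; apply: lee_sum => i iu.
  rewrite Ex_sum//.
  have -> : n%:R * dl ^+ 2 + v = \sum_(1 <= j < n.+1) (dl ^+ 2 + v *+ (i == j)).
    rewrite big_split/= sumr_const_nat subn1/= mulr_natl; congr (_ + _).
    rewrite (bigD1_seq i) ?iota_uniq ?mem_index_iota//= eqxx big1 ?addr0// => j.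
    by rewrite eq_sym => /negbTE ->.
  rewrite -sumEFin !big_nat; apply: lee_sum => j ju.
  exact: size_biased_pair.
(* Written with additions of nonnegative terms only, since expectations are extended reals and
   additivity is at hand for nonnegative functions. *)
have key : (Ex P (fun t => Q u t * (S t - c) ^+ 2)%R + (2 * c * c)%:E =
    Ex P (fun t => Q u t * S t ^+ 2)%R + (c ^+ 2)%:E)%E.
  have -> : ((2 * c * c)%:E = Ex P (fun t => (2 * c) * (Q u t * S t))%R)%E.
    rewrite ExZ ?ES ?mulr_ge0//; first exact: measurable_funM.
    by move=> t; rewrite mulr_ge0.
  have -> : ((c ^+ 2)%:E = Ex P (fun t => c ^+ 2 * Q u t)%R)%E.
    by rewrite ExZ ?sqr_ge0// (Ex_path_weight mX X0 iX Ex_X) mule1.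
  have mc : measurable_fun setT (fun t => S t - c) by exact: measurable_funB.
  rewrite -!ExD//.
  - by apply: eq_Ex => t; ring.
  - by apply: measurable_funM => //; exact: measurable_funX.
  - exact: measurable_funM.
  - by move=> t; rewrite mulr_ge0// exprn_ge0.
  - by move=> t; rewrite mulr_ge0 ?sqr_ge0.
  - by apply: measurable_funM => //; exact: measurable_funX.
  - by apply: measurable_funM => //; exact: measurable_funM.
  - by move=> t; rewrite mulr_ge0 ?sqr_ge0.
  - by move=> t; rewrite !mulr_ge0.
have : (Ex P (fun t => Q u t * (S t - c) ^+ 2)%R + (2 * c * c)%:E <=
    (n%:R ^+ 2 * dl ^+ 2 + n%:R * v)%:E + (c ^+ 2)%:E)%E.
  by rewrite key leeD2r.
have : (0 <= Ex P (fun t => Q u t * (S t - c) ^+ 2)%R)%E.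
  by apply: Ex_ge0 => t; rewrite mulr_ge0 ?sqr_ge0.
case: (Ex P _) => // r _; rewrite -!EFinD !lee_fin /c; nra.
Qed.

(** A union bound for a jump above [N] among at most [N] positions, plus Chebyshev for the capped
    sum: a variance of at most [N] times the capped second moment, divided by [(ep N / 2)^2]. *)
Definition deviation_cost (ep : R) (N : nat) (x : R) : R :=
  N%:R * (N%:R < y x)%R%:R + 4 / (ep ^+ 2 * N%:R) * cap N x ^+ 2.

Lemma measurable_deviation_cost ep N : measurable_fun setT (deviation_cost ep N).
Proof.
apply: measurable_funD; apply: measurable_funM => //.
- by apply: measurable_bool_R; exact: measurable_fun_ltr.
- by apply: measurable_funX; exact: measurable_cap.
Qed.

Lemma deviation_cost_ge0 ep N x : 0 <= deviation_cost ep N x.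
Proof.
apply: addr_ge0; first by rewrite mulr_ge0 ?ler0n.
by rewrite mulr_ge0 ?sqr_ge0// divr_ge0// mulr_ge0 ?sqr_ge0.
Qed.

Lemma spine_deviation (ep : R) N u : (0 < N)%N -> (size u <= N)%N -> 0 < ep -> 2 * delta <= ep ->
  (Ex P (fun t => Q u t * (ep * N%:R < \sum_(1 <= j < (size u).+1) y (X (take j u) t))%R%:R)%R
    <= Ex P0 (fun t => V t * deviation_cost ep N (V t))%R)%E.
Proof.
move=> N0 uN ep0 ed; set n := size u in uN *.
have NR : 0 < N%:R :> R by rewrite ltr0n.
have mQ := @measurable_path_weight _ _ _ _ _ mX.
have Q0 := path_weight_ge0 X0.
have mc := measurable_cap N.
have c0 := cap_ge0 N.
have mi : measurable_fun setT (fun x => (N%:R < y x)%R%:R : R).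
  by apply: measurable_bool_R; exact: measurable_fun_ltr.
have [dl Edl dl_delta] : exists2 dl, Ex P0 (fun t => V t * cap N (V t)) = dl%:E & dl <= delta.
  have : (0 <= Ex P0 (fun t => V t * cap N (V t))%R <= delta%:E)%E.
    rewrite Ex_ge0/=; last by move=> t; rewrite mulr_ge0.
    apply: le_trans Ey; apply: Ex_le.
    - by apply: measurable_funM => //; exact: (measurableT_comp mc mV).
    - by apply: measurable_funM => //; exact: (measurableT_comp my mV).
    - by move=> t; rewrite mulr_ge0.
    - by move=> t; rewrite ler_wpM2l// cap_le_y.
  case: (Ex _ _) => [r /andP[_]|/andP[_]|/andP[]]; last 2 first.
  - by rewrite leye_eq.
  - by rewrite leeNy_eq.
  by rewrite lee_fin => r_delta; exists r.
have mVc2 : measurable_fun setT (fun t => V t * cap N (V t) ^+ 2).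
  apply: measurable_funM => //; apply: measurable_funX; exact: (measurableT_comp mc mV).
have [v Ev] : exists v, Ex P0 (fun t => V t * cap N (V t) ^+ 2) = v%:E.
  have : (0 <= Ex P0 (fun t => V t * cap N (V t) ^+ 2)%R <= (N%:R ^+ 2)%:E)%E.
    rewrite Ex_ge0/=; last by move=> t; rewrite mulr_ge0 ?sqr_ge0.
    rewrite -[leRHS]mule1 -V1 -ExZ ?sqr_ge0//.
    apply: Ex_le => //.
    - exact: measurable_funM.
    - by move=> t; rewrite mulr_ge0 ?sqr_ge0.
    - by move=> t; rewrite mulrC ler_wpM2r// ler_sqr ?nnegrE// cap_le.
  by case: (Ex _ _) => [r _|/andP[_]|/andP[]]; [exists r|rewrite leye_eq|rewrite leeNy_eq].
have v0 : 0 <= v by rewrite -lee_fin -Ev; apply: Ex_ge0 => t; rewrite mulr_ge0 ?sqr_ge0.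
pose S t := \sum_(1 <= j < n.+1) cap N (X (take j u) t).
have mS : measurable_fun setT S.
  by apply: measurable_sum => j; exact: (measurableT_comp mc (mX _)).
pose I t := \sum_(1 <= j < n.+1) ((N%:R < y (X (take j u) t))%R%:R : R).
have mI : measurable_fun setT I.
  by apply: measurable_sum => j; exact: (measurableT_comp mi (mX _)).
have I0 t : 0 <= I t by apply: sumr_ge0 => j _; exact: ler0n.
have k0 : 0 <= 4 / (ep * N%:R) ^+ 2 by rewrite divr_ge0 ?sqr_ge0.
have mSd : measurable_fun setT (fun t => Q u t * (S t - n%:R * dl) ^+ 2).
  by apply: measurable_funM => //; apply: measurable_funX; exact: measurable_funB.
apply: (@le_trans _ _ (Ex P (fun t => Q u t * I t + 4 / (ep * N%:R) ^+ 2 * (Q u t * (S t - n%:R *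
  dl) ^+ 2))%R)).
  apply: Ex_le.
  - apply: measurable_funM => //; apply: measurable_bool_R; apply: measurable_fun_ltr => //.
    by apply: measurable_sum => j; exact: (measurableT_comp my (mX _)).
  - by apply: measurable_funD; exact: measurable_funM.
  - by move=> t; rewrite mulr_ge0 ?ler0n.
  move=> t; rewrite [X in _ <= _ + X]mulrCA -mulrDr; apply: ler_wpM2l => //.
  case: ltP => hR /=; last by rewrite addr_ge0// mulr_ge0 ?sqr_ge0.
  (* Either some term exceeds [N], or the capped sum is the true one. In the latter case
     [2 * delta <= ep] puts its mean below [ep * N / 2], so it deviates by at least as much. *)
  have [/hasP[j ju yj]|/hasPn no] := boolP (has (fun j => N%:R < y (X (take j u) t)) (index_iota 1
    n.+1)).
    rewrite -[leLHS]addr0 lerD//; last by rewrite mulr_ge0 ?sqr_ge0.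
    rewrite /I (bigD1_seq j) ?iota_uniq//= yj lerDl; apply: sumr_ge0 => k _; exact: ler0n.
  have SE : S t = \sum_(1 <= j < n.+1) y (X (take j u) t).
    apply: eq_big_seq => j /no; rewrite -leNgt /cap => -> //.
  rewrite -[leLHS]add0r lerD//.
  have : ep * N%:R / 2 <= S t - n%:R * dl.
    rewrite SE; have : n%:R * dl <= N%:R * (ep / 2).
      apply: (@le_trans _ _ (n%:R * (ep / 2))).
        by rewrite ler_wpM2l//; lra.
      by rewrite ler_wpM2r ?ler_nat// divr_ge0// ltW.
    lra.
  set A := ep * N%:R; set B := S t - _ => AB.
  have A0 : 0 < A by rewrite mulr_gt0.
  rewrite mulrAC ler_pdivlMr ?exprn_gt0// mul1r !expr2; nra.
rewrite ExD//; last 4 first.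
- exact: measurable_funM.
- exact: measurable_funM.
- by move=> t; rewrite mulr_ge0.
- by move=> t; rewrite mulr_ge0// mulr_ge0 ?sqr_ge0.
rewrite ExZ//; last by move=> t; rewrite mulr_ge0 ?sqr_ge0.
have -> : Ex P0 (fun t => V t * deviation_cost ep N (V t)) =
    (N%:R%:E * Ex P0 (fun t => V t * (N%:R < y (V t))%R%:R)%R + (4 / (ep ^+ 2 * N%:R) * v)%:E)%E.
  have kk0 : 0 <= 4 / (ep ^+ 2 * N%:R) by rewrite divr_ge0// mulr_ge0 ?sqr_ge0.
  rewrite (EFinM (4 / _)) -Ev -!ExZ//.
  - rewrite -ExD//.
    + by apply: eq_Ex => t; rewrite /deviation_cost; ring.
    + by apply: measurable_funM => //; apply: measurable_funM => //; exact:
      (measurableT_comp mi mV).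
    + exact: measurable_funM.
    + by move=> t; rewrite !mulr_ge0 ?ler0n.
    + by move=> t; rewrite mulr_ge0// mulr_ge0 ?sqr_ge0.
  - by move=> t; rewrite mulr_ge0 ?sqr_ge0.
  - by apply: measurable_funM => //; exact: (measurableT_comp mi mV).
  - by move=> t; rewrite !mulr_ge0 ?ler0n.
apply: leeD.
  have -> : Ex P (fun t => Q u t * I t) =
      Ex P (fun t => \sum_(j <- index_iota 1 n.+1 | (0 < j <= n)%N) Q u t * (N%:R < y (X (take j u)
        t))%R%:R).
    apply: eq_Ex => t; rewrite /I mulr_sumr big_nat; apply: eq_bigl => j.
    by rewrite ltnS.
  rewrite Ex_sum; last 2 first.
  - by move=> j; apply: measurable_funM => //; exact: (measurableT_comp mi (mX _)).
  - by move=> j t; rewrite mulr_ge0 ?ler0n.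
  set z := Ex P0 _; have z0 : (0 <= z)%E by apply: Ex_ge0 => t; rewrite mulr_ge0 ?ler0n.
  have zfin : (z < +oo)%E.
    apply: (@le_lt_trans _ _ (Ex P0 V)); last by rewrite V1 ltry.
    apply: Ex_le => //.
    - by apply: measurable_funM => //; exact: (measurableT_comp mi mV).
    - by move=> t; rewrite mulr_ge0 ?ler0n.
    - by move=> t; case: (_ < _); rewrite ?mulr1 ?mulr0.
  rewrite (eq_bigr (fun=> z)); last first.
    by move=> j ju; rewrite (size_biased_single (z := fun x => (N%:R < y x)%R%:R))// => x;
      exact: ler0n.
  apply: (@le_trans _ _ (\sum_(j <- index_iota 1 n.+1) z)%E).
    by rewrite big_mkcond; apply: lee_sum => j _; case: ifP.
  rewrite -(@fineK _ z) ?ge0_fin_numE ?zfin// sumEFin sumr_const_nat subn1/= -EFinM lee_fin.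
  by rewrite -[leLHS]mulr_natl ler_wpM2r ?ler_nat// fine_ge0.
have := size_biased_variance u mc c0 Edl Ev; rewrite -/n -/S => hv.
apply: (le_trans (lee_wpmul2l _ hv)); first by rewrite lee_fin.
rewrite -EFinM lee_fin exprMn.
have -> : 4 / (ep ^+ 2 * N%:R ^+ 2) * (n%:R * v) = (4 / (ep ^+ 2 * N%:R) * v) * (n%:R / N%:R).
  by field; rewrite ?gt_eqF.
apply: ler_piMr; last by rewrite ler_pdivrMr// mul1r ler_nat.
by rewrite mulr_ge0// divr_ge0// mulr_ge0 ?sqr_ge0.
Qed.

(** The reason for dyadic levels: the costs of all of them add up to a multiple of [y x], whose
    size-biased mean is finite, although [y] may have no second moment. *)
Lemma deviation_cost_sum ep x n : 0 < ep ->
  \sum_(0 <= k < n) deviation_cost ep (2 ^ k)%N x <= (2 + 8 / ep ^+ 2) * y x.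
Proof.
move=> ep0; rewrite /deviation_cost big_split/=.
have -> : (2 + 8 / ep ^+ 2) * y x = 2 * y x + 4 / ep ^+ 2 * (2 * y x) by ring.
apply: lerD.
  by under eq_bigr do rewrite natrX; exact: dyadic_below.
have -> : \sum_(0 <= i < n) 4 / (ep ^+ 2 * (2 ^ i)%N%:R) * cap (2 ^ i) x ^+ 2 =
    4 / ep ^+ 2 * \sum_(0 <= k < n) (if y x <= 2 ^+ k then y x else 0) ^+ 2 / 2 ^+ k.
  rewrite mulr_sumr; apply: eq_bigr => k _; rewrite /cap natrX invfM; ring.
by rewrite ler_wpM2l ?divr_ge0 ?sqr_ge0//; exact: dyadic_above.
Qed.

Hypothesis delta0 : 0 <= delta.

(* Blocks [2^(k-1), 2^k] of prefix lengths are controlled by a single deviation at [2^k];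
   finitely many short blocks are absorbed in the constant [C]. *)
Lemma spine_excess (ep eta : R) : 0 < ep -> 2 * delta <= ep -> 0 < eta ->
  exists2 C : R, 0 < C & forall u,
  (Ex P (fun t => Q u t * (has (fun m => (C + 2 * ep * m%:R <
      \sum_(1 <= j < m.+1) y (X (take j u) t))%R) (iota 0 (size u).+1))%:R)%R <= eta%:E)%E.
Proof.
move=> ep0 ed eta0.
have mQ := @measurable_path_weight _ _ _ _ _ mX.
have Q0 := path_weight_ge0 X0.
have mdc := measurable_deviation_cost ep.
have dc0 := deviation_cost_ge0 ep.
pose B := (2 + 8 / ep ^+ 2) * delta.
have c0 : 0 <= 2 + 8 / ep ^+ 2 by rewrite addr_ge0// divr_ge0 ?sqr_ge0.
have mVc k : measurable_fun setT (fun t => V t * deviation_cost ep (2 ^ k) (V t)).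
  by apply: measurable_funM => //; exact: (measurableT_comp (mdc _) mV).
have Vc0 k t : 0 <= V t * deviation_cost ep (2 ^ k) (V t) by rewrite mulr_ge0.
have sumB n : (\sum_(0 <= k < n) Ex P0 (fun t => V t * deviation_cost ep (2 ^ k) (V t))%R <=
  B%:E)%E.
  rewrite -Ex_sum//.
  apply: (@le_trans _ _ (Ex P0 (fun t => (2 + 8 / ep ^+ 2) * (V t * y (V t)))%R)).
    apply: Ex_le.
    - exact: measurable_sum.
    - by apply: measurable_funM => //; apply: measurable_funM => //; exact:
      (measurableT_comp my mV).
    - by move=> t; exact: sumr_ge0.
    - by move=> t; rewrite -mulr_sumr mulrCA ler_wpM2l// deviation_cost_sum.
  rewrite ExZ//.
  - by rewrite /B EFinM lee_wpmul2l.
  - by apply: measurable_funM => //; exact: (measurableT_comp my mV).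
  - by move=> t; rewrite mulr_ge0.
have fin k : exists s, Ex P0 (fun t => V t * deviation_cost ep (2 ^ k) (V t)) = s%:E.
  have : (0 <= Ex P0 (fun t => V t * deviation_cost ep (2 ^ k) (V t))%R <= B%:E)%E.
    rewrite Ex_ge0//=; apply: le_trans (sumB k.+1); rewrite big_nat_recr//= leeDr//.
    by apply: sume_ge0 => i _; exact: Ex_ge0.
  by case: (Ex _ _) => [r _|/andP[_]|/andP[]]; [exists r|rewrite leye_eq|rewrite leeNy_eq].
have [s sE] := choice fin.
have s0 k : 0 <= s k by rewrite -lee_fin -sE; exact: Ex_ge0.
have eta2 : 0 < eta / 2 by rewrite divr_gt0.
have [|k0 hk0] := @tail_small _ s B _ s0 _ eta2.
  by move=> n; rewrite -lee_fin -sumEFin; apply: le_trans (sumB n); apply: lee_sum => k _;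
    rewrite sE.
pose N0 := (2 ^ k0)%N.
(* Markov's inequality for the short prefixes: the sum over at most [N0] terms has mean at most
   [N0 * delta], and dividing by [C] leaves at most [eta / 2]. The summand 1 makes [C] positive. *)
pose C := 2 / eta * (N0%:R * delta) + 1.
have C0 : 0 < C by rewrite ltr_wpDl// mulr_ge0 ?divr_ge0 ?mulr_ge0// ltW.
exists C => // u; set n := size u.
pose Rm m t := \sum_(1 <= j < m.+1) y (X (take j u) t).
have mR m : measurable_fun setT (Rm m).
  by apply: measurable_sum => j; exact: (measurableT_comp my (mX _)).
have R0 m t : 0 <= Rm m t by exact: sumr_ge0.
have R_le m m' t : (m <= m')%N -> Rm m t <= Rm m' t.
  by move=> mm; rewrite /Rm (@big_cat_nat _ _ _ m.+1 1 m'.+1)//= lerDl; exact: sumr_ge0.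
(* The block end is clipped to the length of [u], so the same family of events serves paths of every
   length. *)
pose I k t : R := (ep * (2 ^ k)%N%:R < Rm (minn (2 ^ k) n) t)%R%:R.
have mI k : measurable_fun setT (I k).
  by apply: measurable_bool_R; exact: measurable_fun_ltr.
have EI k : (Ex P (fun t => Q u t * I k t)%R <= (s k)%:E)%E.
  have kn : (minn (2 ^ k) n <= size u)%N by rewrite geq_minr.
  rewrite (size_biased_take kn); last 2 first.
  - apply: measurable_bool_R; apply: measurable_fun_ltr => //.
    apply: measurable_sum_nat => j /andP[_ jm]; apply: (measurableT_comp my).
    by apply: sigma_fun_var; exists j.
  - by move=> t; exact: ler0n.
  rewrite -sE; apply: le_trans (spine_deviation (u := take (minn (2 ^ k) n) u) (N :=
    2 ^ k) _ _ ep0 ed).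
  - rewrite size_takel// le_eqVlt; apply/orP; left; apply/eqP; apply: eq_Ex => t.
    rewrite /I /Rm; congr (_ * (_ < _)%R%:R).
    by rewrite !big_nat; apply: eq_bigr => j /andP[_ jm]; rewrite take_takel.
  - by rewrite expn_gt0.
  - by rewrite size_takel// geq_minl.
apply: (@le_trans _ _ (Ex P (fun t => C^-1 * (Q u t * Rm (minn N0 n) t) + \sum_(k0 <= k < n.+1) Q u
  t * I k t)%R)).
  apply: Ex_le.
  - apply: measurable_funM => //; apply: measurable_bool_R.
    by apply: measurable_has => m; apply: measurable_fun_ltr => //; exact: (mR m).
  - apply: measurable_funD; first by apply: measurable_funM => //; exact: measurable_funM.
    by apply: measurable_sum => k; exact: measurable_funM.
  - by move=> t; rewrite mulr_ge0 ?ler0n.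
  move=> t; rewrite mulrCA -mulr_sumr -mulrDr; apply: ler_wpM2l => //.
  have I0 k : 0 <= I k t by exact: ler0n.
  have S0 : 0 <= \sum_(k0 <= k < n.+1) I k t by exact: sumr_ge0.
  have R00 : 0 <= C^-1 * Rm (minn N0 n) t by rewrite mulr_ge0 ?invr_ge0// ltW.
  case: hasP => [[m]|_]; last by rewrite addr_ge0.
  rewrite mem_iota add0n ltnS /= => mn mR'.
  have [mN|Nm] := leqP m N0.
    rewrite -[leLHS]addr0 lerD// mulrC ler_pdivlMr// mul1r.
    apply: le_trans (R_le m (minn N0 n) t _); last by rewrite leq_min mN.
    by apply: le_trans (ltW mR'); rewrite lerDl mulr_ge0// mulr_ge0// ltW.
  (* The smallest power [2^k >= m] satisfies [2^k <= 2 m]; this is the origin of the factor 2 in the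
     slope [2 * ep]. *)
  pose k := up_log 2 m.
  have N01 : (0 < N0)%N by rewrite expn_gt0.
  have /andP[k1 k2] : (2 ^ k.-1 < m <= 2 ^ k)%N.
    by apply: up_log_bounds => //; exact: leq_ltn_trans Nm.
  have kpos : (0 < k)%N by rewrite up_log_gt0 (leq_ltn_trans _ Nm).
  have kk : (k0 <= k < n.+1)%N.
    rewrite ltnS; apply/andP; split.
      by rewrite -(@leq_exp2l 2)//; apply: leq_trans k2; exact: ltnW.
    rewrite -(prednK kpos); apply: leq_trans mn; apply: leq_ltn_trans k1.
    exact/ltnW/ltn_expl.
  rewrite -[leLHS]add0r lerD// (bigD1_seq k) ?iota_uniq ?mem_index_iota//=.
  rewrite -[leLHS]addr0 lerD//; last by apply: sumr_ge0.
  rewrite /I; case: ltP => //= le_R; exfalso.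
  have : Rm m t <= Rm (minn (2 ^ k) n) t by apply: R_le; rewrite leq_min k2.
  move: le_R mR'; rewrite -/(Rm m t).
  have : ((2 ^ k)%N%:R <= 2 * m%:R :> R).
    by rewrite -natrM ler_nat -(prednK kpos) expnS leq_mul2l /= ltnW.
  have e0 : 0 <= ep by rewrite ltW.
  move=> h1 h2 h3 h4; have := ler_wpM2l e0 h1; lra.
rewrite ExD//; last 4 first.
- by apply: measurable_funM => //; exact: measurable_funM.
- by apply: measurable_sum => k; exact: measurable_funM.
- by move=> t; rewrite mulr_ge0 ?invr_ge0 ?mulr_ge0// ltW.
- by move=> t; apply: sumr_ge0 => k _; rewrite mulr_ge0 ?ler0n.
have -> : eta = eta / 2 + eta / 2 by lra.
rewrite EFinD; apply: leeD; last first.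
  rewrite Ex_sum.
  - apply: (@le_trans _ _ (\sum_(k0 <= k < n.+1) (s k)%:E)%E).
      by apply: lee_sum => k _; exact: EI.
    by rewrite sumEFin lee_fin.
  - by move=> k; exact: measurable_funM.
  - by move=> k t; rewrite mulr_ge0 ?ler0n.
rewrite ExZ ?invr_ge0 ?(ltW C0)//; last 2 first.
- exact: measurable_funM.
- by move=> t; rewrite mulr_ge0.
have mN : (minn N0 n <= size u)%N by rewrite geq_minr.
have -> : Ex P (fun t => Q u t * Rm (minn N0 n) t) =
    Ex P (fun t => \sum_(j <- index_iota 1 (minn N0 n).+1 | (0 < j <= size u)%N) Q u t * y (X (take
      j u) t)).
  apply: eq_Ex => t; rewrite /Rm mulr_sumr big_nat [RHS]big_nat_cond; apply: eq_bigl => j.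
  by rewrite ltnS; case: (ltnP 0 j) => //= _; case: leqP => //= jm; rewrite (leq_trans jm).
rewrite Ex_sum.
- rewrite (eq_bigr (fun=> Ex P0 (fun t => V t * y (V t))%R)); last first.
    by move=> j ju; rewrite size_biased_single.
  apply: (@le_trans _ _ (C^-1%:E * (N0%:R * delta)%:E)%E).
    apply: lee_wpmul2l; first by rewrite lee_fin invr_ge0 ltW.
    apply: (@le_trans _ _ (\sum_(1 <= j < (minn N0 n).+1) delta%:E)%E).
      by rewrite big_mkcond; apply: lee_sum => j _; case: ifP; rewrite ?lee_fin.
    rewrite sumEFin sumr_const_nat subn1/= lee_fin -[leLHS]mulr_natl.
    by rewrite ler_wpM2r// ler_nat geq_minl.
  rewrite -EFinM lee_fin mulrC ler_pdivrMr// /C.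
  have : eta / 2 * (2 / eta * (N0%:R * delta)) = N0%:R * delta by field; rewrite gt_eqF.
  nra.
- by move=> j; apply: measurable_funM => //; exact: (measurableT_comp my (mX _)).
- by move=> j t; rewrite mulr_ge0.
Qed.

End chebyshev.

(** The bound is imposed at every prefix at once, because a second path may branch off at any
    level. *)
Definition tame (C beta : R) (u : seq L) (t : T) : bool :=
  all (fun m => Q (take m u) t <= C * beta ^+ m) (iota 0 (size u).+1).

Lemma measurable_tame C beta u : measurable_fun setT (tame C beta u).
Proof.
have -> : tame C beta u =
    fun t => ~~ has (fun m => ~~ (Q (take m u) t <= C * beta ^+ m)) (iota 0 (size u).+1).
  by apply/funext => t; rewrite [has _ _]has_predC negbK.
apply: measurable_neg; apply: measurable_has => m; apply: measurable_neg.
apply: measurable_fun_ler => //; exact: measurable_path_weight.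
Qed.

(* [ln x = min (ln x) K + max (ln x - K) 0]: the truncated part has exponential moments under the
   size-biased law, while the excess has only a small first moment. *)
Lemma spine_tame (e eta : R) : 0 < e -> 0 < eta ->
  exists2 C : R, 0 < C & forall u,
  (Ex P (fun t => Q u t * (~~ tame C (expR (h + e)) u t)%:R)%R <= eta%:E)%E.
Proof.
move=> e0 eta0.
(* Budget for the slope: the capped part is allowed [h + e / 2], and the excess, of mean at most
   [e / 8], is allowed [2 * (e / 4)]. *)
have e4 : 0 < e / 4 by rewrite divr_gt0.
have e8 : 0 < e / 8 by rewrite divr_gt0.
have eta2 : 0 < eta / 2 by rewrite divr_gt0.
have [K K0 /andP[hK Kh]] := truncated_ln_close mV V0 VlnV e8.
have mK := measurable_truncated_ln K.
have iK := truncated_ln_integrable mV VlnV K0.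
pose y (x : R) := Num.max (ln x - K) 0.
have my : measurable_fun setT y.
  by apply: measurable_maxr => //; apply: measurable_funB => //; exact: measurable_ln.
have y0 x : 0 <= y x by rewrite le_max lexx orbT.
have lny x : ln x = Num.min (ln x) K + y x.
  rewrite /y; case: (leP (ln x) K) => h.
    have -> : Num.max (ln x - K) 0 = 0 by apply/max_idPr; lra.
    by rewrite addr0.
  have -> : Num.max (ln x - K) 0 = ln x - K by apply/max_idPl; lra.
  by rewrite addrC subrK.
have mVy : measurable_fun setT (fun t => V t * y (V t)).
  by apply: measurable_funM => //; exact: (measurableT_comp my mV).
have Ey : (Ex P0 (fun t => V t * y (V t))%R <= (e / 8)%:E)%E.
  have E : Ex P0 (fun t => V t * y (V t)) = (\int[P0]_t (V t * ln (V t) - V t * Num.min (ln (V t))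
    K))%:E.
    rewrite -Ex_Rintegral.
      by apply: eq_Ex => t; rewrite {1}lny; ring.
    by have := integrableB measurableT VlnV iK; apply: eq_integrable.
  by rewrite E RintegralB// lee_fin; lra.
have [|||||s [theta [s0 /andP[th0 th1] le_th]]] := @chernoff _ _ _ P0 V mV V0 V1
  (fun x => Num.min (ln x) K) (h + e / 2) (16 + K ^+ 2 * expR (K / 2)).
- exact: mK.
- by rewrite addr_ge0// mulr_ge0 ?sqr_ge0 ?expR_ge0.
- by move=> x x0; exact: truncated_ln_moment.
- exact: iK.
- by lra.
have [|C2 C20 hC2] := @spine_excess y (e / 8) my y0 Ey (ltW e8) (e / 4) (eta / 2) e4 _ eta2.
  lra.
(* Chosen so that [expR (- (s * c1))] times the geometric sum [1 / (1 - theta)] equals [eta / 2]. *)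
pose c1 := - ln (eta / 2 * (1 - theta)) / s.
have t1 : 0 < 1 - theta by rewrite subr_gt0.
have ec1 : expR (- (s * c1)) = eta / 2 * (1 - theta).
  rewrite /c1 mulrCA mulfV ?gt_eqF// mulr1 opprK lnK// posrE mulr_gt0//.
have mQ := @measurable_path_weight _ _ _ _ _ mX.
have Q0 := path_weight_ge0 X0.
have th0' := ltW th0.
exists (expR (c1 + C2)); first exact: expR_gt0.
move=> u; set n := size u.
pose S m t := \sum_(1 <= j < m.+1) Num.min (ln (X (take j u) t)) K.
pose Rm m t := \sum_(1 <= j < m.+1) y (X (take j u) t).
have mS m : measurable_fun setT (S m).
  by apply: measurable_sum => j; exact: (measurableT_comp mK (mX _)).
have mR m : measurable_fun setT (Rm m).
  by apply: measurable_sum => j; exact: (measurableT_comp my (mX _)).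
pose I m t : R := (c1 + m%:R * (h + e / 2) <= S m t)%R%:R.
pose H t : R := (has (fun m => C2 + 2 * (e / 4) * m%:R < Rm m t) (iota 0 n.+1))%:R.
have mI m : measurable_fun setT (I m) by apply: measurable_bool_R; exact: measurable_fun_ler.
have mH : measurable_fun setT H.
  by apply: measurable_bool_R; apply: measurable_has => m; exact: measurable_fun_ltr.
apply: (@le_trans _ _ (Ex P (fun t => \sum_(0 <= m < n.+1) Q u t * I m t + Q u t * H t)%R)).
  apply: Ex_le.
  - apply: measurable_funM => //; apply: measurable_bool_R; apply: measurable_neg.
    exact: measurable_tame.
  - by apply: measurable_funD; [apply: measurable_sum => m|]; exact: measurable_funM.
  - by move=> t; rewrite mulr_ge0 ?ler0n.
  move=> t; rewrite -mulr_sumr -mulrDr.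
  have [->|Qn0] := eqVneq (Q u t) 0; first by rewrite !mul0r.
  apply: ler_wpM2l => //.
  have I0 m : 0 <= I m t by exact: ler0n.
  have H0 : 0 <= H t by exact: ler0n.
  rewrite /tame -has_predC; case: hasP => [[m]|_]; last by rewrite addr_ge0// sumr_ge0.
  rewrite mem_iota add0n ltnS /= -ltNge => mn.
  have mu : (m <= size u)%N by [].
  rewrite (path_weight_expR (path_weight_neq0_take mu Qn0)) -expRM_natl -expRD ltr_expR.
  have -> : \sum_(1 <= j < (size (take m u)).+1) ln (X (take j (take m u)) t) = S m t + Rm m t.
    rewrite -big_split/= size_takel// !big_nat; apply: eq_bigr => j /andP[_ jm].
    by rewrite take_takel// lny.
  move=> big.
  (* If the capped part stays below its line, the excess has to exceed its own; the intercepts [c1]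
     and [C2] and the two slopes add up exactly. *)
  have [le1|lt1] := leP (c1 + m%:R * (h + e / 2)) (S m t).
    rewrite -[leLHS]addr0 lerD// (bigD1_seq m) ?iota_uniq ?mem_index_iota//=.
    by rewrite {1}/I le1 lerDl sumr_ge0.
  rewrite -[leLHS]add0r lerD ?sumr_ge0// /H.
  suff -> : has (fun m => C2 + 2 * (e / 4) * m%:R < Rm m t) (iota 0 n.+1) by [].
  apply/hasP; exists m; first by rewrite mem_iota add0n ltnS.
  lra.
rewrite ExD//; last 4 first.
- by apply: measurable_sum => m; exact: measurable_funM.
- exact: measurable_funM.
- by move=> t; apply: sumr_ge0 => m _; rewrite mulr_ge0 ?ler0n.
- by move=> t; rewrite mulr_ge0 ?ler0n.
have -> : eta = eta / 2 + eta / 2 by lra.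
rewrite EFinD; apply: leeD; last exact: hC2.
rewrite Ex_sum.
- apply: (@le_trans _ _ (\sum_(0 <= m < n.+1) (expR (- (s * c1)) * theta ^+ m)%:E)%E).
    rewrite !big_nat; apply: lee_sum => m; rewrite ltnS => /= mn.
    exact: (spine_chernoff c1 mK mn s0 th0' le_th).
  rewrite sumEFin lee_fin -mulr_sumr ec1.
  have : \sum_(0 <= m < n.+1) theta ^+ m <= (1 - theta)^-1.
    by apply: geometric_le; rewrite th1 andbT.
  rewrite -[leRHS]mul1r ler_pdivlMr// mulrC => hg.
  by rewrite -(mulrA (eta / 2)); apply: ler_piMr => //; exact: ltW.
- by move=> m; exact: measurable_funM.
- by move=> m t; rewrite mulr_ge0 ?ler0n.
Qed.

End spine.

(** * From finite levels to the limit measure *)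

Section words.
Context {L : finType}.

Fixpoint words (n : nat) : seq (seq L) :=
  if n is n'.+1 then [seq c :: w | c <- enum L, w <- words n'] else [:: [::]].

Lemma mem_words n w : (w \in words n) = (size w == n).
Proof.
elim: n w => [|n ih] [|c w] //=.
  by apply/negbTE/allpairsP => -[[c w] [_ _]].
apply/allpairsP/idP => [[[c' w'] /= [_ + [_ ->]]]|]; first by rewrite ih.
by move=> wn; exists (c, w); split => //=; [rewrite mem_enum|rewrite ih].
Qed.

Lemma uniq_words n : uniq (words n).
Proof.
elim: n => //= n ih; apply: allpairs_uniq => //; first exact: enum_uniq.
by move=> [c w] [c' w'] _ _ /= [-> ->].
Qed.

Lemma size_words n : size (words n) = (#|L| ^ n)%N.
Proof. by elim: n => //= n ih; rewrite size_allpairs ih -cardE expnS. Qed.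

Lemma big_wordsS {R : nmodType} n (f : seq L -> R) :
  \sum_(w <- words n.+1) f w = \sum_(c : L) \sum_(w <- words n) f (c :: w).
Proof. by rewrite /= big_allpairs_dep big_enum. Qed.

Lemma big_words_cat {R : nmodType} n m (f : seq L -> R) :
  \sum_(w <- words (n + m)) f w = \sum_(u <- words n) \sum_(v <- words m) f (u ++ v).
Proof.
elim: n f => [|n ih] f; first by rewrite big_seq1.
rewrite addSn !big_wordsS; apply: eq_bigr => c _; exact: ih.
Qed.

End words.
Arguments words : clear implicits.

Lemma big_words_prod {A B : finType} {R : nmodType} n (f : seq A -> seq B -> R) :
  \sum_(z <- words (A * B)%type n) f (unzip1 z) (unzip2 z) =
  \sum_(u <- words A n) \sum_(v <- words B n) f u v.
Proof.
elim: n f => [|n ih] f; first by rewrite !big_seq1.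
rewrite !big_wordsS -(pair_bigA _ (fun c d => \sum_(w <- words (A * B)%type n) f (unzip1 ((c,
  d) :: w)) (unzip2 ((c, d) :: w))))/=.
apply: eq_bigr => c _; under eq_bigr => d _ do rewrite (ih (fun u v => f (c :: u) (d :: v))).
rewrite exchange_big; apply: eq_bigr => u _; by rewrite big_wordsS.
Qed.

Section level_mass.
Context {R : realType} {L : finType} {T : Type}.
Variable q : seq L -> T -> R.

(** For [q] the products of weights and [n >= size u], this is the mass given to the cylinder of [u]
    by the density of level [n]. Keeping [q] arbitrary lets the same lemmas serve words over a
    product alphabet. *)
Definition level_mass (n : nat) (u : seq L) (t : T) : R :=
  #|L|%:R ^- n * \sum_(z <- words L n | take (size u) z == u) q z t.

Lemma sum_level_mass N n (G : seq L -> R) t : (N <= n)%N ->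
  \sum_(x <- words L N) level_mass n x t * G x =
  #|L|%:R ^- n * \sum_(z <- words L n) q z t * G (take N z).
Proof.
move=> Nn; rewrite /level_mass.
under eq_bigr do rewrite -mulrA mulr_suml.
rewrite -mulr_sumr; congr (_ * _).
under eq_bigr do rewrite big_mkcond.
rewrite exchange_big; apply: eq_big_seq => z; rewrite mem_words => /eqP zn.
rewrite (bigD1_seq (take N z)) ?uniq_words ?mem_words ?size_takel ?zn//=.
rewrite eqxx big_seq_cond big1 ?addr0// => x; rewrite mem_words => /andP[/eqP <-].
by rewrite eq_sym => /negbTE ->.
Qed.

End level_mass.

Section transfer.
Context {R : realType} {d : measure_display} {T : measurableType d}.
Variable P : probability T R.
Context {L : finType}.
Hypothesis L0 : (0 < #|L|)%N.
Variables (q m : seq L -> T -> R).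
Hypothesis mq : forall u, measurable_fun setT (q u).
Hypothesis q0 : forall u t, 0 <= q u t.
Hypothesis mm : forall u, measurable_fun setT (m u).
Hypothesis m0 : forall u t, 0 <= m u t.
Hypothesis q_m : {ae P, forall t u, level_mass q n u t @[n --> \oo] --> m u t}.

Lemma level_mass_ge0 n u t : 0 <= level_mass q n u t.
Proof. by rewrite mulr_ge0 ?invr_ge0 ?exprn_ge0// sumr_ge0. Qed.

Lemma measurable_level_mass n u : measurable_fun setT (level_mass q n u).
Proof.
apply: measurable_funM => //; under eq_fun do rewrite -big_filter.
exact: measurable_sum.
Qed.

(** Integrating a function of the first [N] letters against the limit masses is a limit of the same
    integral at level [n], and Fatou preserves upper bounds. *)
Lemma Ex_mass_le (G : seq L -> T -> R) N (c : \bar R) :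
  (forall x, measurable_fun setT (G x)) -> (forall x t, 0 <= G x t) ->
  (\forall n \near \oo, (Ex P (fun t => #|L|%:R ^- n * \sum_(z <- words L n) q z t * G (take N z)
    t)%R <= c)%E) ->
  (Ex P (fun t => \sum_(x <- words L N) m x t * G x t)%R <= c)%E.
Proof.
move=> mG G0 le_c.
apply: (@fatou_le _ _ _ P (fun n t => \sum_(x <- words L N) level_mass q n x t * G x t)).
- by move=> n; apply: measurable_sum => x; apply: measurable_funM => //;
  exact: measurable_level_mass.
- by move=> n t; apply: sumr_ge0 => x _; rewrite mulr_ge0 ?level_mass_ge0.
- by apply: measurable_sum => x; exact: measurable_funM.
- apply: filterS q_m => t cv.
  elim: (words L N) => [|x s ih].
    by rewrite big_nil; under eq_fun do rewrite big_nil; exact: cvg_cst.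
  rewrite big_cons; under eq_fun do rewrite big_cons.
  by apply: cvgD => //; apply: cvgM; [exact: cv|exact: cvg_cst].
- have /filterS2 := le_c; apply; last exact: (nbhs_infty_ge N).
  move=> n le_c' /= Nn; apply: le_trans le_c'; rewrite le_eqVlt; apply/orP; left; apply/eqP.
  by apply: eq_Ex => t; rewrite (sum_level_mass q (fun x => G x t) t Nn).
Qed.

(** At a finite level the expectation is a uniform average over words, so a bound valid for each
    single word suffices. This is where one fixed path with the size-biased law enters. *)
Lemma Ex_mass_le_max (G : seq L -> T -> R) N (c : R) :
  (forall x, measurable_fun setT (G x)) -> (forall x t, 0 <= G x t) ->
  (forall z, (N <= size z)%N -> (Ex P (fun t => q z t * G (take N z) t)%R <= c%:E)%E) ->
  (Ex P (fun t => \sum_(x <- words L N) m x t * G x t)%R <= c%:E)%E.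
Proof.
move=> mG G0 le_c; apply: Ex_mass_le => //.
exists N => // n /= Nn.
have mqG z : measurable_fun setT (fun t => q z t * G (take N z) t) by exact: measurable_funM.
have qG0 z t : 0 <= q z t * G (take N z) t by rewrite mulr_ge0.
rewrite ExZ ?invr_ge0 ?exprn_ge0//; [|exact: measurable_sum|by move=> t; exact: sumr_ge0].
rewrite Ex_sum//.
have Ln : 0 < #|L|%:R ^+ n :> R by rewrite exprn_gt0// ltr0n.
apply: (@le_trans _ _ ((#|L|%:R ^- n)%:E * \sum_(z <- words L n) c%:E)%E).
  apply: lee_wpmul2l; first by rewrite lee_fin invr_ge0 ltW.
  rewrite big_seq [leRHS]big_seq; apply: lee_sum => z; rewrite mem_words => /eqP zn.
  by apply: le_c; rewrite zn.
rewrite sumEFin big_const_seq count_predT size_words iter_addr_0 -EFinM lee_fin.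
by rewrite -[X in _ * X]mulr_natl natrX mulrA mulVf ?gt_eqF// mul1r.
Qed.

Section lower.
Variable close : nat -> seq L -> seq L -> bool.
Variables rho tau : R.
Hypothesis rho0 : 0 <= rho.
Hypothesis rho_tau : rho < tau.

Definition close_mass k x t := \sum_(x' <- words L k | close k x x') m x' t.

Hypothesis kernel : forall eta : R, 0 < eta -> exists C (g : seq L -> T -> bool),
  [/\ 0 <= C, forall z, measurable_fun setT (g z),
      forall z, (Ex P (fun t => q z t * (~~ g z t)%:R)%R <= eta%:E)%E &
      forall z k n, (k <= size z)%N -> (size z <= n)%N ->
        (Ex P (fun t => #|L|%:R ^- n * \sum_(z' <- words L n | close k (take k z) (take k z'))
            q z t * (g z t)%:R * q z' t)%R <= (C * rho ^+ k)%:E)%E].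

Lemma measurable_close_mass k x : measurable_fun setT (close_mass k x).
Proof.
have -> : close_mass k x = fun t => \sum_(x' <- [seq x' <- words L k | close k x x']) m x' t.
  by apply/funext => t; rewrite big_filter.
exact: measurable_sum.
Qed.

Lemma close_mass_ge0 k x t : 0 <= close_mass k x t.
Proof. exact: sumr_ge0. Qed.

(** On the good event, Markov's inequality at scale [k] gains [(rho / tau)^k]. The tail of this
    geometric series from [K0] on is small, uniformly in [K1]; the bad event costs [eta / 2]. *)
Lemma close_mass_small (eta : R) : 0 < eta -> exists K0, forall K1,
  (Ex P (fun t => \sum_(x <- words L K1)
    m x t * (has (fun k => tau ^+ k < close_mass k (take k x) t) (iota K0 (K1.+1 - K0)))%:R)%R
  <= eta%:E)%E.
Proof.
move=> eta0.
have tau0 : 0 < tau by exact: le_lt_trans rho_tau.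
have eta2 : 0 < eta / 2 by rewrite divr_gt0.
have [C [g [C0 mg Eg Ek]]] := kernel eta2.
pose th := rho / tau.
have th01 : 0 <= th < 1 by rewrite divr_ge0 ?(ltW tau0)//= ltr_pdivrMr// mul1r.
have th0 : 0 <= th by case/andP: th01.
have [||K0 hK0] := @tail_small _ (fun k => C * th ^+ k) (C / (1 - th)) (eta / 2) _ _ eta2.
- by move=> k; rewrite mulr_ge0// exprn_ge0.
- by move=> n; rewrite -mulr_sumr ler_wpM2l//; exact: geometric_le.
exists K0 => K1.
have mbad k x : measurable_fun setT (fun t => tau ^+ k < close_mass k x t).
  by apply: measurable_fun_ltr => //; exact: measurable_close_mass.
apply: Ex_mass_le_max.
- by move=> x; apply: measurable_bool_R; exact: measurable_has.
- by move=> x t; exact: ler0n.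
move=> z zK.
have mng : measurable_fun setT (fun t => (~~ g z t)%:R : R).
  by apply: measurable_bool_R; exact: measurable_neg.
have mgR : measurable_fun setT (fun t => (g z t)%:R : R) by exact: measurable_bool_R.
have mqg : measurable_fun setT (fun t => q z t * (g z t)%:R) by exact: measurable_funM.
have qg0 t : 0 <= q z t * (g z t)%:R by rewrite mulr_ge0 ?ler0n.
(* The Markov bound for the indicator that [close_mass] exceeds [tau ^+ k], kept together with the
   weight and the good event. *)
pose J k t := tau ^- k * (q z t * (g z t)%:R * close_mass k (take k z) t).
have mJ k : measurable_fun setT (J k).
  by apply: measurable_funM => //; apply: measurable_funM => //; exact: measurable_close_mass.
have J0 k t : 0 <= J k t.
  by rewrite mulr_ge0 ?invr_ge0 ?exprn_ge0 ?(ltW tau0)// mulr_ge0// close_mass_ge0.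
apply: (@le_trans _ _ (Ex P (fun t => q z t * (~~ g z t)%:R + \sum_(K0 <= k < K1.+1) J k t)%R)).
  apply: Ex_le.
  - by apply: measurable_funM => //; apply: measurable_bool_R; exact: measurable_has.
  - by apply: measurable_funD; [exact: measurable_funM|exact: measurable_sum].
  - by move=> t; rewrite mulr_ge0 ?ler0n.
  move=> t; case: hasP => [[k]|_]; last first.
    by rewrite mulr0 addr_ge0 ?mulr_ge0 ?ler0n// sumr_ge0.
  rewrite -/(index_iota K0 K1.+1) => kK; rewrite take_takel; last first.
    by move: kK; rewrite mem_index_iota ltnS => /andP[].
  move=> bad; rewrite mulr1.
  have Sk : J k t <= \sum_(K0 <= k < K1.+1) J k t.
    by rewrite (bigD1_seq k) ?iota_uniq//= lerDl sumr_ge0.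
  case: (boolP (g z t)) => gz; rewrite /= ?mulr1 ?mulr0 ?add0r; last first.
    by rewrite lerDl sumr_ge0.
  apply: le_trans Sk; rewrite /J gz mulr1 mulrCA ler_peMr//.
  by rewrite mulrC ler_pdivlMr ?exprn_gt0// mul1r ltW.
rewrite ExD//; last 4 first.
- exact: measurable_funM.
- exact: measurable_sum.
- by move=> t; rewrite mulr_ge0 ?ler0n.
- by move=> t; exact: sumr_ge0.
have -> : eta = eta / 2 + eta / 2 by lra.
rewrite EFinD; apply: leeD; first exact: Eg.
rewrite Ex_sum//.
apply: (@le_trans _ _ (\sum_(K0 <= k < K1.+1) (C * th ^+ k)%:E)%E); last first.
  by rewrite sumEFin lee_fin.
rewrite big_nat [leRHS]big_nat; apply: lee_sum => k; rewrite ltnS => /andP[_ kK1].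
have kz : (k <= size z)%N by exact: leq_trans zK.
rewrite ExZ ?invr_ge0 ?exprn_ge0 ?(ltW tau0)//; last 2 first.
- by apply: measurable_funM => //; exact: measurable_close_mass.
- by move=> t; rewrite mulr_ge0// close_mass_ge0.
have -> : C * th ^+ k = tau ^- k * (C * rho ^+ k) by rewrite /th expr_div_n; ring.
rewrite EFinM lee_wpmul2l ?lee_fin ?invr_ge0 ?exprn_ge0 ?(ltW tau0)//.
(* A second passage to the limit: with the first path [z] fixed, the limit masses of the second word
   are approximated at levels [n >= size z]. *)
have -> : Ex P (fun t => q z t * (g z t)%:R * close_mass k (take k z) t) =
   Ex P (fun t => \sum_(x' <- words L k) m x' t * (q z t * (g z t)%:R * (close k (take k z)
     x')%:R)).
  apply: eq_Ex => t; rewrite /close_mass mulr_sumr big_mkcond; apply: eq_bigr => x' _.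
  by case: ifP => _; rewrite ?mulr1 ?mulr0// mulrC.
apply: Ex_mass_le.
- by move=> x; exact: measurable_funM.
- by move=> x t; rewrite mulr_ge0 ?ler0n.
exists (size z) => // n /= zn.
apply: le_trans (Ek z k n kz zn); rewrite le_eqVlt; apply/orP; left; apply/eqP.
apply: eq_Ex => t; congr (_ * _); rewrite [RHS]big_mkcond; apply: eq_bigr => z' _.
by case: ifP => _; rewrite ?mulr1 ?mulr0// mulrC.
Qed.

End lower.

End transfer.

(** * Borel-Cantelli arguments for random measures *)

Section limsup.
Context {R : realType} {d dS : measure_display} {T : measurableType d} {S : measurableType dS}.
Variable P : probability T R.
Context {L : finType}.
Variable m : seq L -> T -> R.
Hypothesis mm : forall u, measurable_fun setT (m u).
Hypothesis m0 : forall u t, 0 <= m u t.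
Variable pre : S -> nat -> seq L.
Hypothesis size_pre : forall s k, size (pre s k) = k.
Hypothesis take_pre : forall s k l, (k <= l)%N -> take k (pre s l) = pre s k.
Hypothesis mpre : forall k x, measurable [set s | pre s k = x].
Variable mu : T -> {measure set S -> \bar R}.
Hypothesis mu_m : {ae P, forall t u, mu t [set s | pre s (size u) = u] = (m u t)%:E}.

Lemma measurable_pre_pred k (p : pred (seq L)) : measurable [set s | p (pre s k)].
Proof.
have -> : [set s | p (pre s k)] = \bigcup_(x in [set x | x \in [seq x <- words L k | p x]]) [set s
  | pre s k = x].
  apply/seteqP; split => [s /= ps|s [x /=]].
    by exists (pre s k) => //=; rewrite mem_filter ps mem_words size_pre/=.
  by rewrite mem_filter => /andP[px _] ->.
apply: fin_bigcup_measurable => //; exact: finite_seq.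
Qed.

Lemma measure_pre_pred (nu : {measure set S -> \bar R}) (f : seq L -> R) k (p : pred (seq L)) :
  (forall u, nu [set s | pre s (size u) = u] = (f u)%:E) ->
  (nu [set s | p (pre s k)] <= (\sum_(x <- words L k) f x * (p x)%:R)%:E)%E.
Proof.
move=> nuf.
have nu_list (l : seq (seq L)) : (forall x, x \in l -> size x = k) ->
    (nu [set s | pre s k \in l] <= \sum_(x <- l) (f x)%:E)%E.
  elim: l => [|x l ih] sl.
    by rewrite big_nil (_ : [set s | _] = set0) ?measure0//; apply/seteqP; split.
  have -> : [set s | pre s k \in x :: l] = [set s | pre s k = x] `|` [set s | pre s k \in l].
    apply/seteqP; split => s /=; first by rewrite inE => /orP[/eqP|]; [left|right].
    by rewrite inE => -[->|->]; rewrite ?eqxx ?orbT.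
  rewrite big_cons; apply: (le_trans (measureU2 _ _ _)) => //.
    exact: (measurable_pre_pred k (fun y => y \in l)).
  apply: leeD; last by apply: ih => y yl; apply: sl; rewrite inE yl orbT.
  by rewrite -nuf; rewrite (sl x) ?inE ?eqxx.
have -> : [set s | p (pre s k)] = [set s | pre s k \in [seq x <- words L k | p x]].
  by apply/seteqP; split => s /=; rewrite mem_filter mem_words size_pre eqxx andbT.
apply: le_trans (nu_list _ _) _.
  by move=> x; rewrite mem_filter mem_words => /andP[_ /eqP].
rewrite sumEFin lee_fin big_filter big_mkcond; apply: ler_sum => x _.
by case: (p x); rewrite ?mulr1 ?mulr0.
Qed.

(** The sum over [k] of the random masses of the bad sets has finite expectation, hence is almost
    surely finite, and the usual Borel-Cantelli lemma applies to each such measure. *)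
Lemma limsup_null_summable (beta : nat -> seq L -> T -> bool) (B : R) :
  (forall k x, measurable_fun setT (beta k x)) ->
  (forall n, (\sum_(0 <= k < n) Ex P (fun t => \sum_(x <- words L k) m x t * (beta k x t)%:R)%R <=
    B%:E)%E) ->
  {ae P, forall t, mu t (lim_sup_set (fun k => [set s | beta k (pre s k) t])) = 0%E}.
Proof.
move=> mbeta sumB.
pose e k t := \sum_(x <- words L k) m x t * (beta k x t)%:R.
have me k : measurable_fun setT (e k).
  by apply: measurable_sum => x; apply: measurable_funM => //; exact: measurable_bool_R.
have e0 k t : 0 <= e k t by apply: sumr_ge0 => x _; rewrite mulr_ge0 ?ler0n.
pose G t := (\sum_(0 <= k <oo) (e k t)%:E)%E.
have mG : measurable_fun setT G.
  apply: ge0_emeasurable_sum => k *; [by rewrite lee_fin|exact/measurable_EFinP].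
have G0 t : (0 <= G t)%E by apply: nneseries_ge0 => k _ _; rewrite lee_fin.
have iG : P.-integrable setT G.
  apply/integrableP; split => //.
  under eq_integral => t _ do rewrite gee0_abs//.
  rewrite /G integral_nneseries//; last 2 first.
  - by move=> k; exact/measurable_EFinP.
  - by move=> k t _; rewrite lee_fin.
  apply: (@le_lt_trans _ _ B%:E); last by rewrite ltry.
  apply: lime_le; first by apply: is_cvg_nneseries => k _ _; exact: Ex_ge0.
  by apply: nearW => n; exact: sumB.
apply: filterS2 mu_m (integrable_ae measurableT iG) => t mut /(_ Logic.I) Gt.
have mB k : measurable [set s | beta k (pre s k) t].
  exact: (measurable_pre_pred k (fun x => beta k x t)).
apply: lim_sup_set_cvg0 => //.
apply: (@le_lt_trans _ _ (G t)); last by rewrite -ge0_fin_numE.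
apply: lee_nneseries => k _ *; first exact: measure_ge0.
by apply: (@measure_pre_pred _ (m^~ t) k (fun x => beta k x t)) => u; exact: mut.
Qed.

(** The good event depends on [eta] and its complement is not small in [k], so the masses cannot
    simply be summed. Instead the union of the bad sets from [K0] on has expected mass at most
    [eta], and [eta] tends to 0 along [1 / (j + 1)]. *)
Lemma limsup_null (beta : nat -> seq L -> T -> bool) :
  (forall k x, measurable_fun setT (beta k x)) ->
  (forall eta : R, 0 < eta -> exists K0, forall K1,
    (Ex P (fun t => \sum_(x <- words L K1)
       m x t * (has (fun k => beta k (take k x) t) (iota K0 (K1.+1 - K0)))%:R)%R <= eta%:E)%E) ->
  {ae P, forall t, mu t (lim_sup_set (fun k => [set s | beta k (pre s k) t])) = 0%E}.
Proof.
move=> mbeta small.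
pose e K0 K1 t := \sum_(x <- words L K1)
  m x t * (has (fun k => beta k (take k x) t) (iota K0 (K1.+1 - K0)))%:R.
have me K0 K1 : measurable_fun setT (e K0 K1).
  apply: measurable_sum => x; apply: measurable_funM => //.
  by apply: measurable_bool_R; exact: measurable_has.
have e0 K0 K1 t : 0 <= e K0 K1 t by apply: sumr_ge0 => x _; rewrite mulr_ge0 ?ler0n.
have small' (j : nat) : exists K0, forall K1, (Ex P (e K0 K1) <= (j.+1%:R^-1)%:E)%E.
  by apply: small; rewrite invr_gt0.
have [K hK] := choice small'.
(* Fatou is used twice: in [K1], to reach the infinite union for fixed [j], and then in [j], to
   obtain a lower limit of zero expectation. *)
pose F j t := limn_einf (fun K1 => (e (K j) K1 t)%:E).
have mF j : measurable_fun setT (F j).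
  by apply: measurable_limn_einf => n; exact/measurable_EFinP.
have F0 j t : (0 <= F j t)%E by apply: limn_einf_ge => n; rewrite lee_fin.
have EF j : (\int[P]_t F j t <= (j.+1%:R^-1)%:E)%E.
  apply: (le_trans (fatou _ _ _ _)) => //.
  - by move=> n; exact/measurable_EFinP.
  - by move=> n t _; rewrite lee_fin.
  - by apply: limn_einf_le => n; exact: hK.
pose G t := limn_einf (F^~ t).
have mG : measurable_fun setT G by exact: measurable_limn_einf.
have G0 t : (0 <= G t)%E by exact: limn_einf_ge.
have EG : (\int[P]_t G t = 0)%E.
  apply/eqP; rewrite eq_le integral_ge0// andbT.
  apply: (le_trans (fatou _ _ _ _)) => //.
  have : (fun j => (j.+1%:R^-1)%:E) @ \oo --> (0 : R)%:E.
    by apply: cvg_EFin; [exact: nearW|exact: cvg_harmonic].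
  move=> /cvg_limn_einf_sup[h _].
  by apply: le_trans (limn_einf_mono EF) _; rewrite h.
have : ae_eq P setT G (cst 0%E).
  apply/ae_eq_integral_abs => //.
  by under eq_integral => t _ do rewrite gee0_abs//.
move=> G_eq0; apply: filterS2 mu_m G_eq0 => t mut /(_ Logic.I) /= Gt.
pose B k := [set s | beta k (pre s k) t].
have mB k : measurable (B k) by exact: (measurable_pre_pred k (fun x => beta k x t)).
pose U K0 K1 := [set s | has (fun k => beta k (take k (pre s K1)) t) (iota K0 (K1.+1 - K0))].
have UE K0 K1 : U K0 K1 = \bigcup_(k in [set k | K0 <= k <= K1]%N) B k.
  apply/seteqP; split => s /=.
    move=> /hasP[k]; rewrite -/(index_iota K0 K1.+1) mem_index_iota ltnS => kK.
    by case/andP: (kK) => _ kK1; rewrite take_pre// => bk; exists k.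
  move=> [k /= kK bk]; apply/hasP; exists k; first by rewrite -/(index_iota K0 K1.+1)
    mem_index_iota ltnS.
  by case/andP: (kK) => _ kK1; rewrite take_pre.
have mU K0 K1 : measurable (U K0 K1).
  exact: (measurable_pre_pred K1 (fun y => has (fun k => beta k (take k y) t) (iota K0 (K1.+1 -
    K0)))).
have mu_e K0 K1 : (mu t (U K0 K1) <= (e K0 K1 t)%:E)%E.
  apply: (@measure_pre_pred _ (m^~ t) K1 (fun y => has (fun k => beta k (take k y) t) (iota K0
    (K1.+1 - K0)))) => u.
  exact: mut.
apply/eqP; rewrite eq_le measure_ge0 andbT -Gt.
apply: limn_einf_ge => j; apply: (@le_trans _ _ (mu t (\bigcup_(k >= K j) B k))).
  exact: lim_sup_set_ub.
have -> : \bigcup_(k >= K j) B k = \bigcup_n U (K j) n.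
  apply/seteqP; split => s [k /= kK bk].
    by exists k => //; rewrite UE; exists k => //=; rewrite kK leqnn.
  by move: bk; rewrite UE => -[l /= /andP[lK _] bl]; exists l.
have cv : mu t (U (K j) n) @[n --> \oo] --> mu t (\bigcup_n U (K j) n).
  apply: nondecreasing_cvg_mu => //; first exact: bigcup_measurable.
  move=> n1 n2 n12; apply/subsetPset; rewrite !UE => s [k /= /andP[k1 k2] bk].
  by exists k => //=; rewrite k1 (leq_trans k2).
have [<- _] := cvg_limn_einf_sup cv.
exact: limn_einf_mono (mu_e (K j)).
Qed.

End limsup.

(** * Masses of cylinders *)

Section cylinders.
Context {a : nat}.

Lemma size_prefix_word (i : seq_space a) k : size (prefix_word i k) = k.
Proof. by rewrite size_map size_iota. Qed.

Lemma take_prefix_word (i : seq_space a) k l : (k <= l)%N ->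
  take k (prefix_word i l) = prefix_word i k.
Proof. by move=> kl; rewrite -map_take take_iota (minn_idPl kl). Qed.

Lemma prefix_wordS (i : seq_space a) k :
  prefix_word i k.+1 = rcons (prefix_word i k) (i k : letter a).
Proof. by rewrite /prefix_word -addn1 iotaD map_cat /= add0n cats1. Qed.

Lemma open_prefix (k : nat) (z : word a) :
  @open (seq_topology a) [set i : seq_topology a | prefix_word i k = z].
Proof.
elim: k z => [|k ih] z.
  have [->|z0] := eqVneq z [::].
    by rewrite (_ : [set _ | _] = setT)//; [exact: openT|apply/seteqP; split].
  rewrite (_ : [set _ | _] = set0); first exact: open0.
  by apply/seteqP; split => // i /= h; rewrite -h eqxx in z0.
case/lastP: z => [|z c].
  rewrite (_ : [set _ | _] = set0); first exact: open0.
  by apply/seteqP; split => // i /= /(congr1 size); rewrite size_prefix_word.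
rewrite (_ : [set _ | _] = [set i : seq_topology a | prefix_word i k = z] `&`
   (proj k : seq_topology a -> discrete_topology (letter a)) @^-1` [set c]).
  apply: openI; first exact: ih.
  apply: open_comp => [x _|]; last exact: discrete_open.
  exact: (@proj_continuous nat (fun=> discrete_topology (letter a)) k).
apply/seteqP; split => i /=; rewrite prefix_wordS; first by move=> /rcons_inj [h1 h2]; split.
by move=> [-> h2]; rewrite -h2.
Qed.

Lemma measurable_prefix k z : measurable [set i : seq_space a | prefix_word i k = z].
Proof. by apply: sub_sigma_algebra; exact: open_prefix. Qed.

Lemma measurable_cylinder (u : word a) : measurable (cylinder u).
Proof. exact: measurable_prefix. Qed.

(** Cylinders are open and closed, so their indicators are admissible test functions; this turns
    weak convergence into convergence of the masses of cylinders. *)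
Lemma continuous_cylinder {R : realType} (u : word a) :
  continuous (\1_(cylinder u) : seq_topology a -> R).
Proof.
move=> i A /nbhs_singleton Ai.
have : nbhs (i : seq_topology a) [set j : seq_topology a | prefix_word j (size u) = prefix_word i
  (size u)].
  by apply: open_nbhs_nbhs; split => //; exact: open_prefix.
apply: filterS => j /= ji; suff <- : \1_(cylinder u) i = \1_(cylinder u) j :> R by [].
rewrite !indicE; suff -> : (i \in cylinder u) = (j \in cylinder u) by [].
by apply/idP/idP; rewrite !inE /cylinder /= ji.
Qed.

End cylinders.

Lemma card_letter a : (0 < a)%N -> #|letter a| = a.
Proof. by move=> a0; rewrite card_ord prednK. Qed.

Section weak_limit.
Context {R : realType} {a : nat}.
Hypothesis a0 : (0 < a)%N.
Variable ell : probability (seq_space a) R.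
Hypothesis ell_unif : uniform_measure ell.
Variable V : word a -> R.
Hypothesis V0 : forall u, 0 <= V u.

(** The one-point sample space [unit] lets [path_weight] be used for a fixed realization of the
    weights. *)
Local Notation Q u := (path_weight (fun u (_ : unit) => V u) u tt).

Lemma cascade_density_words n (i : seq_space a) :
  cascade_density V n i = \sum_(z <- words (letter a) n) Q z * \1_(cylinder z) i.
Proof.
rewrite (bigD1_seq (prefix_word i n)) ?uniq_words ?mem_words ?size_prefix_word//=.
rewrite big_seq_cond big1 ?addr0; last first.
  move=> z; rewrite mem_words => /andP[/eqP zn zi]; rewrite indicE memNset ?mulr0//.
  by rewrite /cylinder /= zn => h; rewrite h eqxx in zi.
rewrite indicE mem_set ?mulr1; last by rewrite /cylinder /= size_prefix_word.
rewrite /cascade_density /path_weight size_prefix_word !big_nat.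
by apply: eq_bigr => j /andP[_ jn]; rewrite take_prefix_word.
Qed.

Lemma Q_ge0 u : 0 <= Q u.
Proof. exact: path_weight_ge0. Qed.

Lemma cascade_density_ge0 n i : 0 <= cascade_density V n i.
Proof. by apply: prodr_ge0. Qed.

Lemma measurable_cascade_density n :
  measurable_fun [set: seq_space a] (cascade_density V n).
Proof.
rewrite (_ : cascade_density V n = fun i => \sum_(z <- words (letter a) n) Q z * \1_(cylinder z)
  i); last first.
  by apply/funext => i; exact: cascade_density_words.
apply: measurable_sum => z; apply: measurable_funM => //.
by apply: measurable_indic; exact: measurable_cylinder.
Qed.

Lemma cascade_step_cylinder n (u : word a) : (size u <= n)%N ->
  cascade_step ell V n (cylinder u) =
  (level_mass (fun u (_ : unit) => Q u) n u tt)%:E.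
Proof.
move=> un; rewrite /cascade_step.
have mc := @measurable_cylinder a.
under eq_integral => i _ do rewrite cascade_density_words -sumEFin.
rewrite ge0_integral_sum//; last 2 first.
- move=> z; apply/measurable_EFinP.
  by apply: measurable_funM; [exact: measurable_cst|exact: measurable_indic].
- by move=> z i _; rewrite lee_fin mulr_ge0// Q_ge0.
rewrite /level_mass card_letter//.
transitivity (\sum_(z <- words (letter a) n) (if take (size u) z == u then Q z * a%:R ^- n else
  0)%:E)%E.
  apply: eq_big_seq => z; rewrite mem_words => /eqP zn.
  under eq_integral do rewrite EFinM.
  rewrite ge0_integralZl//; last 2 first.
  - by apply/measurable_EFinP; exact: measurable_indic.
  - by rewrite lee_fin Q_ge0.
  rewrite integral_indic//.
  case: eqP => zu.
    have -> : cylinder z `&` cylinder u = cylinder z.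
      apply/setIidPl => i; rewrite /cylinder /= zn => iz.
      by rewrite -[u in RHS]zu -iz take_prefix_word.
    by rewrite EFinM -zn; congr (_ * _)%E; exact: ell_unif.
  have -> : cylinder z `&` cylinder u = set0.
    apply/seteqP; split => // i []; rewrite /cylinder /= zn => iz iu.
    by apply: zu; rewrite -iz take_prefix_word.
  by rewrite measure0 mule0.
rewrite sumEFin mulr_sumr [in RHS]big_mkcond; congr (_%:E); apply: eq_bigr => z _.
by case: ifP => _; rewrite // mulrC.
Qed.

Section step_measure.
Variable n : nat.
Local Open Scope ereal_scope.

Let step0 : cascade_step ell V n set0 = 0.
Proof. by rewrite /cascade_step integral_set0. Qed.

Let step_ge0 A : 0 <= cascade_step ell V n A.
Proof. by apply: integral_ge0 => i _; rewrite lee_fin cascade_density_ge0. Qed.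

Let step_sigma_additive : semi_sigma_additive (cascade_step ell V n).
Proof.
move=> F mF tF mUF; rewrite /cascade_step ge0_integral_bigcup//.
- apply: is_cvg_ereal_nneg_natsum_cond => k _ _.
  by apply: integral_ge0 => i _; rewrite lee_fin cascade_density_ge0.
- apply/measurable_EFinP; apply: (@measurable_funS _ _ _ _ setT) => //.
  exact: measurable_cascade_density.
- by move=> i _; rewrite lee_fin cascade_density_ge0.
Qed.

Definition step_measure : {measure set (seq_space a) -> \bar R} :=
  HB.pack (cascade_step ell V n)
    (isMeasure.Build _ _ _ (cascade_step ell V n) step0 step_ge0 step_sigma_additive).

End step_measure.

Variable mu : {finite_measure set (seq_space a) -> \bar R}.
Hypothesis V_mu : weakly_converges (cascade_step ell V) mu.

Lemma weak_limit_cylinder (u : word a) :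
  level_mass (fun u (_ : unit) => Q u) n u tt @[n --> \oo] --> fine (mu (cylinder u)).
Proof.
have mc := measurable_cylinder u.
have := V_mu (@continuous_cylinder a R u) _.
have H : exists M : R, forall i : seq_topology a, `|\1_(cylinder u) i : R| <= M.
  by exists 1 => i; rewrite indicE; case: (_ \in _); rewrite ?normr1 ?normr0.
move=> /(_ H); rewrite integral_indic// setIT => cv.
suff : (level_mass (fun u (_ : unit) => Q u) n u tt)%:E @[n --> \oo] -->
  (fine (mu (cylinder u)))%:E.
  by move=> /fine_cvg.
rewrite fineK ?fin_num_measure//.
apply: cvg_trans cv; apply: near_eq_cvg; exists (size u) => // n /= un.
rewrite -cascade_step_cylinder//.
rewrite -[LHS]/(\int[step_measure n]_i (\1_(cylinder u) i)%:E)%E.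
by rewrite integral_indic// setIT.
Qed.

End weak_limit.

(** * Counting pairs of close words *)

Fixpoint lcp {L : eqType} (u v : seq L) : nat :=
  match u, v with
  | x :: u', y :: v' => if x == y then (lcp u' v').+1 else 0
  | _, _ => 0
  end.

Lemma leq_lcp {L : eqType} (u v : seq L) j :
  (j <= lcp u v)%N = [&& (j <= size u)%N, (j <= size v)%N & take j u == take j v].
Proof.
elim: u v j => [|x u ih] [|y v] [|j] //=; rewrite ?andbF//.
rewrite eqseq_cons; have [_|_] := eqVneq x y; last by rewrite !andbF.
by rewrite ltnS ih.
Qed.

Section coding_count.
Context {R : realType} {a : nat}.
Hypothesis a2 : (2 <= a)%N.

Let card_a : #|letter a| = a. Proof. by rewrite card_letter// (leq_trans _ a2). Qed.

Definition left_end (w : word a) : R := foldr (@ifs_map R a) 0 w.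

(** The integer with base-[a] digits [w]. It shows that left endpoints at level [k] are distinct
    multiples of [a^-k], so counting close words is counting integers in an interval. *)
Fixpoint digits_val (w : word a) : nat :=
  if w is c :: w' then (c * a ^ size w' + digits_val w')%N else 0%N.

Lemma digits_val_lt w : (digits_val w < a ^ size w)%N.
Proof.
elim: w => //= c w ih; have : (c < a)%N by apply: leq_trans (ltn_ord c) _; rewrite prednK//
  (leq_trans _ a2).
rewrite expnS; move: ih; set N := (a ^ size w)%N => ih ca.
have : (c.+1 * N <= a * N)%N by rewrite leq_mul2r ca orbT.
by rewrite mulSn; lia.
Qed.

Lemma digits_val_inj w w' : size w = size w' -> digits_val w = digits_val w' -> w = w'.
Proof.
elim: w w' => [|c w ih] [|c' w'] //= [sw]; rewrite -sw => e.
have h1 := digits_val_lt w; have h2 := digits_val_lt w'; rewrite -sw in h2.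
have N0 : (0 < a ^ size w)%N by rewrite expn_gt0 (leq_trans _ a2).
have ec : c = c' :> nat.
  have := congr1 (divn^~ (a ^ size w)%N) e.
  by rewrite !divnMDl// (divn_small h1) (divn_small h2) !addn0.
have ev : digits_val w = digits_val w' by move: e; rewrite ec => /addnI.
by rewrite (ih w' sw ev); congr (_ :: _); exact: val_inj.
Qed.

Lemma left_endE w : left_end w = (digits_val w)%:R / a%:R ^+ size w.
Proof.
have a0 : a%:R != 0 :> R by rewrite pnatr_eq0 -lt0n (leq_trans _ a2).
rewrite /left_end; elim: w => [|c w ih] /=; first by rewrite mul0r.
rewrite ih /ifs_map natrD natrM natrX exprS.
by field; rewrite expf_neq0.
Qed.

Lemma size_in_interval (s : seq nat) (x l : R) : uniq s -> 0 <= l ->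
  (forall n, n \in s -> x <= n%:R <= x + l) -> (size s)%:R <= l + 1.
Proof.
move=> us l0 sx; case: s us sx => [|n0 s] us sx; first by rewrite addr_ge0.
have [i0 i0s i0min] : exists2 i, i \in n0 :: s & forall j, j \in n0 :: s -> (i <= j)%N.
  have ex : exists i, i \in n0 :: s by exists n0; rewrite inE eqxx.
  by case: (ex_minnP ex) => i is_ imin; exists i.
have sub : {subset n0 :: s <= iota i0 (Num.truncn l).+1}.
  move=> j js; rewrite mem_iota i0min//= addnS ltnS -leq_subLR.
  rewrite truncn_ge_nat// natrB ?i0min//.
  by have /andP[_] := sx _ js; have /andP[+ _] := sx _ i0s; lra.
have := uniq_leq_size us sub; rewrite size_iota => h.
apply: (@le_trans _ _ (Num.truncn l).+1%:R); first by rewrite ler_nat.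
by rewrite -natr1 lerD2r truncn_le.
Qed.

Lemma sum_indic_count {I : Type} (s : seq I) (p : pred I) :
  \sum_(i <- s) (p i)%:R = (count p s)%:R :> R.
Proof. by elim: s => [|i s ih]; rewrite ?big_nil// big_cons /= natrD ih. Qed.

(** An interval of length [2 c 2^-k] holds at most [2 c 2^-k a^k + 1] of the left endpoints of level
    [k], and after division by [a^k] the last term is at most [2^-k]. The letters beyond [k]
    cancel. *)
Lemma count_close k n (y c : R) : (k <= n)%N -> 0 <= c ->
  a%:R ^- n * \sum_(z <- words (letter a) n) (`|left_end (take k z) - y| <= c * 2 ^- k)%R%:R
    <= (2 * c + 1) * 2 ^- k.
Proof.
move=> kn c0; rewrite -(subnKC kn) big_words_cat; set m := (n - k)%N.
have a0 : 0 < a%:R :> R by rewrite ltr0n (leq_trans _ a2).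
have -> : \sum_(u <- words (letter a) k) \sum_(v <- words (letter a) m)
    (`|left_end (take k (u ++ v)) - y| <= c * 2 ^- k)%R%:R =
    a%:R ^+ m * (count (fun u => `|left_end u - y| <= c * 2 ^- k) (words (letter a) k))%:R :> R.
  rewrite -sum_indic_count mulr_sumr; apply: eq_big_seq => u.
  rewrite mem_words => /eqP uk.
  under eq_bigr => v _ do rewrite -uk take_size_cat// uk.
  by rewrite big_const_seq count_predT size_words card_a iter_addr_0 -[LHS]mulr_natl natrX.
rewrite -size_filter exprD; set s := [seq u <- _ | _].
have -> : (a%:R ^+ k * a%:R ^+ m)^-1 * (a%:R ^+ m * (size s)%:R) = a%:R ^- k * (size s)%:R :> R.
  by field; rewrite !expf_neq0 ?gt_eqF.
have ak : 0 < a%:R ^+ k :> R by rewrite exprn_gt0.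
have k2 : 0 < 2 ^+ k :> R by rewrite exprn_gt0.
have le2a : 2 ^+ k <= a%:R ^+ k :> R by apply: lerXn2r; rewrite ?nnegrE ?ler0n ?ler_nat.
have : (size [seq digits_val u | u <- s])%:R <= 2 * c * 2 ^- k * a%:R ^+ k + 1.
  apply: (@size_in_interval _ ((y - c * 2 ^- k) * a%:R ^+ k)).
  - rewrite map_inj_in_uniq ?filter_uniq ?uniq_words// => u u'.
    rewrite !mem_filter !mem_words => /andP[_ /eqP uk] /andP[_ /eqP u'k].
    by apply: digits_val_inj; rewrite uk.
  - by rewrite !mulr_ge0 ?invr_ge0// ltW.
  - move=> j /mapP[u]; rewrite mem_filter mem_words => /andP[uy /eqP uk] ->.
    have -> : (digits_val u)%:R = left_end u * a%:R ^+ k :> R.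
      by rewrite left_endE uk mulfVK// gt_eqF.
    move: uy; rewrite ler_norml => /andP[h1 h2].
    by rewrite -mulrDl !ler_pM2r//; apply/andP; split; lra.
rewrite size_map => h; rewrite [leLHS]mulrC ler_pdivrMr//; apply: le_trans h _.
have : 1 <= 2 ^- k * a%:R ^+ k :> R by rewrite mulrC ler_pdivlMr ?mul1r.
set E := 2 ^- k * _ => hE; rewrite -[leLHS]/(2 * c * 2 ^- k * a%:R ^+ k + 1).
have -> : 2 * c * 2 ^- k * a%:R ^+ k = 2 * c * E by rewrite /E; ring.
have -> : (2 * c + 1) * 2 ^- k * a%:R ^+ k = (2 * c + 1) * E by rewrite /E mulrA.
lra.
Qed.

Lemma count_prefix m n (z : word a) : (m <= size z)%N -> (m <= n)%N ->
  a%:R ^- n * \sum_(z' <- words (letter a) n) (take m z' == take m z)%:R <= a%:R ^- m :> R.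
Proof.
move=> mz mn; rewrite -{1 2}(subnKC mn) big_words_cat; set l := (n - m)%N.
have a0 : 0 < a%:R :> R by rewrite ltr0n (leq_trans _ a2).
rewrite (bigD1_seq (take m z)) ?uniq_words ?mem_words ?size_takel//=.
rewrite [X in _ + X]big1_seq ?addr0; last first.
  move=> u /andP[uz]; rewrite mem_words => /eqP um; apply: big1 => v _.
  by rewrite -um take_size_cat// um (negbTE uz).
under eq_bigr => v _ do rewrite take_size_cat ?size_takel// eqxx.
rewrite big_const_seq count_predT size_words card_a iter_addr_0 natrX.
rewrite exprD invfM -mulrA mulVf ?mulr1// expf_neq0// gt_eqF//.
Qed.

(** Only the term [m = lcp z z'] is kept from the sum. The gain is that the right side is linear in
    the indicators of agreement up to level [m], whose averages are easy to count. *)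
Lemma lcp_weight_le (beta : R) (z z' : word a) : 0 <= beta ->
  beta ^+ lcp z z' <= \sum_(0 <= m < (size z).+1) beta ^+ m * (take m z' == take m z)%:R.
Proof.
move=> b0; have := leq_lcp z z' (lcp z z'); rewrite leqnn => /esym/and3P[lz lz' /eqP e].
rewrite (bigD1_seq (lcp z z')) ?iota_uniq ?mem_index_iota//=.
rewrite e eqxx mulr1 lerDl; apply: sumr_ge0 => m _.
by rewrite mulr_ge0 ?exprn_ge0 ?ler0n.
Qed.

End coding_count.

(** * Energy sums over the branching levels *)

Section kernel_sums.
Context {R : realType}.

(* Geometric mean of the three bounds, with weights [1 - s1 - s2], [s1] and [s2]. *)
Lemma three_way_le (t A B r s1 s2 : R) : 0 <= t -> 0 <= s1 -> 0 <= s2 -> s1 + s2 <= 1 ->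
  t <= expR (A + B) -> t <= expR (r + A) -> t <= expR (r + B) ->
  t <= expR ((1 - s1) * A + (1 - s2) * B + (s1 + s2) * r).
Proof.
rewrite le_eqVlt => /orP[/eqP<-|t0] s10 s20 s12; first by rewrite expR_ge0.
have -> : t = expR (ln t) by rewrite lnK.
rewrite !ler_expR; move: (ln t) => l h1 h2 h3.
have := ler_wpM2l s10 h3; have := ler_wpM2l s20 h2.
have s0 : 0 <= 1 - s1 - s2 by lra.
have := ler_wpM2l s0 h1; lra.
Qed.

Lemma expR_natN (a : nat) m : (0 < a)%N -> a%:R ^- m = expR (- (m%:R * ln a%:R)) :> R.
Proof. by move=> a0; rewrite expRN expRM_natl lnK// posrE ltr0n. Qed.

(** The words that are close to [y] and agree with [z] up to level [m] have mass at most [a^-m] and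
    at most [(2 c + 1) 2^-k]. The geometric mean with weights [1 - s] and [s] leaves a convergent
    geometric series in [m]. *)
Lemma single_kernel_sum (a : nat) (beta s c : R) k n (z : word a) (y : R) :
  (2 <= a)%N -> 0 <= beta -> 0 <= s <= 1 -> 0 <= c ->
  beta * expR (- ((1 - s) * ln a%:R)) < 1 -> (k <= n)%N -> (size z <= n)%N ->
  a%:R ^- n * \sum_(z' <- words (letter a) n | `|left_end (take k z') - y| <= c * 2 ^- k) beta ^+
    lcp z z'
  <= (2 * c + 1) / (1 - beta * expR (- ((1 - s) * ln a%:R))) * expR (- (s * ln 2)) ^+ k.
Proof.
move=> a2 b0 /andP[s0 s1] c0; set th := beta * _ => th1 kn zn.
have a0 : (0 < a)%N by exact: leq_trans a2.
have aR : 0 < a%:R :> R by rewrite ltr0n.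
have an : 0 <= a%:R ^- n :> R by rewrite invr_ge0 exprn_ge0// ltW.
have th0 : 0 <= th by rewrite mulr_ge0// expR_ge0.
pose p (z' : word a) := `|left_end (take k z') - y| <= c * 2 ^- k.
pose t m : R := a%:R ^- n * \sum_(z' <- words (letter a) n | p z') (take m z' == take m z)%:R.
have c1 : 0 < 2 * c + 1 by lra.
have tm m : (m <= size z)%N -> t m <= (2 * c + 1) * (expR (- ((1 - s) * ln a%:R)) ^+ m * expR (- (s
  * ln 2)) ^+ k).
  move=> mz; have mn : (m <= n)%N by exact: leq_trans zn.
  have tA : t m <= a%:R ^- m.
    apply: le_trans (count_prefix a2 mz mn); rewrite ler_wpM2l// big_mkcond.
    by apply: ler_sum => z' _; case: ifP.
  have tr : t m <= (2 * c + 1) * 2 ^- k.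
    apply: le_trans (count_close a2 y kn c0); rewrite ler_wpM2l// big_mkcond.
    by apply: ler_sum => z' _; rewrite /p; case: ifP => //= _; case: (_ == _).
  have t0 : 0 <= t m by rewrite mulr_ge0// sumr_ge0.
  rewrite mulrC -ler_pdivrMr//; set u := t m / _.
  have u0 : 0 <= u by rewrite divr_ge0// ltW.
  have uA : u <= expR (- (m%:R * ln a%:R)).
    rewrite -expR_natN// /u ler_pdivrMr//; apply: le_trans tA _.
    by rewrite ler_peMr ?invr_ge0 ?exprn_ge0//; lra.
  have ur : u <= expR (- (k%:R * ln 2)).
    by rewrite -(expR_natN k (a := 2))// /u ler_pdivrMr// mulrC.
  rewrite -!expRM_natl -expRD.
  move: u0 uA ur; rewrite le_eqVlt => /orP[/eqP <- _ _|u0]; first by rewrite expR_ge0.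
  have -> : u = expR (ln u) by rewrite lnK.
  rewrite !ler_expR; move: (ln u) => l h1 h2.
  have := ler_wpM2l s0 h2; have s10 : 0 <= 1 - s by lra.
  have := ler_wpM2l s10 h1; lra.
apply: (@le_trans _ _ (\sum_(0 <= m < (size z).+1) beta ^+ m * t m)).
  have -> : \sum_(0 <= m < (size z).+1) beta ^+ m * t m =
      a%:R ^- n * \sum_(z' <- words (letter a) n | p z') \sum_(0 <= m < (size z).+1) beta ^+ m *
        (take m z' == take m z)%:R.
    rewrite [in RHS]exchange_big mulr_sumr; apply: eq_bigr => m _.
    by rewrite /t mulrCA -mulr_sumr.
  rewrite ler_wpM2l//; apply: ler_sum => z' _; exact: lcp_weight_le.
apply: (@le_trans _ _ (\sum_(0 <= m < (size z).+1) (2 * c + 1) * expR (- (s * ln 2)) ^+ k * th ^+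
  m)).
  rewrite !big_nat; apply: ler_sum => m; rewrite ltnS => /= mz.
  apply: (@le_trans _ _ (beta ^+ m * ((2 * c + 1) * (expR (- ((1 - s) * ln a%:R)) ^+ m * expR (- (s
    * ln 2)) ^+ k)))).
    by rewrite ler_wpM2l ?exprn_ge0// tm.
  by rewrite /th exprMn le_eqVlt; apply/orP; left; apply/eqP; ring.
rewrite -mulr_sumr [leRHS]mulrAC; apply: ler_wpM2l.
  by rewrite mulr_ge0 ?exprn_ge0 ?expR_ge0// ltW.
by apply: geometric_le; rewrite th0.
Qed.

(** For each fixed [u] the admissible [v] have left endpoints in one interval of size [2^-k], so
    that the coordinate [v] contributes the scale while [u] keeps its own bound. *)
Lemma close_pair_le (a b : nat) (c F y : R) k n (f : word a -> R) (g : word b -> R) :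
  (2 <= b)%N -> (k <= n)%N -> 0 <= c -> (forall u, 0 <= f u) -> (forall v, g v <= 1) ->
  a%:R ^- n * \sum_(u <- words (letter a) n) f u <= F ->
  a%:R ^- n * \sum_(u <- words (letter a) n) f u * (b%:R ^- n *
    \sum_(v <- words (letter b) n | `|left_end (take k u) + left_end (take k v) - y| <= c * 2 ^- k)
      g v)
  <= (2 * c + 1) * (2 ^- k * F).
Proof.
move=> b2 kn c0 f0 g1 hF.
apply: (@le_trans _ _ (a%:R ^- n * \sum_(u <- words (letter a) n) f u * ((2 * c + 1) * 2 ^- k))).
  rewrite ler_wpM2l ?invr_ge0 ?exprn_ge0//; apply: ler_sum => u _; rewrite ler_wpM2l//.
  apply: le_trans (count_close b2 (y - left_end (take k u)) kn c0).
  rewrite ler_wpM2l ?invr_ge0 ?exprn_ge0// big_mkcond; apply: ler_sum => v _.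
  have -> : left_end (take k v) - (y - left_end (take k u)) =
    left_end (take k u) + left_end (take k v) - y by ring.
  by case: ifP.
rewrite -mulr_suml [leLHS]mulrA [leRHS]mulrA [leRHS]mulrC; apply: ler_wpM2r => //.
by rewrite !mulr_ge0 ?invr_ge0 ?exprn_ge0//; lra.
Qed.

Lemma pair_kernel_sum (a b : nat) (alpha beta s1 s2 c : R) k n (u : word a) (v : word b) (y : R) :
  (2 <= a)%N -> (2 <= b)%N -> 0 <= alpha -> 0 <= beta ->
  0 <= s1 -> 0 <= s2 -> s1 + s2 <= 1 -> 0 <= c ->
  alpha * expR (- ((1 - s1) * ln a%:R)) < 1 -> beta * expR (- ((1 - s2) * ln b%:R)) < 1 ->
  (k <= n)%N -> (size u <= n)%N -> (size v <= n)%N ->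
  a%:R ^- n * b%:R ^- n * (\sum_(u' <- words (letter a) n) \sum_(v' <- words (letter b) n |
      `|left_end (take k u') + left_end (take k v') - y| <= c * 2 ^- k)
      alpha ^+ lcp u u' * beta ^+ lcp v v')
  <= (2 * c + 1) / (1 - alpha * expR (- ((1 - s1) * ln a%:R)))
       / (1 - beta * expR (- ((1 - s2) * ln b%:R))) * expR (- ((s1 + s2) * ln 2)) ^+ k.
Proof.
move=> a2 b2 al0 be0 s10 s20 s12 c0; set th := alpha * _; set th' := beta * _ => th1 th'1 kn un vn.
have a0 : (0 < a)%N by exact: leq_trans a2.
have b0 : (0 < b)%N by exact: leq_trans b2.
have an : 0 <= a%:R ^- n :> R by rewrite invr_ge0 exprn_ge0.
have bn : 0 <= b%:R ^- n :> R by rewrite invr_ge0 exprn_ge0.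
have th0 : 0 <= th by rewrite mulr_ge0// expR_ge0.
have th'0 : 0 <= th' by rewrite mulr_ge0// expR_ge0.
have c1 : 0 < 2 * c + 1 by lra.
pose p (u' : word a) (v' : word b) := `|left_end (take k u') + left_end
  (take k v') - y| <= c * 2 ^- k.
pose f m (u' : word a) : R := (take m u' == take m u)%:R.
pose g m (v' : word b) : R := (take m v' == take m v)%:R.
have f0 m u' : 0 <= f m u' by exact: ler0n.
have g0 m v' : 0 <= g m v' by exact: ler0n.
have f1 m u' : f m u' <= 1 by rewrite /f; case: (_ == _); rewrite ?ler01.
have g1 m v' : g m v' <= 1 by rewrite /g; case: (_ == _); rewrite ?ler01.
pose t m m' : R := a%:R ^- n * b%:R ^- n * \sum_(u' <- words (letter a) n) \sum_(v' <- words
  (letter b) n | p u' v') f m u' * g m' v'.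
have t0 m m' : 0 <= t m m'.
  rewrite !mulr_ge0// sumr_ge0// => u' _; rewrite sumr_ge0// => v' _.
  by rewrite mulr_ge0.
have fA m : (m <= size u)%N -> a%:R ^- n * \sum_(u' <- words (letter a) n) f m u' <= a%:R ^- m.
  by move=> mu; apply: count_prefix => //; exact: leq_trans un.
have gB m : (m <= size v)%N -> b%:R ^- n * \sum_(v' <- words (letter b) n) g m v' <= b%:R ^- m.
  by move=> mv; apply: count_prefix => //; exact: leq_trans vn.
(* The three competing bounds: forgetting closeness, then closeness spent on the second coordinate,
   then on the first. *)
have tAB m m' : (m <= size u)%N -> (m' <= size v)%N -> t m m' <= a%:R ^- m * b%:R ^- m'.
  move=> mu mv; apply: (@le_trans _ _ ((a%:R ^- n * \sum_(u' <- words (letter a) n) f m u') * (b%:R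
    ^- n * \sum_(v' <- words (letter b) n) g m' v'))).
    rewrite mulrACA ler_wpM2l ?mulr_ge0// mulr_suml; apply: ler_sum => u' _.
    rewrite mulr_sumr big_mkcond; apply: ler_sum => v' _.
    by case: ifP => // _; rewrite mulr_ge0.
  by apply: ler_pM; [rewrite mulr_ge0// sumr_ge0|rewrite mulr_ge0// sumr_ge0|exact: fA|exact: gB].
have trA m m' : (m <= size u)%N -> t m m' <= (2 * c + 1) * (2 ^- k * a%:R ^- m).
  move=> mu; apply: le_trans (close_pair_le y b2 kn c0 (f0 m) (g1 m') (fA m mu)).
  rewrite /t -[leLHS]mulrA mulr_sumr le_eqVlt; apply/orP; left; apply/eqP; congr (_ * _).
  by apply: eq_bigr => u' _; rewrite -mulr_sumr mulrCA.
have trB m m' : (m' <= size v)%N -> t m m' <= (2 * c + 1) * (2 ^- k * b%:R ^- m').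
  move=> mv; apply: le_trans (close_pair_le y a2 kn c0 (g0 m') (f1 m) (gB m' mv)).
  rewrite /t (exchange_big_dep xpredT)//= (mulrC (a%:R ^- n)) -[leLHS]mulrA mulr_sumr.
  rewrite le_eqVlt; apply/orP; left; apply/eqP; congr (_ * _).
  apply: eq_bigr => v' _; rewrite mulrCA; congr (_ * _).
  rewrite mulr_sumr; apply: eq_big => [u'|u' _]; last by rewrite mulrC.
  by rewrite /p (addrC (left_end _)).
pose x := expR (- ((1 - s1) * ln a%:R)); pose x' := expR (- ((1 - s2) * ln b%:R)).
pose w := expR (- ((s1 + s2) * ln 2)).
have tm m m' : (m <= size u)%N -> (m' <= size v)%N -> t m m' <= (2 * c + 1) *
  (x ^+ m * x' ^+ m' * w ^+ k).
  move=> mu mv; rewrite mulrC -ler_pdivrMr//.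
  rewrite /x /x' /w -!expRM_natl -!expRD.
  have -> : m%:R * - ((1 - s1) * ln a%:R) + m'%:R * - ((1 - s2) * ln b%:R) + k%:R * -
    ((s1 + s2) * ln 2) =
    (1 - s1) * - (m%:R * ln a%:R) + (1 - s2) * - (m'%:R * ln b%:R) + (s1 + s2) * -
      (k%:R * ln 2) by ring.
  apply: three_way_le => //.
  - by rewrite divr_ge0// ltW.
  - rewrite expRD -!expR_natN// ler_pdivrMr//; apply: le_trans (tAB m m' mu mv) _.
    by rewrite ler_peMr ?mulr_ge0 ?invr_ge0 ?exprn_ge0//; lra.
  - by rewrite expRD -(expR_natN k (a := 2))// -expR_natN// ler_pdivrMr// mulrC trA.
  - by rewrite expRD -(expR_natN k (a := 2))// -expR_natN// ler_pdivrMr// mulrC trB.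
apply: (@le_trans _ _ (\sum_(0 <= m < (size u).+1) \sum_(0 <= m' < (size v).+1) alpha ^+ m * beta
  ^+ m' * t m m')).
  have -> : \sum_(0 <= m < (size u).+1) \sum_(0 <= m' < (size v).+1) alpha ^+ m * beta ^+ m' * t m
    m' =
      a%:R ^- n * b%:R ^- n * \sum_(u' <- words (letter a) n) \sum_(v' <- words (letter b) n | p u'
        v')
       (\sum_(0 <= m < (size u).+1) alpha ^+ m * f m u') * (\sum_(0 <= m' < (size v).+1) beta ^+ m'
         * g m' v').
    transitivity (\sum_(0 <= m < (size u).+1) \sum_(0 <= m' < (size v).+1)
      a%:R ^- n * b%:R ^- n * \sum_(u' <- words (letter a) n) \sum_(v' <- words (letter b) n | p u'
        v')
         (alpha ^+ m * f m u') * (beta ^+ m' * g m' v')).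
      apply: eq_bigr => m _; apply: eq_bigr => m' _; rewrite /t mulrCA; congr (_ * _).
      rewrite mulr_sumr; apply: eq_bigr => u' _; rewrite mulr_sumr; apply: eq_bigr => v' _.
      by rewrite mulrACA.
    under eq_bigr do rewrite -mulr_sumr.
    rewrite -mulr_sumr; congr (_ * _).
    under eq_bigr do rewrite exchange_big.
    rewrite exchange_big; apply: eq_bigr => u' _.
    under eq_bigr do rewrite exchange_big.
    rewrite exchange_big; apply: eq_bigr => v' _.
    by rewrite mulr_suml; apply: eq_bigr => m _; rewrite mulr_sumr.
  rewrite ler_wpM2l ?mulr_ge0//; apply: ler_sum => u' _; apply: ler_sum => v' _.
  by apply: ler_pM; rewrite ?exprn_ge0// lcp_weight_le.
apply: (@le_trans _ _ (\sum_(0 <= m < (size u).+1) \sum_(0 <= m' < (size v).+1)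
   ((2 * c + 1) * w ^+ k) * (th ^+ m * th' ^+ m'))).
  rewrite big_nat [leRHS]big_nat; apply: ler_sum => m; rewrite ltnS => /= mu.
  rewrite big_nat [leRHS]big_nat; apply: ler_sum => m'; rewrite ltnS => /= mv.
  apply: (@le_trans _ _ (alpha ^+ m * beta ^+ m' * ((2 * c + 1) * (x ^+ m * x' ^+ m' * w ^+ k)))).
    by rewrite ler_wpM2l ?mulr_ge0 ?exprn_ge0// tm.
  by rewrite /th /th' -/x -/x' !exprMn le_eqVlt; apply/orP; left; apply/eqP; ring.
under eq_bigr do rewrite -mulr_sumr -mulr_sumr.
rewrite -mulr_sumr -mulr_suml.
have cw : 0 <= (2 * c + 1) * w ^+ k by rewrite mulr_ge0 ?exprn_ge0 ?expR_ge0// ltW.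
rewrite -/w.
have -> : (2 * c + 1) / (1 - th) / (1 - th') * w ^+ k = (2 * c + 1) * w ^+ k *
  ((1 - th)^-1 * (1 - th')^-1) by ring.
rewrite ler_wpM2l//; apply: ler_pM.
- by apply: sumr_ge0 => m _; exact: exprn_ge0.
- by apply: sumr_ge0 => m _; exact: exprn_ge0.
- by apply: geometric_le; rewrite th0.
- by apply: geometric_le; rewrite th'0.
Qed.

End kernel_sums.

(** * Exact dimensionality from dyadic scales *)

Section scales.
Context {R : realType}.
Variable f : R -> R.
Hypothesis f_nd : forall r r', 0 < r -> r <= r' -> f r <= f r'.

Lemma near_ln_lt (M : R) : \forall r \near 0^'+, ln r < M.
Proof. by have /cvgrNy_lt := @lnNy R; apply. Qed.

Lemma dyadic_lnE (k : nat) : ln (2 ^- k) = - (k%:R * ln 2) :> R.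
Proof. by rewrite lnV ?posrE ?exprn_gt0// lnXn// mulr_natl. Qed.

Lemma scale_lower (s s' : R) : 0 <= s' -> s' < s ->
  (\forall k \near \oo, f (2 ^- k) <= expR (- (s * ln 2)) ^+ k) ->
  \forall r \near 0^'+, f r <= expR (s' * ln r).
Proof.
move=> s'0 ss [N _ hN].
have l2 : 0 < ln 2 :> R by apply: ln_gt0; rewrite ltr1n.
have s0 : 0 < s by exact: le_lt_trans ss.
near=> r.
have r0 : 0 < r by near: r; exact: nbhs_right_gt.
pose y := - ln r.
have yM : N.+1%:R * ln 2 < y.
  by rewrite /y ltrNr; near: r; exact: near_ln_lt.
have yM' : s * ln 2 < (s - s') * y.
  rewrite [ltRHS]mulrC -ltr_pdivrMr ?subr_gt0// /y ltrNr; near: r; exact: near_ln_lt.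
have yl0 : 0 <= y / ln 2.
  by rewrite divr_ge0 ?(ltW l2)//; apply: ltW; apply: le_lt_trans yM; rewrite mulr_ge0// ltW.
pose k := Num.truncn (y / ln 2).
have k1 : k%:R * ln 2 <= y by rewrite -ler_pdivlMr// truncn_le.
have k2 : y < k.+1%:R * ln 2 by rewrite -ltr_pdivrMr// truncnS_gt.
have Nk : (N <= k)%N.
  rewrite /k truncn_ge_nat// ler_pdivlMr//; apply: le_trans (ltW yM).
  by rewrite ler_wpM2r ?ler_nat// ltW.
have rk : r <= 2 ^- k.
  rewrite -[r]lnK ?posrE// -[2 ^- k]lnK ?posrE ?invr_gt0 ?exprn_gt0// ler_expR dyadic_lnE.
  by rewrite lerNr.
apply: le_trans (f_nd r0 rk) _; apply: le_trans (hN k Nk) _.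
rewrite -expRM_natl ler_expR.
have h1 : s * y <= s * (k.+1%:R * ln 2) by rewrite ler_wpM2l// ltW.
have -> : ln r = - y by rewrite opprK.
move: h1 yM'; rewrite -natr1; move: (k%:R : R) (ln 2 : R) (y) => kk LL yy; clear; lra.
Unshelve. all: by end_near. Qed.

(** Here [r] is rounded down to [K * q ^+ k]. The ratio is arbitrary because cylinders supply lower
    bounds at the scales [a^-k], whereas sparse points are defined at the scales [2^-k]. *)
Lemma scale_upper (q K s s' : R) : 0 < q < 1 -> 0 < K -> 0 <= s -> s < s' ->
  (\forall k \near \oo, expR (k%:R * (s * ln q)) <= f (K * q ^+ k)) ->
  \forall r \near 0^'+, expR (s' * ln r) <= f r.
Proof.
move=> /andP[q0 q1] K0 s0 ss [N _ hN].
pose L := - ln q; have L0 : 0 < L by rewrite /L oppr_gt0 ln_lt0// q0.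
near=> r.
have r0 : 0 < r by near: r; exact: nbhs_right_gt.
pose y := - ln r.
have yM : N%:R * L - ln K < y by rewrite /y ltrNr; near: r; exact: near_ln_lt.
have yK : - ln K < y by rewrite /y ltrNr; near: r; exact: near_ln_lt.
have yM' : s * (ln K + L) < (s' - s) * y.
  rewrite [ltRHS]mulrC -ltr_pdivrMr ?subr_gt0// /y ltrNr; near: r; exact: near_ln_lt.
have yl0 : 0 <= (y + ln K) / L by rewrite divr_ge0 ?(ltW L0)//; lra.
pose k := (Num.truncn ((y + ln K) / L)).+1.
have k1 : y + ln K < k%:R * L by rewrite -ltr_pdivrMr// truncnS_gt.
have k2 : k%:R * L <= y + ln K + L.
  rewrite /k -natr1 mulrDl mul1r lerD2r -ler_pdivlMr// truncn_le//.
have Nk : (N <= k)%N.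
  by rewrite leqW// truncn_ge_nat// ler_pdivlMr// -lerBlDr ltW.
clearbody k.
have qk : q ^+ k = expR (- (k%:R * L)).
  by rewrite /L mulrN opprK expRM_natl lnK.
have rk : K * q ^+ k <= r.
  rewrite qk -[K]lnK ?posrE// -expRD -[leRHS]lnK ?posrE// ler_expR.
  by move: k1; rewrite /y; move: (k%:R * L) => z; lra.
apply: le_trans (f_nd _ rk); last by rewrite mulr_gt0// exprn_gt0.
apply: le_trans (hN k Nk); rewrite ler_expR.
have h1 : s * (k%:R * L) <= s * (y + ln K + L) by rewrite ler_wpM2l.
have -> : ln q = - L by rewrite opprK.
have -> : ln r = - y by rewrite opprK.
move: h1 yM'; move: (k%:R : R) (L) (ln K) (y) => kk LL lK yy; clear; lra.
Unshelve. all: by end_near. Qed.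

Lemma dim_limit (D : R) :
  (forall e, 0 < e -> \forall r \near 0^'+, f r <= expR ((D - e) * ln r)) ->
  (forall e, 0 < e -> \forall r \near 0^'+, expR ((D + e) * ln r) <= f r) ->
  (fun r => ln (f r) / ln r) @ 0^'+ --> D.
Proof.
move=> lo up; apply/cvgrPdist_le => e e0; near=> r.
have lr : ln r < 0 by near: r; exact: near_ln_lt.
have h1 : f r <= expR ((D - e) * ln r) by near: r; exact: lo.
have h2 : expR ((D + e) * ln r) <= f r by near: r; exact: up.
have f0 : 0 < f r by apply: lt_le_trans h2; exact: expR_gt0.
have lh1 : ln (f r) <= (D - e) * ln r by rewrite -ler_expR lnK.
have lh2 : (D + e) * ln r <= ln (f r) by rewrite -ler_expR lnK.
have g1 : D - e <= ln (f r) / ln r by rewrite ler_ndivlMr.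
have g2 : ln (f r) / ln r <= D + e by rewrite ler_ndivrMr.
by rewrite ler_distlC; apply/andP; split; lra.
Unshelve. all: by end_near. Qed.

End scales.

Section exact_dimension.
Context {R : realType}.
Variable m : {finite_measure set R -> \bar R}.

Definition ball_mass (x r : R) : R := fine (m (ball x r)).

Lemma ball_mass_nd x r r' : 0 < r -> r <= r' -> ball_mass x r <= ball_mass x r'.
Proof.
move=> r0 rr; have mb s : measurable (ball x s) by exact: measurable_ball.
apply: fine_le; [exact: fin_num_measure|exact: fin_num_measure|].
by apply: le_measure; rewrite ?inE; [exact: mb|exact: mb|exact: le_ball].
Qed.

Lemma measurable_ball_mass r : measurable_fun setT (fun x => ball_mass x r).
Proof.
apply: measurableT_comp => //.
pose A := [set z : R * R | `|z.1 - z.2| < r].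
have mA : measurable A.
  have mf : measurable_fun setT (fun z : R * R => `|z.1 - z.2| < r).
    by apply: measurable_fun_ltr => //; apply: measurableT_comp => //; exact: measurable_funB.
  by rewrite -[A]setTI; exact: (mf measurableT [set true]).
rewrite (_ : (fun x => m (ball x r)) = m \o xsection A); first exact: measurable_fun_xsection.
apply/funext => x /=; congr (m _); apply/seteqP; split => y; rewrite /xsection /= inE /A /ball /=.
  by [].
by [].
Qed.

(** The threshold is [2^(-s k)], written with [expR] as [s] is real. Here and in [sparse_pt], points
    are bad if the comparison fails at infinitely many dyadic scales. *)
Definition dense_pt (s : R) : set R :=
  lim_sup_set (fun k => [set x | expR (- (s * ln 2)) ^+ k < ball_mass x (2 ^- k)]).
Definition sparse_pt (s : R) : set R :=
  lim_sup_set (fun k => [set x | ball_mass x (2 ^- k) < expR (- (s * ln 2)) ^+ k]).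

Lemma measurable_lim_sup_set {d} {T : measurableType d} (F : nat -> set T) :
  (forall k, measurable (F k)) -> measurable (lim_sup_set F).
Proof.
by move=> mF; apply: bigcap_measurable => // n _; apply: bigcup_measurable => k _; exact: mF.
Qed.

Lemma measurable_dense_pt s : measurable (dense_pt s).
Proof.
apply: measurable_lim_sup_set => k; rewrite -[X in measurable X]setTI.
have mf : measurable_fun setT (fun x => expR (- (s * ln 2)) ^+ k < ball_mass x (2 ^- k)).
  by apply: measurable_fun_ltr => //; exact: measurable_ball_mass.
exact: (mf measurableT [set true]).
Qed.

Lemma measurable_sparse_pt s : measurable (sparse_pt s).
Proof.
apply: measurable_lim_sup_set => k; rewrite -[X in measurable X]setTI.
have mf : measurable_fun setT (fun x => ball_mass x (2 ^- k) < expR (- (s * ln 2)) ^+ k).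
  by apply: measurable_fun_ltr => //; exact: measurable_ball_mass.
exact: (mf measurableT [set true]).
Qed.

Lemma not_lim_sup_set {T : Type} (F : nat -> set T) x :
  ~ lim_sup_set F x -> \forall k \near \oo, ~ F k x.
Proof.
move=> /existsNP[n /not_implyP[_ nx]]; exists n => // k /= nk Fk.
by apply: nx; exists k.
Qed.

(** Almost every point must avoid the bad sets for all exponents at once; the countable families
    [D - 1 / (n + 1)] and [D + 1 / (n + 1)] are enough. *)
Lemma exact_dim_criterion (D : R) : 0 < D ->
  (forall s, 0 <= s -> s < D -> m (dense_pt s) = 0%E) ->
  (forall s, D < s -> m (sparse_pt s) = 0%E) ->
  exact_dim m D.
Proof.
move=> D0 lo up.
have aelo : {ae m, forall x (n : nat), 0 <= D - n.+1%:R^-1 -> ~ dense_pt (D - n.+1%:R^-1) x}.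
  apply: ae_foralln => n; have [s0|s0] := leP 0 (D - n.+1%:R^-1); last by apply: aeW => x h;
    exfalso; lra.
  have sD : D - n.+1%:R^-1 < D by rewrite ltrBlDr ltrDl invr_gt0.
  exists (dense_pt (D - n.+1%:R^-1)); split; [exact: measurable_dense_pt|exact: lo|].
  by move=> x /= /not_implyP[_ /contrapT].
have aeup : {ae m, forall x (n : nat), ~ sparse_pt (D + n.+1%:R^-1) x}.
  apply: ae_foralln => n; have sD : D < D + n.+1%:R^-1 by rewrite ltrDl invr_gt0.
  exists (sparse_pt (D + n.+1%:R^-1)); split; [exact: measurable_sparse_pt|exact: up|].
  by move=> x /= /contrapT.
apply: filterS2 aelo aeup => x hlo hup.
have small (e : R) : 0 < e -> exists n : nat, n.+1%:R^-1 < e.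
  move=> e0; exists (Num.truncn e^-1).
  by rewrite -[ltRHS]invrK ltf_pV2 ?posrE ?invr_gt0// truncnS_gt.
apply: (@dim_limit R (ball_mass x)) => e e0.
  have ee : 0 < Num.min e D by rewrite lt_min e0.
  have [n hn] := small _ ee.
  have [ne nD] : n.+1%:R^-1 < e /\ n.+1%:R^-1 < D by move: hn; rewrite lt_min => /andP[].
  have s0 : 0 <= D - n.+1%:R^-1 by rewrite subr_ge0 ltW.
  have := not_lim_sup_set (hlo n s0) => h.
  have {}h : \forall k \near \oo, ball_mass x (2 ^- k) <= expR (- ((D - n.+1%:R^-1) * ln 2)) ^+ k.
    by apply: filterS h => k /negP; rewrite -leNgt.
  (* The rounding lemma needs a nonnegative exponent, and [D - e] is negative for large [e]. *)
  pose s' := Num.max 0 (D - e).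
  have s'0 : 0 <= s' by rewrite le_max lexx.
  have s's : s' < D - n.+1%:R^-1 by rewrite gt_max subr_gt0 nD ltrD2l ltrN2.
  have hs := scale_lower (@ball_mass_nd x) s'0 s's h.
  near=> r; apply: (@le_trans _ _ (expR (s' * ln r))); first by near: r; exact: hs.
  have lr : ln r < 0 by near: r; exact: near_ln_lt.
  rewrite ler_expR ler_nM2r//.
  by rewrite le_max lexx orbT.
have [n hn] := small _ e0.
have := not_lim_sup_set (hup n) => h.
have h12 : 0 < (2^-1 : R) < 1 by rewrite invr_gt0 invf_lt1 ?ltr1n ?ltr0n.
have s0 : 0 <= D + n.+1%:R^-1 by rewrite addr_ge0// ltW.
have se : D + n.+1%:R^-1 < D + e by rewrite ltrD2l.
apply: (scale_upper (@ball_mass_nd x) h12 (@ltr01 R) s0 se).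
apply: filterS h => k /negP; rewrite -leNgt mul1r exprVn.
apply: le_trans; rewrite -expRM_natl ler_expR lnV ?posrE// [in leLHS]mulrN.
Unshelve. all: by end_near. Qed.

(* Each dyadic interval meeting the sparse set at scale [2^-k] has mass at most [2^-ks], and
   there are about [2^k] of them. *)
Lemma sparse_null (B : nat) (s : R) : 1 < s -> m (~` `[0, B%:R]%classic) = 0%E ->
  m (sparse_pt s) = 0%E.
Proof.
move=> s1 mB0.
have l2 : 0 < ln 2 :> R by apply: ln_gt0; rewrite ltr1n.
pose S k := [set x | ball_mass x (2 ^- k) < expR (- (s * ln 2)) ^+ k].
have mS k : measurable (S k).
  rewrite -[X in measurable X]setTI.
  have mf : measurable_fun setT (fun x => ball_mass x (2 ^- k) < expR (- (s * ln 2)) ^+ k).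
    by apply: measurable_fun_ltr => //; exact: measurable_ball_mass.
  exact: (mf measurableT [set true]).
pose th := expR (- ((s - 1) * ln 2)).
have th01 : 0 <= th < 1.
  by rewrite expR_ge0 expR_lt1 oppr_lt0 mulr_gt0 ?subr_gt0.
have mSk k : (m (S k) <= (B.+1%:R * th ^+ k)%:E)%E.
  have k20 : 0 < 2 ^+ k :> R by rewrite exprn_gt0.
  pose J (j : nat) : set R := `[j%:R * 2 ^- k, j.+1%:R * 2 ^- k[%classic.
  have mJ j : measurable (J j) by exact: measurable_itv.
  have mSJ j : (m (S k `&` J j) <= (expR (- (s * ln 2)) ^+ k)%:E)%E.
    have [->|/set0P[x [Sx Jx]]] := eqVneq (S k `&` J j) set0.
      by rewrite measure0 lee_fin exprn_ge0// expR_ge0.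
    apply: (@le_trans _ _ (m (ball x (2 ^- k)))).
      apply: le_measure; rewrite ?inE; [exact: measurableI|exact: measurable_ball|].
      move=> z [_]; rewrite /J /ball /=; move: Jx; rewrite /J /= !in_itv/= => /andP[x1 x2]
        /andP[z1 z2].
      have e : j.+1%:R * 2 ^- k = j%:R * 2 ^- k + 2 ^- k :> R by rewrite -natr1 mulrDl mul1r.
      by rewrite ltr_norml; apply/andP; split; lra.
    rewrite -[leLHS]fineK ?fin_num_measure//; last exact: measurable_ball.
    by rewrite lee_fin ltW.
  (* The additional interval contains the right endpoint [B], as the intervals [J j] are
     half-open. *)
  pose N := (B * 2 ^ k).+1.
  have cover : S k `<=` (~` `[0, B%:R]%classic) `|` \big[setU/set0]_(j < N) (S k `&` J j).
    move=> x Sx; have [xB|xB] := boolP (x \in `[0, B%:R]); last by left => /=; exact/negP.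
    right; move: xB; rewrite in_itv/= => /andP[x0 xB].
    have xk0 : 0 <= x * 2 ^+ k by rewrite mulr_ge0// ltW.
    pose j := Num.truncn (x * 2 ^+ k).
    have jN : (j < N)%N.
      rewrite /N ltnS -(ler_nat R) natrM natrX; apply: (@le_trans _ _ (x * 2 ^+ k)).
        by rewrite truncn_le.
      by rewrite ler_pM2r.
    rewrite -(bigcup_mkord N (fun j => S k `&` J j)); exists j => //; split => //;
      rewrite /J /= in_itv/=.
    rewrite ler_pdivrMr// truncn_le// xk0/= ltr_pdivlMr//; exact: truncnS_gt.
  have mU : measurable (\big[setU/set0]_(j < N) (S k `&` J j)).
    by apply: bigsetU_measurable => j _; exact: measurableI.
  have mC : measurable (~` `[0, B%:R]%classic : set R) by apply: measurableC; exact: measurable_itv.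
  apply: (@le_trans _ _ (m ((~` `[0, B%:R]%classic) `|` \big[setU/set0]_(j < N) (S k `&` J j)))).
    by apply: le_measure; rewrite ?inE//; exact: measurableU.
  apply: le_trans (measureU2 _ mC mU) _; rewrite -[leRHS]add0e; apply: leeD.
    by rewrite le_eqVlt; apply/orP; left; apply/eqP; exact: mB0.
  apply: (@le_trans _ _ (\sum_(j < N) m (S k `&` J j))%E).
    by apply: (@content_subadditive _ _ _ m _ (fun j => S k `&` J j) N) => // j _;
      exact: measurableI.
  apply: (@le_trans _ _ (\sum_(j < N) (expR (- (s * ln 2)) ^+ k)%:E)%E).
    by apply: lee_sum => j _; exact: mSJ.
  rewrite sumEFin sumr_const card_ord lee_fin -[leLHS]mulr_natl.
  have -> : expR (- (s * ln 2)) ^+ k = 2 ^- k * th ^+ k.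
    rewrite /th -!expRM_natl -[2 ^- k]lnK ?posrE ?invr_gt0// dyadic_lnE -expRD; congr expR; ring.
  rewrite mulrA ler_wpM2r ?exprn_ge0 ?expR_ge0// ler_pdivrMr//.
  by rewrite -natrX -natrM ler_nat /N mulSn -add1n leq_add2r expn_gt0.
apply: lim_sup_set_cvg0 => //.
apply: (@le_lt_trans _ _ (B.+1%:R / (1 - th))%:E); last by rewrite ltry.
apply: lime_le; first by apply: is_cvg_nneseries.
apply: nearW => n; apply: (@le_trans _ _ (\sum_(0 <= k < n) (B.+1%:R * th ^+ k)%:E)%E).
  by apply: lee_sum => k _; exact: mSk.
by rewrite sumEFin lee_fin -mulr_sumr ler_wpM2l//; exact: geometric_le.
Qed.

End exact_dimension.

Section coding_geometry.
Context {R : realType} {a : nat}.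
Hypothesis a2 : (2 <= a)%N.

Lemma foldr_ifs_map (w : word a) (x : R) :
  foldr (@ifs_map R a) x w = left_end w + a%:R ^- size w * x.
Proof.
rewrite /left_end; elim: w => [|c w ih] /=; first by rewrite expr0 invr1 mul1r add0r.
by rewrite ih /ifs_map exprS invfM; ring.
Qed.

Lemma left_end_itv (w : word a) : 0 <= @left_end R a w <= 1.
Proof.
rewrite /left_end; elim: w => [|c s ih] /=; first by rewrite lexx ler01.
exact: ifs_map_itv.
Qed.

Lemma coding_bounds (i : seq_space a) k :
  left_end (prefix_word i k) <= (coding i : R) <= left_end (prefix_word i k) + a%:R ^- k.
Proof.
have ak : 0 <= a%:R ^- k :> R by rewrite invr_ge0 exprn_ge0.
have bd : \forall n \near \oo, left_end (prefix_word i k) <= foldr (@ifs_map R a) 0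
  (prefix_word i n) <=
    left_end (prefix_word i k) + a%:R ^- k.
  exists k => // n /= kn.
  have -> : prefix_word i n = prefix_word i k ++ [seq (i j : letter a) | j <- iota k (n - k)].
    by rewrite -map_cat -iotaD subnKC.
  rewrite foldr_cat foldr_ifs_map size_prefix_word.
  have /andP[h0 h1] := left_end_itv [seq (i j : letter a) | j <- iota k (n - k)].
  by rewrite lerDl lerD2l mulr_ge0//= ler_piMr.
apply/andP; split.
  by apply: limr_ge; [exact: coding_cvg|apply: filterS bd => n /andP[]].
by apply: limr_le; [exact: coding_cvg|apply: filterS bd => n /andP[]].
Qed.

Lemma inv_pow_le k : a%:R ^- k <= 2 ^- k :> R.
Proof.
rewrite lef_pV2 ?posrE ?exprn_gt0 ?ltr0n ?(leq_trans _ a2)//.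
by apply: lerXn2r; rewrite ?nnegrE ?ler0n ?ler_nat.
Qed.

Lemma coding_itv (i : seq_space a) : 0 <= (coding i : R) <= 1.
Proof.
have /andP[h0 h1] := coding_bounds i 0.
have /andP[l0 l1] := left_end_itv (prefix_word i 0).
by move: h0 h1; rewrite /prefix_word /left_end /= expr0 invr1 add0r => -> ->.
Qed.

Lemma measurable_coding_preimage (A : set R) : measurable A ->
  measurable ((@coding R a) @^-1` A).
Proof. by move=> mA; rewrite -[X in measurable X]setTI; exact: measurable_coding. Qed.

End coding_geometry.

Section null_sets.
Context {R : realType} {d} {T : measurableType d}.
Variable mu : {measure set T -> \bar R}.

Lemma ae_not_null (A : set T) : measurable A -> {ae mu, forall x, ~ A x} -> mu A = 0%E.
Proof.
move=> mA [N [mN N0 AN]]; apply/eqP; rewrite eq_le measure_ge0 andbT -N0.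
by apply: le_measure; rewrite ?inE// => x Ax; apply: AN => /= /(_ Ax).
Qed.

Lemma null_ae_not (A : set T) : measurable A -> mu A = 0%E -> {ae mu, forall x, ~ A x}.
Proof. by move=> mA A0; exists A; split => // x /= /contrapT. Qed.

End null_sets.

Lemma near_dyadic {R : realType} (Q : R -> Prop) :
  (\forall r \near 0^'+, Q r) -> \forall k \near \oo, Q (2 ^- k).
Proof.
move=> [e /= e0 he].
have cv : (fun k => 2 ^- k) @ \oo --> (0 : R).
  have -> : (fun k => 2 ^- k) = (fun k => (2^-1) ^+ k) :> (nat -> R).
    by apply/funext => k; rewrite exprVn.
  by apply: cvg_expr; rewrite ger0_norm ?invr_ge0// invf_lt1 ?ltr1n.
move/cvgrPdist_lt: cv => /(_ e e0); apply: filterS => k hk.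
by apply: he => //=; rewrite invr_gt0 exprn_gt0.
Qed.

Lemma below_cofinal {R : realType} (D s : R) : 0 < D -> s < D ->
  exists n : nat, s <= D * (1 - n.+2%:R^-1).
Proof.
move=> D0 sD; have e0 : 0 < 1 - s / D by rewrite subr_gt0 ltr_pdivrMr// mul1r.
exists (Num.truncn (1 - s / D)^-1); rewrite -ler_pdivrMl// mulrC.
have : (Num.truncn (1 - s / D)^-1).+2%:R^-1 <= 1 - s / D.
  rewrite -[leRHS]invrK lef_pV2 ?posrE ?invr_gt0//; apply: ltW.
  by apply: lt_trans (truncnS_gt _) _; rewrite ltr_nat.
by rewrite lerBrDl -lerBrDr.
Qed.

(** * From close words to heavy balls *)

Section dense_points.
Context {R : realType} {d dS : measure_display} {T : measurableType d} {S : measurableType dS}.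
Variable P : probability T R.
Context {L : finType}.
Variable m : seq L -> T -> R.
Variable pre : S -> nat -> seq L.
Hypothesis size_pre : forall s k, size (pre s k) = k.
Hypothesis mpre : forall k x, measurable [set s | pre s k = x].
Variable mu : T -> {measure set S -> \bar R}.
Hypothesis mu_m : {ae P, forall t u, mu t [set s | pre s (size u) = u] = (m u t)%:E}.
Variable phi : S -> R.
Hypothesis mphi : measurable_fun setT phi.
Variable lam : T -> {finite_measure set R -> \bar R}.
Hypothesis lamE : forall t A, measurable A -> lam t A = mu t (phi @^-1` A).
Variable close : nat -> seq L -> seq L -> bool.
Hypothesis phi_close : forall k s s', `|phi s - phi s'| < 2 ^- k -> close k (pre s k) (pre s' k).

Let mphi_pre A : measurable A -> measurable (phi @^-1` A).
Proof. by move=> mA; rewrite -[X in measurable X]setTI; exact: mphi. Qed.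

Lemma ball_mass_le_close t s k : (forall u, mu t [set s | pre s (size u) = u] = (m u t)%:E) ->
  ball_mass (lam t) (phi s) (2 ^- k) <= close_mass m close k (pre s k) t.
Proof.
move=> mE; have mB : measurable (ball (phi s) (2 ^- k) : set R) by exact: measurable_ball.
rewrite -lee_fin fineK; last exact: fin_num_measure.
have := @measure_pre_pred _ _ _ _ pre size_pre mpre (mu t) (m^~ t) k (close k (pre s k)) mE.
have -> : \sum_(x <- words L k) m x t * (close k (pre s k) x)%:R = close_mass m close k (pre s k) t.
  by rewrite /close_mass [RHS]big_mkcond; apply: eq_bigr => x _; case: ifP => _;
    rewrite ?mulr1 ?mulr0.
apply: le_trans; rewrite lamE//; apply: le_measure; rewrite ?inE.
- exact: mphi_pre.
- exact: (@measurable_pre_pred _ _ _ pre size_pre mpre).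
by move=> s' /phi_close.
Qed.

(** A heavy ball forces a heavy set of close words. Dense sets grow with the exponent, so the
    countable sequence [sn], cofinal below [D], covers every [s < D] outside a single null event. *)
Lemma dense_null (D : R) : 0 < D ->
  (forall s, 0 <= s -> s < D -> {ae P, forall t, mu t (lim_sup_set (fun k => [set i |
     expR (- (s * ln 2)) ^+ k < close_mass m close k (pre i k) t])) = 0%E}) ->
  {ae P, forall t s, 0 <= s -> s < D -> lam t (dense_pt (lam t) s) = 0%E}.
Proof.
move=> D0 null; pose sn (n : nat) := D * (1 - n.+2%:R^-1).
have nul : {ae P, forall t (n : nat), mu t (lim_sup_set (fun k => [set s |
    expR (- (sn n * ln 2)) ^+ k < close_mass m close k (pre s k) t])) = 0%E}.
  apply: ae_foralln => n; apply: null.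
    by rewrite mulr_ge0 ?(ltW D0)// subr_ge0 invf_le1// ler1n.
  by rewrite gtr_pMr// gtrBl invr_gt0.
apply: filterS2 mu_m nul => t mE {}null s s0 sD.
have [n hn] : exists n, s <= sn n by exact: below_cofinal.
apply/eqP; rewrite eq_le measure_ge0 andbT -(null n) lamE; last exact: measurable_dense_pt.
apply: le_measure; rewrite ?inE.
- by apply: mphi_pre; exact: measurable_dense_pt.
- apply: measurable_lim_sup_set => k.
  exact: (@measurable_pre_pred _ _ _ pre size_pre mpre k
    (fun x => expR (- (sn n * ln 2)) ^+ k < close_mass m close k x t)).
move=> i hi N _; have [k /= Nk hk] := hi N Logic.I; exists k => //=.
apply: lt_le_trans (ball_mass_le_close i k mE); apply: le_lt_trans hk.
by apply: lerXn2r; rewrite ?nnegrE ?expR_ge0// ler_expR lerN2 ler_wpM2r// ltW// ln_gt0// ltr1n.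
Qed.

End dense_points.

(** * A single cascade *)

Lemma ae_forall_count {R : realType} {d} {T : measurableType d} (mu : {measure set T -> \bar R})
  {I : countType} (Q : I -> T -> Prop) :
  (forall i, {ae mu, forall t, Q i t}) -> {ae mu, forall t i, Q i t}.
Proof.
move=> aeQ.
have : {ae mu, forall t (n : nat), if unpickle n is Some i then Q i t else True}.
  apply: ae_foralln => n; case: (unpickle n) => [i|]; [exact: aeQ|exact: aeW].
by apply: filterS => t Qt i; have := Qt (pickle i); rewrite pickleK.
Qed.

(* Copies of a nonnegative variable are nonnegative only almost surely; their absolute values
   are so everywhere. *)
Definition abs_weight {R : realType} {T : Type} {I : Type} (Vs : I -> T -> R) (u : I)
  (t : T) : R := `|Vs u t|.

(** The measures [lV] are chosen sample by sample, with no measurability in the sample. The upper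
    limit of the level masses is measurable, and almost surely it is a true limit equal to the mass
    of the cylinder. *)
Definition mass {R : realType} {L : finType} {T : Type} (q : seq L -> T -> R) (u : seq L)
  (t : T) : R :=
  fine (limn_esup (fun n => (level_mass q n u t)%:E)).

Lemma sigma_tame {R : realType} {d} {T : measurableType d} {L : choiceType}
    (X : seq L -> T -> R) (A : set (seq L)) (C beta : R) z :
  (forall u, measurable_fun setT (X u)) ->
  (forall j, (0 < j <= size z)%N -> A (take j z)) ->
  sigma_fun X A (fun t => (tame X C beta z t)%:R).
Proof.
move=> mX zA; apply: measurable_bool_R.
have -> : tame X C beta z = fun t =>
    ~~ has (fun m => ~~ (path_weight X (take m z) t <= C * beta ^+ m)) (iota 0 (size z).+1).
  by apply/funext => t; rewrite [has _ _]has_predC negbK.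
apply: measurable_neg; apply: measurable_has => k; apply: measurable_neg.
apply: measurable_fun_ler => //; apply: sigma_path_weight => j /andP[j0].
rewrite size_take_min leq_min => /andP[jk jz]; rewrite take_takel//.
by apply: zA; rewrite j0.
Qed.

Section single.
Context {R : realType} {d0 d : measure_display} {T0 : measurableType d0} {T : measurableType d}.
Variables (P0 : probability T0 R) (P : probability T R).
Variable V : {RV P0 >-> R}.
Hypothesis V0 : forall t, 0 <= V t.
Hypothesis EV : ('E_P0[V] = 1)%E.
Variable a : nat.
Hypothesis a2 : (2 <= a)%N.
Hypothesis hV : (entropy V < (ln (a%:R : R))%:E)%E.
Variable Vs : word a -> {RV P >-> R}.
Hypothesis Vs_iid : iid_copies Vs V.
Variable ell : probability (seq_space a) R.
Hypothesis ell_unif : uniform_measure ell.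
Variable lV : T -> {finite_measure set (seq_space a) -> \bar R}.
Hypothesis lV_lim : {ae P, forall w, weakly_converges (cascade_step ell (fun u => Vs u w)) (lV w)}.

Local Notation X := (abs_weight (fun u => Vs u : T -> R)).
Local Notation Q := (path_weight X).
Local Notation m := (mass Q).
Local Notation h := (\int[P0]_t (V t * ln (V t))).

Let a0 : (0 < a)%N. Proof. exact: leq_trans a2. Qed.

Lemma measurable_abs_weight u : measurable_fun setT (X u).
Proof. by apply: measurableT_comp => //; exact: measurable_funPT. Qed.

Lemma abs_weight_ge0 u t : 0 <= X u t.
Proof. exact: normr_ge0. Qed.

Lemma abs_weight_independent : mutually_independent P X.
Proof.
move=> s B us mB; apply: (Vs_iid.1 s (fun u => (fun x : R => `|x|) @^-1` B u) us) => u.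
rewrite -[X in measurable X]setTI.
have /(_ measurableT _ (mB u)) : measurable_fun setT (fun x : R => `|x|) by exact: normr_measurable.
exact.
Qed.

Lemma abs_weight_law u (g : R -> R) : measurable_fun setT g -> (forall x, 0 <= g x) ->
  Ex P (fun t => g (X u t)) = Ex P0 (fun t => g (V t)).
Proof.
move=> mg g0; rewrite (@same_law_Ex _ _ _ _ _ P P0 (Vs u) V (fun x => g `|x|) (Vs_iid.2 u))//.
- by apply: eq_Ex => t; rewrite ger0_norm.
- by apply: (measurableT_comp mg); exact: normr_measurable.
Qed.

Lemma abs_weightE : {ae P, forall t u, X u t = Vs u t}.
Proof.
apply: ae_forall_count => u.
pose B : set R := `]-oo, 0[%classic.
have mB : measurable B by exact: measurable_itv.
exists (Vs u @^-1` B); split.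
- by rewrite -[X in measurable X]setTI; exact: measurable_funPT.
- transitivity (P0 (V @^-1` B)); first exact: (Vs_iid.2 u B mB).
  rewrite (_ : _ @^-1` _ = set0) ?measure0//.
  by apply/seteqP; split => // t; rewrite /B /= in_itv/= ltNge V0.
- move=> t /= /eqP; rewrite /abs_weight => h0; rewrite /B /= in_itv/= ltNge.
  by apply/negP => v0; rewrite ger0_norm ?eqxx in h0.
Qed.

Let mX := measurable_abs_weight.
Let X0 := abs_weight_ge0.
Let iX := abs_weight_independent.
Let lawX := abs_weight_law.
Let mV : measurable_fun setT V. Proof. exact: measurable_funPT. Qed.
Let V1 : Ex P0 V = 1%E. Proof. by move: EV; rewrite unlock. Qed.

Lemma VlnV : P0.-integrable setT (EFin \o (fun t => V t * ln (V t))).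
Proof.
apply: mul_ln_integrable => //; move: hV; rewrite /entropy unlock => /lt_trans; apply.
by rewrite ltry.
Qed.

Lemma entropyE : entropy V = h%:E.
Proof. by rewrite /entropy unlock -Ex_Rintegral//; exact: VlnV. Qed.

Lemma entropy_lt : h < ln a%:R.
Proof. by move: hV; rewrite entropyE lte_fin. Qed.

Lemma weight_entropy_ge0 : 0 <= h.
Proof. by apply: entropy_ge0 => //; exact: VlnV. Qed.

Let mQ := measurable_path_weight mX.
Let Q0 := path_weight_ge0 X0.

Lemma measurable_mass u : measurable_fun setT (m u).
Proof.
apply: measurableT_comp => //; apply: measurable_fun_limn_esup => n.
by apply/measurable_EFinP; exact: measurable_level_mass.
Qed.

Lemma mass_ge0 u t : 0 <= m u t.
Proof.
rewrite fine_ge0//; apply: le_trans (limn_einf_sup _).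
by apply: limn_einf_ge => n; rewrite lee_fin level_mass_ge0.
Qed.

Lemma mass_correct : {ae P, forall t,
  (forall u, level_mass Q n u t @[n --> \oo] --> m u t) /\
  (forall u, lV t (cylinder u) = (m u t)%:E)}.
Proof.
apply: filterS2 lV_lim abs_weightE => t lim_t XE.
have XE' : (fun u => Vs u t) = (fun u => X u t) by apply/funext => u; rewrite XE.
rewrite XE' in lim_t.
have cv u := weak_limit_cylinder a0 ell_unif (X0^~ t) lim_t u.
have mE u : m u t = fine (lV t (cylinder u)).
  have cv' : (level_mass Q n u t)%:E @[n --> \oo] --> (fine (lV t (cylinder u)))%:E.
    by apply: cvg_EFin; [exact: nearW|exact: cv].
  by rewrite /mass; have [_ ->] := cvg_limn_einf_sup cv'.
split=> u; rewrite mE; first exact: cv.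
by rewrite fineK// fin_num_measure//; exact: measurable_cylinder.
Qed.

Let q_m : {ae P, forall t u, level_mass Q n u t @[n --> \oo] --> m u t}.
Proof. by apply: filterS mass_correct => t []. Qed.

Let mu_m : {ae P, forall t u, lV t [set i | prefix_word i (size u) = u] = (m u t)%:E}.
Proof. by apply: filterS mass_correct => t []. Qed.

(** The constant 5 is shared with sums of two codings: one [2^-k] for the radius, and at most one
    for each of the four codings replaced by a left endpoint. *)
Definition close (k : nat) (x x' : word a) : bool :=
  `|@left_end R a x' - left_end x| <= 5 * 2 ^- k.

Let card_a : #|letter a| = a. Proof. exact: card_letter. Qed.
Let card0 : (0 < #|letter a|)%N. Proof. by rewrite card_a. Qed.

(* Beyond the common prefix of [z] and [z'] the weights along [z'] are independent of those
   along [z]. *)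
Lemma spine_kernel (C beta : R) z z' : 0 <= C -> 0 <= beta ->
  (Ex P (fun t => Q z t * (tame X C beta z t)%:R * Q z' t)%R <= (C * beta ^+ lcp z z')%:E)%E.
Proof.
move=> C0 b0; set F := fun t => Q z t * (tame X C beta z t)%:R.
have mT : measurable_fun setT (tame X C beta z) by exact: measurable_tame.
have mF : measurable_fun setT F by apply: measurable_funM => //; exact: measurable_bool_R.
have F0 t : 0 <= F t by rewrite mulr_ge0 ?ler0n.
pose A := [set w | exists2 j, (0 < j <= size z)%N & w = take j z].
have sF : sigma_fun X A F.
  apply: measurable_funM; first by apply: sigma_path_weight => j jz; exists j.
  by apply: sigma_tame => // j jz; exists j.
have := leq_lcp z z' (lcp z z'); rewrite leqnn => /esym/and3P[lz lz' /eqP e].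
rewrite (Ex_path_weight_take mX X0 iX (Ex_X X0 V0 V1 lawX) sF F0 lz'); last first.
  move=> j /andP[lj jz'] [j' /andP[_ j'z] e'].
  have jj' : j = j' by move/(congr1 size): e'; rewrite !size_takel.
  by move: lj; rewrite ltnNge leq_lcp jz' e' -jj' eqxx andbT jj' j'z.
apply: (@le_trans _ _ (Ex P (fun t => C * beta ^+ lcp z z' * Q z t)%R)).
  apply: Ex_le => //.
  - exact: measurable_funM.
  - exact: measurable_funM.
  - by move=> t; rewrite mulr_ge0.
  move=> t; rewrite -e /F mulrAC -mulrA mulrC; apply: ler_wpM2r => //.
  case: (boolP (tame _ _ _ _ _)) => [/allP/(_ (lcp z z'))|_]; last first.
    by rewrite mulr0 mulr_ge0 ?exprn_ge0.
  by rewrite mem_iota add0n ltnS => /(_ lz); rewrite mulr1.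
rewrite ExZ ?mulr_ge0 ?exprn_ge0//.
by rewrite (Ex_path_weight mX X0 iX (Ex_X X0 V0 V1 lawX)) mule1.
Qed.

Lemma single_lower (s : R) : 0 <= s -> s < 1 - h / ln a%:R ->
  {ae P, forall t, lV t (lim_sup_set (fun k => [set i |
     expR (- (s * ln 2)) ^+ k < close_mass m close k (prefix_word i k) t])) = 0%E}.
Proof.
move=> s0 sD.
have la : 0 < ln a%:R :> R by apply: ln_gt0; rewrite ltr1n.
have h0 := weight_entropy_ge0.
have D1 : 1 - h / ln a%:R <= 1 by rewrite gerBl divr_ge0// ltW.
(* The energy decays at the rate [s'] while the threshold uses [s < s']; the ratio of the two is
   what is summable in [k]. *)
pose s' := (s + (1 - h / ln a%:R)) / 2.
have ss' : s < s' by rewrite /s'; lra.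
have s'D : s' < 1 - h / ln a%:R by rewrite /s'; lra.
have l2 : 0 < ln 2 :> R by apply: ln_gt0; rewrite ltr1n.
(* Half of the available gap, so the growth rate [expR (h + e)] stays below [a^(1 - s')] and the sum
   over branching levels converges. *)
pose e := ((1 - s') * ln a%:R - h) / 2.
have e0 : 0 < e.
  rewrite /e divr_gt0// subr_gt0 -ltr_pdivrMr//; lra.
have th1 : expR (h + e) * expR (- ((1 - s') * ln a%:R)) < 1.
  by rewrite -expRD expR_lt1; move: e0; rewrite /e; lra.
apply: (@limsup_null _ _ _ _ _ P _ m measurable_mass mass_ge0 (@prefix_word a)
  (@size_prefix_word a) (fun i k l => @take_prefix_word a i k l) (@measurable_prefix a) lV mu_m
  (fun k x t => expR (- (s * ln 2)) ^+ k < close_mass m close k x t)).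
  move=> k x; apply: measurable_fun_ltr => //.
  by apply: measurable_close_mass; exact: measurable_mass.
move=> eta eta0.
apply: (@close_mass_small _ _ _ P _ card0 Q m mQ Q0 measurable_mass mass_ge0 q_m close
  (expR (- (s' * ln 2))) (expR (- (s * ln 2)))) => //.
- by rewrite ltr_expR ltrN2 ltr_pM2r.
move=> eta' eta'0.
have [C C0 hC] := spine_tame mX X0 iX mV V0 V1 lawX VlnV e0 eta'0.
have b0 : 0 <= expR (h + e) by exact: expR_ge0.
exists (C * ((2 * 5 + 1) / (1 - expR (h + e) * expR (- ((1 - s') * ln a%:R))))),
  (tame X C (expR (h + e))).
split.
- by rewrite mulr_ge0 ?(ltW C0)// divr_ge0 ?subr_ge0 ?(ltW th1)//; lra.
- by move=> z; exact: measurable_tame.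
- exact: hC.
move=> z k n kz zn; rewrite card_a.
have mT : measurable_fun setT (fun t => Q z t * (tame X C (expR (h + e)) z t)%:R).
  by apply: measurable_funM => //; apply: measurable_bool_R; exact: measurable_tame.
have T0' t : 0 <= Q z t * (tame X C (expR (h + e)) z t)%:R by rewrite mulr_ge0 ?ler0n.
have mTQ z' : measurable_fun setT (fun t => Q z t * (tame X C (expR (h + e)) z t)%:R * Q z' t).
  exact: measurable_funM.
have TQ0 z' t : 0 <= Q z t * (tame X C (expR (h + e)) z t)%:R * Q z' t by rewrite mulr_ge0.
rewrite ExZ ?invr_ge0 ?exprn_ge0//; last 2 first.
- by under eq_fun do rewrite -big_filter; exact: measurable_sum.
- by move=> t; exact: sumr_ge0.
rewrite Ex_sum//.
apply: (@le_trans _ _ ((a%:R ^- n)%:E * (\sum_(z' <- words (letter a) n | close k (take k z) (take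
  k z')) C * expR (h + e) ^+ lcp z z')%:E)%E).
  apply: lee_wpmul2l; first by rewrite lee_fin invr_ge0 exprn_ge0.
  rewrite -sumEFin; apply: lee_sum => z' _; apply: spine_kernel => //; exact: ltW.
rewrite -EFinM lee_fin -mulr_sumr mulrCA -[leRHS]mulrA ler_wpM2l ?(ltW C0)//.
apply: single_kernel_sum => //; first by apply/andP; split; lra.
exact: leq_trans zn.
Qed.

(** A typical cylinder of level [k] has mass about [a^-k e^(k h)]. One [e] allows for fluctuations
    of the product of weights, the other for a limit mass below [a^-k] times that product. *)
Definition light (e : R) (k : nat) (x : word a) (t : T) : bool :=
  m x t < a%:R ^- k * expR (k%:R * (h - 2 * e)).

(** A light word either has an atypically small product, which is exponentially rare under the
    size-biased law, or its mass is at most [e^(-e k) a^-k] times its product. The latter quantity,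
    summed over all words, has mean [e^(-e k)]. *)
Lemma single_upper (e : R) : 0 < e ->
  {ae P, forall t, lV t (lim_sup_set (fun k => [set i | light e k (prefix_word i k) t])) = 0%E}.
Proof.
move=> e0.
have [theta /andP[th0 th1] hth] := spine_lower mX X0 iX mV V0 V1 lawX VlnV e0.
have ee1 : 0 <= expR (- e) < 1 by rewrite expR_ge0 expR_lt1 oppr_lt0.
have ml k x : measurable_fun setT (light e k x).
  by apply: measurable_fun_ltr => //; exact: measurable_mass.
apply: (@limsup_null_summable _ _ _ _ _ P _ m measurable_mass mass_ge0 (@prefix_word a)
  (@size_prefix_word a) (@measurable_prefix a) lV mu_m (light e)
    ((1 - theta)^-1 + (1 - expR (- e))^-1)) => //.
move=> n.
suff hk k : (Ex P (fun t => \sum_(x <- words (letter a) k) m x t * (light e k x t)%:R)%R <= (theta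
  ^+ k + expR (- e) ^+ k)%:E)%E.
  apply: (@le_trans _ _ (\sum_(0 <= k < n) (theta ^+ k + expR (- e) ^+ k)%:E)%E).
    by apply: lee_sum => k _; exact: hk.
  rewrite sumEFin lee_fin big_split/=; apply: lerD; apply: geometric_le => //.
  by rewrite (ltW th0).
pose I x t : R := (Q x t <= expR (k%:R * (h - e)))%R%:R.
have mI x : measurable_fun setT (I x) by apply: measurable_bool_R; exact: measurable_fun_ler.
have I0 x t : 0 <= I x t by exact: ler0n.
pose c := expR (- e) ^+ k * a%:R ^- k.
have c0 : 0 <= c by rewrite mulr_ge0 ?exprn_ge0 ?expR_ge0// invr_ge0 exprn_ge0.
apply: (@le_trans _ _ (Ex P (fun t => \sum_(x <- words (letter a) k) m x t * I x t + \sum_(x <-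
  words (letter a) k) c * Q x t)%R)).
  apply: Ex_le.
  - apply: measurable_sum => x; apply: measurable_funM; first exact: measurable_mass.
    exact: measurable_bool_R.
  - apply: measurable_funD; apply: measurable_sum => x; apply: measurable_funM => //.
    exact: measurable_mass.
  - by move=> t; apply: sumr_ge0 => x _; rewrite mulr_ge0 ?ler0n ?mass_ge0.
  move=> t; rewrite -big_split/=; apply: ler_sum => x _.
  have m0 := mass_ge0 x t.
  rewrite /I; case: (leP (Q x t)) => /= hQ.
    rewrite mulr1 -[leLHS]addr0 lerD ?mulr_ge0//.
    by case: (light _ _ _ _); rewrite ?mulr1 ?mulr0.
  rewrite mulr0 add0r; case: (boolP (light _ _ _ _)) => /= hl; last by rewrite mulr0 mulr_ge0.
  rewrite mulr1; apply: le_trans (ltW hl) _; rewrite /c mulrAC mulrC.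
  apply: ler_wpM2r; first by rewrite invr_ge0 exprn_ge0.
  apply: (@le_trans _ _ (expR (- e) ^+ k * expR (k%:R * (h - e)))).
    by rewrite -expRM_natl -expRD ler_expR; lra.
  by rewrite ler_wpM2l ?exprn_ge0 ?expR_ge0// ltW.
rewrite ExD//; last 4 first.
- by apply: measurable_sum => x; apply: measurable_funM => //; exact: measurable_mass.
- by apply: measurable_sum => x; exact: measurable_funM.
- by move=> t; apply: sumr_ge0 => x _; rewrite mulr_ge0// mass_ge0.
- by move=> t; apply: sumr_ge0 => x _; rewrite mulr_ge0.
rewrite EFinD; apply: leeD.
  apply: (@Ex_mass_le_max _ _ _ P _ card0 Q m mQ Q0 measurable_mass q_m) => //.
  move=> z kz; rewrite (size_biased_take mX X0 iX V0 V1 lawX kz)//.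
    by have := hth (take k z); rewrite size_takel.
  apply: measurable_bool_R; apply: measurable_fun_ler => //.
  apply: sigma_path_weight => j /andP[_]; rewrite size_takel// => jk.
  by exists j => //; rewrite take_takel.
rewrite Ex_sum; last 2 first.
- by move=> x; exact: measurable_funM.
- by move=> x t; rewrite mulr_ge0.
under eq_bigr => x _ do rewrite ExZ// (Ex_path_weight mX X0 iX (Ex_X X0 V0 V1 lawX)) mule1.
rewrite sumEFin big_const_seq count_predT size_words card_a iter_addr_0 lee_fin.
rewrite -[leLHS]mulr_natl natrX /c mulrCA mulfV ?mulr1// expf_neq0// pnatr_eq0 -lt0n//.
Qed.

Definition cascade_dim : R := 1 - h / ln a%:R.
Local Notation D := cascade_dim.

Let la : 0 < ln a%:R :> R. Proof. by apply: ln_gt0; rewrite ltr1n. Qed.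

Lemma cascade_dim_gt0 : 0 < D.
Proof. by rewrite subr_gt0 ltr_pdivrMr// mul1r; exact: entropy_lt. Qed.

Let limsup_light_null : {ae P, forall t (n : nat), lV t (lim_sup_set (fun k => [set i |
  light (n.+1%:R^-1) k (prefix_word i k) t])) = 0%E}.
Proof.
by apply: ae_foralln => n; apply: single_upper; rewrite invr_gt0.
Qed.

Lemma cascade_dense_null : {ae P, forall t s, 0 <= s -> s < D ->
  cascade_measure (lV t) (dense_pt (cascade_measure (lV t)) s) = 0%E}.
Proof.
apply: (dense_null (@size_prefix_word a) (@measurable_prefix a) mu_m (@measurable_coding R a)
  (lam := fun t => cascade_measure (lV t)) (close := close) _ _ cascade_dim_gt0).
- by [].
- move=> k i j ij.
  have /andP[i1 i2] := @coding_bounds R a i k; have /andP[j1 j2] := @coding_bounds R a j k.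
  have ak := @inv_pow_le R a a2 k; have k0 : 0 < 2 ^- k :> R by rewrite invr_gt0 exprn_gt0.
  move: ij; rewrite ltr_norml => /andP[h1 h2].
  by rewrite /close ler_norml; apply/andP; split; lra.
- by move=> s s0 sD; exact: single_lower.
Qed.

(** Almost every sequence has only finitely many light prefixes, and a cylinder of level [k] is
    coded into the ball of radius [2 a^-k] around the coding of any of its points. *)
Lemma cascade_ball_lower : {ae P, forall t, {ae lV t, forall i (e : R), 0 < e ->
  \forall r \near 0^'+, expR ((D + e) * ln r) <= ball_mass (cascade_measure (lV t)) (coding i) r}}.
Proof.
have mc := mass_correct.
apply: filterS2 mc limsup_light_null => t [_ lVm] null.
have : {ae lV t, forall i (n : nat), ~ lim_sup_set (fun k => [set i |
  light (n.+1%:R^-1) k (prefix_word i k) t]) i}.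
  apply: ae_foralln => n; apply: null_ae_not; last exact: null.
  apply: measurable_lim_sup_set => k.
  exact: (@measurable_pre_pred _ _ _ (@prefix_word a) (@size_prefix_word a) (@measurable_prefix a) k
    (fun x => light (n.+1%:R^-1) k x t)).
apply: filterS => i hi e e0.
have D0 := cascade_dim_gt0.
(* The loss [2 / (n + 1)] in the exponent of [light] becomes [2 / (n + 1) / ln a] in the dimension;
   this [n] brings it below [e]. *)
pose n := Num.truncn (2 / (e * ln a%:R)).
have ne : 2 * n.+1%:R^-1 / ln a%:R < e.
  rewrite ltr_pdivrMr// ltr_pdivrMr// mulrC -ltr_pdivrMr ?mulr_gt0//; exact: truncnS_gt.
pose s := D + 2 * n.+1%:R^-1 / ln a%:R.
have s0 : 0 <= s by rewrite addr_ge0 ?(ltW D0)// divr_ge0 ?(ltW la)// mulr_ge0 ?invr_ge0.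
have se : s < D + e by rewrite ltrD2l.
have ra0 : 0 < a%:R :> R by rewrite ltr0n.
have q01 : 0 < (a%:R^-1 : R) < 1 by rewrite invr_gt0 ra0/= invf_lt1// ltr1n.
apply: (scale_upper (@ball_mass_nd R (cascade_measure (lV t)) (coding i)) q01 (ltr0Sn R 1) s0 se).
apply: filterS (not_lim_sup_set (hi n)) => k /negP; rewrite -leNgt => hk.
apply: le_trans (le_trans _ hk) _.
  rewrite expR_natN// -expRD ler_expR lnV ?posrE// /s /cascade_dim.
  rewrite le_eqVlt; apply/orP; left; apply/eqP.
  move: (n.+1%:R^-1 : R) (k%:R : R) => x y; field.
  by rewrite gt_eqF.
rewrite -lee_fin -lVm fineK; last by apply: fin_num_measure; exact: measurable_ball.
rewrite -[leRHS]/(lV t ((@coding R a) @^-1` ball (coding i : R) (2 * a%:R^-1 ^+ k))).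
apply: le_measure; rewrite ?inE.
- exact: measurable_cylinder.
- by apply: measurable_coding_preimage; exact: measurable_ball.
move=> j; rewrite /cylinder /= size_prefix_word => jE; rewrite /ball /= exprVn.
have /andP[i1 i2] := @coding_bounds R a i k; have /andP[j1 j2] := @coding_bounds R a j k.
have ak : 0 < a%:R ^- k :> R by rewrite invr_gt0 exprn_gt0.
rewrite jE in j1 j2; rewrite ltr_norml; apply/andP; split; lra.
Qed.

Lemma cascade_sparse_null : {ae P, forall t s, D < s ->
  cascade_measure (lV t) (sparse_pt (cascade_measure (lV t)) s) = 0%E}.
Proof.
apply: filterS cascade_ball_lower => t ht s Ds.
apply: (@ae_not_null _ _ _ (lV t)).
  by apply: measurable_coding_preimage; exact: measurable_sparse_pt.
have e0 : 0 < s - D by rewrite subr_gt0.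
apply: filterS ht => i /(_ _ e0) /near_dyadic[N _ hN] hi.
have [k /= Nk] := hi N Logic.I; apply/negP; rewrite -leNgt.
apply: le_trans (hN k Nk); rewrite dyadic_lnE -expRM_natl ler_expR.
by rewrite subrKC; lra.
Qed.

Lemma cascade_exact_dim : {ae P, forall t, exact_dim (cascade_measure (lV t)) D}.
Proof.
apply: filterS2 cascade_dense_null cascade_sparse_null => t lo up.
apply: exact_dim_criterion; [exact: cascade_dim_gt0|exact: lo|exact: up].
Qed.

End single.

(** * Convolution of two cascades *)

Section convolution_finite.
Context {R : realType}.
Variables m1 m2 : {finite_measure set R -> \bar R}.

Lemma convolution_fin : fin_num_fun (convolution m1 m2).
Proof.
have mD : measurable_fun [set: R * R] (fun z : R * R => z.1 + z.2) by exact: measurable_funD.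
move=> A mA; rewrite ge0_fin_numE ?measure_ge0//.
apply: (@le_lt_trans _ _ ((m1 \x m2)%E setT)).
  rewrite -[leLHS]/((m1 \x m2)%E ((fun z : R * R => z.1 + z.2) @^-1` A)).
  apply: le_measure; rewrite ?inE//.
  by rewrite -[X in measurable X]setTI; exact: mD.
rewrite -setXTT product_measure1E//.
by rewrite lte_mul_pinfty// ?ltry ?fin_num_measure// -ge0_fin_numE// fin_num_measure.
Qed.

Definition finite_convolution : {finite_measure set R -> \bar R} :=
  HB.pack (convolution m1 m2) (Measure_isFinite.Build _ _ _ (convolution m1 m2) convolution_fin).

End convolution_finite.

Section convolution_cascades.
Context {R : realType} {a b : nat}.
Variable mu : {finite_measure set (seq_space a) -> \bar R}.
Variable nu : {finite_measure set (seq_space b) -> \bar R}.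

Definition coding_sum (s : seq_space a * seq_space b) : R := coding s.1 + coding s.2.

Lemma measurable_coding_sum : measurable_fun setT coding_sum.
Proof.
by apply: measurable_funD; apply: measurableT_comp => //; exact: measurable_coding.
Qed.

(** Products of measurable sets determine the product measure. The convolution thus lives on pairs
    of sequences, where prefixes are available. *)
Lemma convolution_coding A : measurable A ->
  convolution (cascade_measure mu) (cascade_measure nu) A = (mu \x nu)%E (coding_sum @^-1` A).
Proof.
move=> mA.
have mD : measurable_fun [set: R * R] (fun z : R * R => z.1 + z.2) by exact: measurable_funD.
pose c2 (s : seq_space a * seq_space b) : R * R := (coding s.1, coding s.2).
have mc2 : measurable_fun setT c2.
  by apply: measurable_fun_pair; apply: measurableT_comp => //; exact: measurable_coding.
pose M : {measure set (R * R) -> \bar R} :=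
  measure_function_pushforward__canonical__measure_function_Measure (mu \x nu)%E mc2.
rewrite /convolution /pushforward.
rewrite (@product_measure_unique _ _ _ _ R (cascade_measure mu) (cascade_measure nu) M)//.
- move=> B C mB mC; rewrite /M /= /pushforward.
  rewrite -[_ @^-1` _]/(((@coding R a) @^-1` B) `*` ((@coding R b) @^-1` C)).
  by rewrite product_measure1E//; exact: measurable_coding_preimage.
- by rewrite -[X in measurable X]setTI; exact: mD.
Qed.

End convolution_cascades.

Lemma ae_fst {R : realType} {d1 d2} {T1 : measurableType d1} {T2 : measurableType d2}
    (m1 : {finite_measure set T1 -> \bar R}) (m2 : {finite_measure set T2 -> \bar R}) (Q : T1 ->
      Prop) :
  {ae m1, forall x, Q x} -> {ae (m1 \x m2)%E, forall z, Q z.1}.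
Proof.
move=> [N [mN N0 QN]]; exists (N `*` setT); split.
- exact: measurableX.
- rewrite product_measure1E//; rewrite [X in (X * _)%E](_ : _ = 0%E) ?mul0e//.
- by move=> z /= Qz; split => //; exact: QN.
Qed.

Lemma ae_snd {R : realType} {d1 d2} {T1 : measurableType d1} {T2 : measurableType d2}
    (m1 : {finite_measure set T1 -> \bar R}) (m2 : {finite_measure set T2 -> \bar R}) (Q : T2 ->
      Prop) :
  {ae m2, forall x, Q x} -> {ae (m1 \x m2)%E, forall z, Q z.2}.
Proof.
move=> [N [mN N0 QN]]; exists (setT `*` N); split.
- exact: measurableX.
- rewrite product_measure1E//; rewrite [X in (_ * X)%E](_ : _ = 0%E) ?mule0//.
- by move=> z /= Qz; split => //; exact: QN.
Qed.

Lemma take_zip {A B : Type} k (s : seq A) (t : seq B) : take k (zip s t) = zip (take k s)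
  (take k t).
Proof. by elim: k s t => [|k ih] [|x s] [|y t] //=; rewrite ih. Qed.

Lemma sigma_generated_abs {R : realType} {d} {T : measurableType d} {I : Type} (X : I -> T -> R) A :
  sigma_generated (abs_weight X) A -> sigma_generated X A.
Proof.
apply: smallest_sub; first exact: smallest_sigma_algebra.
move=> _ [i _ [B mB <-]]; apply: sub_sigma_algebra; exists i => //.
exists ((fun x : R => `|x|) @^-1` B) => //.
rewrite -[X in measurable X]setTI.
have /(_ measurableT _ mB) : measurable_fun setT (fun x : R => `|x|) by exact: normr_measurable.
exact.
Qed.

Section pair.
Context {R : realType} {d0 d : measure_display} {T0 : measurableType d0} {T : measurableType d}.
Variables (P0 : probability T0 R) (P : probability T R).
Variables V W : {RV P0 >-> R}.
Hypotheses (V0 : forall t, 0 <= V t) (W0 : forall t, 0 <= W t).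
Hypotheses (EV : ('E_P0[V] = 1)%E) (EW : ('E_P0[W] = 1)%E).
Variables a b : nat.
Hypotheses (a2 : (2 <= a)%N) (b2 : (2 <= b)%N).
Hypothesis hV : (entropy V < (ln (a%:R : R))%:E)%E.
Hypothesis hW : (entropy W < (ln (b%:R : R))%:E)%E.
Variables (Vs : word a -> {RV P >-> R}) (Ws : word b -> {RV P >-> R}).
Hypotheses (Vs_iid : iid_copies Vs V) (Ws_iid : iid_copies Ws W).
Hypothesis Vs_Ws : independent_families P (fun u => Vs u : T -> R) (fun v => Ws v : T -> R).
Variables (ella : probability (seq_space a) R) (ellb : probability (seq_space b) R).
Hypotheses (ella_unif : uniform_measure ella) (ellb_unif : uniform_measure ellb).
Variable lV : T -> {finite_measure set (seq_space a) -> \bar R}.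
Variable lW : T -> {finite_measure set (seq_space b) -> \bar R}.
Hypothesis lV_lim : {ae P, forall w, weakly_converges (cascade_step ella (fun u => Vs u w)) (lV w)}.
Hypothesis lW_lim : {ae P, forall w, weakly_converges (cascade_step ellb (fun v => Ws v w)) (lW w)}.

Local Notation X := (abs_weight (fun u => Vs u : T -> R)).
Local Notation Y := (abs_weight (fun v => Ws v : T -> R)).
Local Notation QV := (path_weight X).
Local Notation QW := (path_weight Y).
Local Notation mV := (mass QV).
Local Notation mW := (mass QW).
Local Notation h := (\int[P0]_t (V t * ln (V t))).
Local Notation h' := (\int[P0]_t (W t * ln (W t))).
Local Notation L := (letter a * letter b)%type.

(** Pairs of words of equal length are words over the product alphabet. These weights are not those
    of an independent cascade on the product tree, since pairs with a common coordinate share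
    weights; only the general transfer lemmas apply, with their own kernel estimate. *)
Definition pair_weight (z : seq L) (t : T) : R := QV (unzip1 z) t * QW (unzip2 z) t.
Definition pair_mass (z : seq L) (t : T) : R := mV (unzip1 z) t * mW (unzip2 z) t.
Definition pair_prefix (s : seq_space a * seq_space b) (k : nat) : seq L :=
  zip (prefix_word s.1 k) (prefix_word s.2 k).
Definition pair_end (z : seq L) : R := left_end (unzip1 z) + left_end (unzip2 z).
Definition pair_close (k : nat) (z z' : seq L) : bool :=
  `|pair_end z' - pair_end z| <= 5 * 2 ^- k.

Let mX := measurable_abs_weight Vs.
Let mY := measurable_abs_weight Ws.
Let X0 := abs_weight_ge0 Vs.
Let Y0 := abs_weight_ge0 Ws.
Let mQV := measurable_path_weight mX.
Let mQW := measurable_path_weight mY.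
Let QV0 := path_weight_ge0 X0.
Let QW0 := path_weight_ge0 Y0.
Let lawX := abs_weight_law V0 Vs_iid.
Let lawY := abs_weight_law W0 Ws_iid.
Let iX := abs_weight_independent Vs_iid.
Let iY := abs_weight_independent Ws_iid.
Let V1 : Ex P0 V = 1%E. Proof. by move: EV; rewrite unlock. Qed.
Let W1 : Ex P0 W = 1%E. Proof. by move: EW; rewrite unlock. Qed.
Let mfV : measurable_fun setT V. Proof. exact: measurable_funPT. Qed.
Let mfW : measurable_fun setT W. Proof. exact: measurable_funPT. Qed.

Lemma abs_independent_families : independent_families P X Y.
Proof. by move=> A B /sigma_generated_abs sA /sigma_generated_abs sB; exact: Vs_Ws. Qed.

Lemma measurable_pair_weight z : measurable_fun setT (pair_weight z).
Proof. exact: measurable_funM. Qed.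

Lemma pair_weight_ge0 z t : 0 <= pair_weight z t.
Proof. by rewrite mulr_ge0. Qed.

Lemma measurable_pair_mass z : measurable_fun setT (pair_mass z).
Proof. by apply: measurable_funM; exact: measurable_mass. Qed.

Lemma pair_mass_ge0 z t : 0 <= pair_mass z t.
Proof. by rewrite mulr_ge0// mass_ge0. Qed.

Lemma card_pair : #|{: L}| = (a * b)%N.
Proof. by rewrite card_prod !card_letter// ltnW. Qed.

Let card_pair0 : (0 < #|{: L}|)%N.
Proof. by rewrite card_pair muln_gt0 !(leq_trans _ a2) ?(leq_trans _ b2). Qed.

Lemma pair_level_mass n z t :
  level_mass pair_weight n z t = level_mass QV n (unzip1 z) t * level_mass QW n (unzip2 z) t.
Proof.
rewrite /level_mass card_pair !card_letter ?(ltnW a2) ?(ltnW b2)// natrM exprMn invfM mulrACA;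
  congr (_ * _).
rewrite mulr_suml; under [RHS]eq_bigr do rewrite mulr_sumr.
pose f (u : word a) (v : word b) : R :=
  if (take (size z) u == unzip1 z) && (take (size z) v == unzip2 z) then QV u t * QW v t else 0.
transitivity (\sum_(w <- words L n) f (unzip1 w) (unzip2 w)).
  rewrite big_mkcond; apply: eq_bigr => w _; rewrite /f /unzip1 /unzip2 -!map_take.
  have -> : (take (size z) w == z) = (unzip1 (take (size z) w) == unzip1 z) &&
    (unzip2 (take (size z) w) == unzip2 z).
    apply/eqP/andP => [->//|[/eqP e1 /eqP e2]].
    by rewrite -[LHS]zip_unzip e1 e2 zip_unzip.
  by [].
rewrite big_words_prod [RHS]big_mkcond; apply: eq_bigr => u _.
rewrite !size_map; case: ifP => hu.
  by rewrite [RHS]big_mkcond; apply: eq_bigr => v _; rewrite /f hu.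
by apply: big1 => v _; rewrite /f hu.
Qed.

Lemma pair_mass_correct : {ae P, forall t,
  (forall z, level_mass pair_weight n z t @[n --> \oo] --> pair_mass z t)}.
Proof.
have cV := mass_correct V0 a2 Vs_iid ella_unif lV_lim.
have cW := mass_correct W0 b2 Ws_iid ellb_unif lW_lim.
apply: filterS2 cV cW => t [cV _] [cW _] z.
under eq_fun do rewrite pair_level_mass.
by apply: cvgM; [exact: cV|exact: cW].
Qed.

Lemma size_pair_prefix s k : size (pair_prefix s k) = k.
Proof. by rewrite size_zip !size_prefix_word minnn. Qed.

Lemma take_pair_prefix s k l : (k <= l)%N -> take k (pair_prefix s l) = pair_prefix s k.
Proof. by move=> kl; rewrite take_zip !take_prefix_word. Qed.

Lemma unzip_pair_prefix s k :
  unzip1 (pair_prefix s k) = prefix_word s.1 k /\ unzip2 (pair_prefix s k) = prefix_word s.2 k.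
Proof. by rewrite unzip1_zip ?unzip2_zip// !size_prefix_word. Qed.

Lemma pair_prefixE z : [set s | pair_prefix s (size z) = z] =
  cylinder (unzip1 z) `*` cylinder (unzip2 z).
Proof.
apply/seteqP; split => -[i j] /=; rewrite /cylinder /= !size_map.
  by move=> zE; rewrite -{2 4}zE; have [-> ->] := unzip_pair_prefix (i, j) (size z).
by move=> [iE jE]; rewrite /pair_prefix /= iE jE zip_unzip.
Qed.

Lemma measurable_pair_prefix k z : measurable [set s | pair_prefix s k = z].
Proof.
have [<-|kz] := eqVneq (size z) k.
  by rewrite pair_prefixE; apply: measurableX; exact: measurable_cylinder.
rewrite (_ : [set _ | _] = set0) ?measurable0//.
by apply/seteqP; split => // s /= sz; move: kz; rewrite -sz size_pair_prefix eqxx.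
Qed.

Definition pair_measure (t : T) : {measure set (seq_space a * seq_space b) -> \bar R} :=
  (lV t \x lW t)%E.

Lemma pair_measure_prefix : {ae P, forall t z,
  pair_measure t [set s | pair_prefix s (size z) = z] = (pair_mass z t)%:E}.
Proof.
have cV := mass_correct V0 a2 Vs_iid ella_unif lV_lim.
have cW := mass_correct W0 b2 Ws_iid ellb_unif lW_lim.
apply: filterS2 cV cW => t [_ cV] [_ cW] z.
rewrite pair_prefixE /pair_measure /=.
rewrite product_measure1E; [|exact: measurable_cylinder|exact: measurable_cylinder].
by rewrite /pair_mass EFinM; congr (_ * _)%E; [exact: cV|exact: cW].
Qed.

Lemma Ex_split F G : sigma_fun X setT F -> sigma_fun Y setT G ->
  (forall t, 0 <= F t) -> (forall t, 0 <= G t) ->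
  Ex P (fun t => F t * G t) = (Ex P F * Ex P G)%E.
Proof. by move=> *; apply: (Ex_independent_families mX mY abs_independent_families). Qed.

(** The independence of the two families splits each expectation into one factor per cascade, to
    which the single-path bounds apply; the geometry of sums enters only through the count of close
    pairs. *)
Lemma pair_lower (s1 s2 : R) : 0 <= s1 -> s1 < 1 - h / ln a%:R ->
  0 <= s2 -> s2 < 1 - h' / ln b%:R -> s1 + s2 <= 1 ->
  forall s, s < s1 + s2 ->
  {ae P, forall t, pair_measure t (lim_sup_set (fun k => [set i |
     expR (- (s * ln 2)) ^+ k < close_mass pair_mass pair_close k (pair_prefix i k) t])) = 0%E}.
Proof.
move=> s10 s1D s20 s2D s12 s ss.
have la : 0 < ln a%:R :> R by apply: ln_gt0; rewrite ltr1n.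
have lb : 0 < ln b%:R :> R by apply: ln_gt0; rewrite ltr1n.
have l2 : 0 < ln 2 :> R by apply: ln_gt0; rewrite ltr1n.
pose e := ((1 - s1) * ln a%:R - h) / 2.
pose e' := ((1 - s2) * ln b%:R - h') / 2.
have e0 : 0 < e by rewrite /e divr_gt0// subr_gt0 -ltr_pdivrMr//; lra.
have e'0 : 0 < e' by rewrite /e' divr_gt0// subr_gt0 -ltr_pdivrMr//; lra.
pose al := expR (h + e); pose be := expR (h' + e').
pose th := al * expR (- ((1 - s1) * ln a%:R)).
pose th' := be * expR (- ((1 - s2) * ln b%:R)).
have th1 : th < 1 by rewrite /th /al -expRD expR_lt1; move: e0; rewrite /e; lra.
have th'1 : th' < 1 by rewrite /th' /be -expRD expR_lt1; move: e'0; rewrite /e'; lra.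
apply: (@limsup_null _ _ _ _ _ P _ pair_mass measurable_pair_mass pair_mass_ge0 pair_prefix
  size_pair_prefix take_pair_prefix measurable_pair_prefix pair_measure pair_measure_prefix
  (fun k x t => expR (- (s * ln 2)) ^+ k < close_mass pair_mass pair_close k x t)).
  move=> k x; apply: measurable_fun_ltr => //.
  by apply: measurable_close_mass; exact: measurable_pair_mass.
move=> eta eta0.
apply: (@close_mass_small _ _ _ P _ card_pair0 pair_weight pair_mass measurable_pair_weight
  pair_weight_ge0 measurable_pair_mass pair_mass_ge0 pair_mass_correct pair_close
  (expR (- ((s1 + s2) * ln 2))) (expR (- (s * ln 2)))) => //.
- by rewrite ltr_expR ltrN2 ltr_pM2r.
move=> eta1 eta10; have eta2 : 0 < eta1 / 2 by rewrite divr_gt0.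
have [C C0 hC] := spine_tame mX X0 iX mfV V0 V1 lawX (VlnV V0 hV) e0 eta2; rewrite -/al in hC.
have [C' C'0 hC'] := spine_tame mY Y0 iY mfW W0 W1 lawY (VlnV W0 hW) e'0 eta2; rewrite -/be in hC'.
have al0 : 0 <= al by exact: expR_ge0.
have be0 : 0 <= be by exact: expR_ge0.
pose tV (z : seq L) (t : T) : R := (tame X C al (unzip1 z) t)%:R.
pose tW (z : seq L) (t : T) : R := (tame Y C' be (unzip2 z) t)%:R.
pose nV (z : seq L) (t : T) : R := (~~ tame X C al (unzip1 z) t)%:R.
pose nW (z : seq L) (t : T) : R := (~~ tame Y C' be (unzip2 z) t)%:R.
have sQV u : sigma_fun X setT (QV u) by exact: sigma_path_weight.
have sQW u : sigma_fun Y setT (QW u) by exact: sigma_path_weight.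
have stV z : sigma_fun X setT (tV z) by exact: sigma_tame.
have stW z : sigma_fun Y setT (tW z) by exact: sigma_tame.
have nVE z t : nV z t = 1 - tV z t by rewrite /nV /tV; case: (tame _ _ _ _ _);
  rewrite /= ?subrr ?subr0.
have nWE z t : nW z t = 1 - tW z t by rewrite /nW /tW; case: (tame _ _ _ _ _);
  rewrite /= ?subrr ?subr0.
have snV z : sigma_fun X setT (nV z).
  by rewrite (_ : nV z = fun t => 1 - tV z t); [apply: measurable_funB;
    [exact: measurable_cst|exact: stV]|apply/funext => t; exact: nVE].
have snW z : sigma_fun Y setT (nW z).
  by rewrite (_ : nW z = fun t => 1 - tW z t); [apply: measurable_funB;
    [exact: measurable_cst|exact: stW]|apply/funext => t; exact: nWE].
have tV0 z t : 0 <= tV z t by exact: ler0n.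
have tW0 z t : 0 <= tW z t by exact: ler0n.
have nV0 z t : 0 <= nV z t by exact: ler0n.
have nW0 z t : 0 <= nW z t by exact: ler0n.
(* Both paths have to be tame; each failure costs [eta1 / 2], the product of weights of the other
   coordinate having mean 1. *)
pose g z t := tame X C al (unzip1 z) t && tame Y C' be (unzip2 z) t.
have mg z : measurable_fun setT (g z) by apply: measurable_and; exact: measurable_tame.
pose K := C * C' * ((2 * 5 + 1) / (1 - th) / (1 - th')).
have K0 : 0 <= K.
  by rewrite /K !mulr_ge0 ?invr_ge0 ?subr_ge0 ?(ltW C0) ?(ltW C'0) ?(ltW th1) ?(ltW th'1)//; lra.
exists K, g; split => //.
- move=> z.
  have mV' F : sigma_fun X setT F -> measurable_fun setT F by exact: sigma_fun_measurable.
  have mW' F : sigma_fun Y setT F -> measurable_fun setT F by exact: sigma_fun_measurable.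
  have m1 : sigma_fun X setT (fun t => QV (unzip1 z) t * nV z t) by apply: measurable_funM;
    [exact: sQV|exact: snV].
  have m2 : sigma_fun Y setT (fun t => QW (unzip2 z) t * nW z t) by apply: measurable_funM;
    [exact: sQW|exact: snW].
  have n1 t : 0 <= QV (unzip1 z) t * nV z t by exact: mulr_ge0 (QV0 _ _) (nV0 _ _).
  have n2 t : 0 <= QW (unzip2 z) t * nW z t by exact: mulr_ge0 (QW0 _ _) (nW0 _ _).
  apply: (@le_trans _ _ (Ex P (fun t => (QV (unzip1 z) t * nV z t) * QW (unzip2 z) t +
      QV (unzip1 z) t * (QW (unzip2 z) t * nW z t))%R)).
    apply: Ex_le.
    + apply: measurable_funM; first exact: measurable_pair_weight.
      by apply: measurable_bool_R; exact: measurable_neg.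
    + apply: measurable_funD; apply: measurable_funM => //.
      * exact: mV' m1.
      * exact: mW' m2.
    + by move=> t; rewrite mulr_ge0 ?ler0n// pair_weight_ge0.
    + move=> t; rewrite /pair_weight /g /nV /nW.
      have q1 := QV0 (unzip1 z) t; have q2 := QW0 (unzip2 z) t.
      have q12 : 0 <= QV (unzip1 z) t * QW (unzip2 z) t by rewrite mulr_ge0.
      case: (tame X _ _ _ _); case: (tame Y _ _ _ _); rewrite /= ?mulr1 ?mulr0 ?mul0r ?addr0
        ?add0r//.
      by rewrite lerDl.
  rewrite ExD; last 4 first.
  + by apply: measurable_funM => //; exact: mV' m1.
  + by apply: measurable_funM => //; exact: mW' m2.
  + by move=> t; exact: mulr_ge0 (n1 t) (QW0 _ _).
  + by move=> t; exact: mulr_ge0 (QV0 _ _) (n2 t).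
  rewrite (Ex_split m1 (sQW _) n1 (QW0 _)) (Ex_split (sQV _) m2 (QV0 _) n2).
  rewrite (Ex_path_weight mX X0 iX (Ex_X X0 V0 V1 lawX)) (Ex_path_weight mY Y0 iY (Ex_X Y0 W0 W1
    lawY)).
  rewrite mule1 mul1e; have -> : eta1 = eta1 / 2 + eta1 / 2 by lra.
  by rewrite EFinD; apply: leeD; [exact: hC|exact: hC'].
move=> z k n kz zn.
have sF (z' : seq L) : sigma_fun X setT (fun t => QV (unzip1 z) t * tV z t * QV (unzip1 z') t).
  by apply: measurable_funM; [apply: measurable_funM; [exact: sQV|exact: stV]|exact: sQV].
have sG (z' : seq L) : sigma_fun Y setT (fun t => QW (unzip2 z) t * tW z t * QW (unzip2 z') t).
  by apply: measurable_funM; [apply: measurable_funM; [exact: sQW|exact: stW]|exact: sQW].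
have mqg z' : measurable_fun setT (fun t => pair_weight z t * (g z t)%:R * pair_weight z' t).
  apply: measurable_funM; last exact: measurable_pair_weight.
  apply: measurable_funM; [exact: measurable_pair_weight|exact: measurable_bool_R].
have qg0 z' t : 0 <= pair_weight z t * (g z t)%:R * pair_weight z' t.
  by rewrite !mulr_ge0 ?ler0n ?pair_weight_ge0.
rewrite ExZ ?invr_ge0 ?exprn_ge0//; last 2 first.
- by under eq_fun do rewrite -big_filter; exact: measurable_sum.
- by move=> t; exact: sumr_ge0.
rewrite Ex_sum// card_pair.
pose u := unzip1 z; pose v := unzip2 z.
(* The closeness test is put inside the summand, so the sum over product words becomes a double sum
   over [u'] and [v']. *)
pose f (u' : word a) (v' : word b) : R :=
  if `|left_end (take k u') + left_end (take k v') - pair_end (take k z)| <= 5 * 2 ^- k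
  then al ^+ lcp u u' * be ^+ lcp v v' else 0.
apply: (@le_trans _ _ ((((a * b)%N%:R) ^- n)%:E * (C * C' * \sum_(z' <- words L n) f (unzip1 z')
  (unzip2 z'))%:E)%E).
  apply: lee_wpmul2l; first by rewrite lee_fin invr_ge0 exprn_ge0.
  rewrite mulr_sumr -sumEFin big_mkcond; apply: lee_sum => z' _.
  rewrite /pair_close /f {1}/pair_end /unzip1 /unzip2 !map_take -/(unzip1 _) -/(unzip2 _).
  case: ifP => _; last by rewrite mulr0.
  have -> : Ex P (fun t => pair_weight z t * (g z t)%:R * pair_weight z' t) =
    Ex P (fun t => (QV (unzip1 z) t * tV z t * QV (unzip1 z') t) * (QW (unzip2 z) t * tW z t * QW
      (unzip2 z') t)).
    apply: eq_Ex => t; rewrite /pair_weight /g /tV /tW.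
    by case: (tame X _ _ _ _); case: (tame Y _ _ _ _); rewrite /=; ring.
  have n1 t : 0 <= QV (unzip1 z) t * tV z t * QV (unzip1 z') t.
    exact: mulr_ge0 (mulr_ge0 (QV0 _ _) (tV0 _ _)) (QV0 _ _).
  have n2 t : 0 <= QW (unzip2 z) t * tW z t * QW (unzip2 z') t.
    exact: mulr_ge0 (mulr_ge0 (QW0 _ _) (tW0 _ _)) (QW0 _ _).
  rewrite (Ex_split (sF z') (sG z') n1 n2).
  have -> : C * C' * (al ^+ lcp u (unzip1 z') * be ^+ lcp v (unzip2 z')) =
     (C * al ^+ lcp u (unzip1 z')) * (C' * be ^+ lcp v (unzip2 z')) by rewrite mulrACA.
  rewrite EFinM; apply: lee_pmul.
  - exact: Ex_ge0 n1.
  - exact: Ex_ge0 n2.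
  - by apply: (spine_kernel V0 EV Vs_iid) => //; exact: ltW.
  - by apply: (spine_kernel W0 EW Ws_iid) => //; exact: ltW.
rewrite -EFinM lee_fin big_words_prod natrM exprMn invfM mulrCA /K -[leRHS]mulrA.
apply: ler_wpM2l; first by rewrite mulr_ge0// ltW.
have := @pair_kernel_sum R a b al be s1 s2 5 k n u v (pair_end (take k z)) a2 b2 al0 be0 s10 s20
  s12.
rewrite -/th -/th' => /(_ _ th1 th'1) H; apply: le_trans (H _ _ _ _).
- rewrite ler_wpM2l ?mulr_ge0 ?invr_ge0 ?exprn_ge0//; apply: ler_sum => u' _.
  by rewrite [leRHS]big_mkcond.
- by [].
- exact: leq_trans zn.
- by rewrite size_map.
- by rewrite size_map.
Qed.

Local Notation DV := (@cascade_dim R d0 T0 P0 V a).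
Local Notation DW := (@cascade_dim R d0 T0 P0 W b).
Local Notation D := (Num.min 1 (DV + DW)).
Local Notation conv t := (finite_convolution (cascade_measure (lV t)) (cascade_measure (lW t))).

Let DV0 : 0 < DV. Proof. exact: cascade_dim_gt0. Qed.
Let DW0 : 0 < DW. Proof. exact: cascade_dim_gt0. Qed.
Let D0 : 0 < D. Proof. by rewrite lt_min ltr01 addr_gt0. Qed.

Lemma split_dim (s : R) : 0 <= s -> s < D -> exists s1 s2,
  [/\ 0 <= s1 < DV, 0 <= s2 < DW, s1 + s2 <= 1 & s < s1 + s2].
Proof.
move=> s0; rewrite lt_min => /andP[s1 sD].
have S0 : 0 < DV + DW by rewrite addr_gt0.
(* Both dimensions are scaled by the same [c]. Above [s / (DV + DW)] the sum exceeds [s]; below [1]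
   each part stays under its dimension; below [(DV + DW)^-1] the sum stays under 1. *)
pose c := (s / (DV + DW) + Num.min 1 (DV + DW)^-1) / 2.
have k1 : s / (DV + DW) < Num.min 1 (DV + DW)^-1.
  by rewrite lt_min ltr_pdivrMr// mul1r sD /= -[ltRHS]mul1r ltr_pM2r ?invr_gt0.
have k0 : 0 <= s / (DV + DW) by rewrite divr_ge0// ltW.
have m1 : Num.min 1 (DV + DW)^-1 <= 1 by rewrite ge_min lexx.
have m2 : Num.min 1 (DV + DW)^-1 <= (DV + DW)^-1 by rewrite ge_min lexx orbT.
move: k1 m1 m2 @c; move: (Num.min _ _) => k k1 m1 m2 c.
have c0 : 0 <= c by rewrite /c; lra.
have c1 : c < 1 by rewrite /c; lra.
have c2 : c <= (DV + DW)^-1 by rewrite /c; lra.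
have c3 : s / (DV + DW) < c by rewrite /c; lra.
exists (c * DV), (c * DW); split.
- by rewrite mulr_ge0 ?(ltW DV0)//= gtr_pMl.
- by rewrite mulr_ge0 ?(ltW DW0)//= gtr_pMl.
- by rewrite -mulrDr -ler_pdivlMr// mul1r.
- by rewrite -mulrDr -ltr_pdivrMr.
Qed.

Lemma conv_dense_null : {ae P, forall t s, 0 <= s -> s < D -> conv t (dense_pt (conv t) s) = 0%E}.
Proof.
apply: (dense_null size_pair_prefix measurable_pair_prefix pair_measure_prefix
  measurable_coding_sum (lam := fun t => conv t) (close := pair_close) _ _ D0).
- by move=> t A; exact: convolution_coding.
- move=> k s s'; rewrite /pair_close /pair_end /coding_sum.
  have [-> ->] := unzip_pair_prefix s k; have [-> ->] := unzip_pair_prefix s' k.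
  have /andP[i1 i2] := @coding_bounds R a s.1 k; have /andP[j1 j2] := @coding_bounds R b s.2 k.
  have /andP[i1' i2'] := @coding_bounds R a s'.1 k; have /andP[j1' j2'] :=
    @coding_bounds R b s'.2 k.
  have ak := @inv_pow_le R a a2 k; have bk := @inv_pow_le R b b2 k.
  have k0 : 0 < 2 ^- k :> R by rewrite invr_gt0 exprn_gt0.
  by rewrite ltr_norml => /andP[h1 h2]; rewrite ler_norml; apply/andP; split; lra.
- move=> s s0 sD; have [s1 [s2 [/andP[s10 s1V] /andP[s20 s2W] s12 ss]]] := split_dim s0 sD.
  exact: (pair_lower s10 s1V s20 s2W s12 ss).
Qed.

Lemma conv_ball_mass_ge t (s : seq_space a * seq_space b) (r : R) : 0 < r ->
  ball_mass (cascade_measure (lV t)) (coding s.1) (r / 2) *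
  ball_mass (cascade_measure (lW t)) (coding s.2) (r / 2) <= ball_mass (conv t) (coding_sum s) r.
Proof.
move=> r0; rewrite -lee_fin EFinM !fineK; try by apply: fin_num_measure; exact: measurable_ball.
rewrite -[leRHS]/(convolution (cascade_measure (lV t)) (cascade_measure (lW t)) (ball (coding_sum s
  : R) r)).
rewrite -product_measure1E; [|exact: measurable_ball|exact: measurable_ball].
rewrite /convolution /pushforward; apply: le_measure; rewrite ?inE.
- by apply: measurableX; exact: measurable_ball.
- have mD : measurable_fun [set: R * R] (fun z : R * R => z.1 + z.2) by exact: measurable_funD.
  by rewrite -[X in measurable X]setTI; apply: mD => //; exact: measurable_ball.
move=> [x y] [/=]; rewrite /ball /= /coding_sum => h1 h2.
have -> : coding s.1 + coding s.2 - (x + y) = (coding s.1 - x) + (coding s.2 - y) by ring.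
by apply: le_lt_trans (ler_normD _ _) _; lra.
Qed.

Lemma conv_sparse_null : {ae P, forall t s, D < s -> conv t (sparse_pt (conv t) s) = 0%E}.
Proof.
have bV := cascade_ball_lower V0 EV a2 hV Vs_iid ella_unif lV_lim.
have bW := cascade_ball_lower W0 EW b2 hW Ws_iid ellb_unif lW_lim.
apply: filterS2 bV bW => t bV bW s; rewrite gt_min => /orP[s1|sD].
  (* Above exponent 1 the covering bound suffices, since both codings lie in [[0, 1]] and the
     convolution is carried by [[0, 2]]. *)
  apply: (@sparse_null _ (conv t) 2) => //.
  rewrite -[LHS]/(convolution (cascade_measure (lV t)) (cascade_measure (lW t)) (~` `[0,
    2%:R]%classic)).
  have mI : measurable (~` `[0, 2%:R]%classic : set R) by apply: measurableC; exact: measurable_itv.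
  rewrite convolution_coding// (_ : _ @^-1` _ = set0) ?measure0//.
  apply/seteqP; split => // -[i j] /=; apply; rewrite in_itv/= /coding_sum /=.
  have /andP[i0 i1] := @coding_itv R a i; have /andP[j0 j1] := @coding_itv R b j.
  by apply/andP; split; lra.
rewrite -[LHS]/(convolution (cascade_measure (lV t)) (cascade_measure (lW t)) (sparse_pt (conv t)
  s)).
rewrite convolution_coding; last exact: measurable_sparse_pt.
apply: (@ae_not_null _ _ _ (lV t \x lW t)%E).
  by rewrite -[X in measurable X]setTI; apply: measurable_coding_sum => //;
    exact: measurable_sparse_pt.
(* One [e] is spent on each cascade, and the remaining [2 * e] absorbs the passage from radius
   [2^-k] to [2^-(k+1)] in both factors. *)
pose e := (s - (DV + DW)) / 4.
have e0 : 0 < e by rewrite divr_gt0// subr_gt0.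
have sE : s = DV + DW + 4 * e by rewrite /e; lra.
clearbody e.
apply: filterS2 (ae_fst (lW t) bV) (ae_snd (lV t) bW) => z /(_ _ e0) hV' /(_ _ e0) hW' hz.
have [N _ hN] : \forall k \near \oo, expR (s * ln (2 ^- k)) <= ball_mass (conv t) (coding_sum z)
  (2 ^- k).
  have nV := near_dyadic hV'; have nW := near_dyadic hW'.
  have nL : \forall k \near \oo, (DV + DW + 2 * e) * ln 2 < 2 * e * (k%:R * ln 2).
    have l2 : 0 < ln 2 :> R by apply: ln_gt0; rewrite ltr1n.
    exists (Num.truncn ((DV + DW + 2 * e) / (2 * e))).+1 => // k /= hk.
    rewrite mulrA ltr_pM2r// [ltRHS]mulrC -ltr_pdivrMr ?mulr_gt0//.
    by apply: lt_le_trans (truncnS_gt _) _; rewrite ler_nat.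
  case: nV => N1 _ h1; case: nW => N2 _ h2; case: nL => N3 _ h3.
  exists (N1 + N2 + N3)%N => // k /= hk.
  have k0 : 0 < 2 ^- k :> R by rewrite invr_gt0 exprn_gt0.
  apply: le_trans (conv_ball_mass_ge t z k0).
  have kE : 2 ^- k / 2 = 2 ^- k.+1 :> R by rewrite exprS invfM mulrC.
  rewrite kE; have h1' := h1 k.+1 ltac:(rewrite /=; lia); have h2' := h2 k.+1 ltac:(rewrite /=;
    lia).
  apply: le_trans (ler_pM (expR_ge0 _) (expR_ge0 _) h1' h2').
  rewrite -expRD ler_expR !dyadic_lnE.
  have := h3 k ltac:(rewrite /=; lia).
  have -> : k.+1%:R = k%:R + 1 :> R by rewrite -natr1.
  rewrite sE.
  move: (DV) (DW) (k%:R : R) (ln 2 : R) (e) => x y kk l ee; lra.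
have [k /= Nk] := hz N Logic.I; apply/negP; rewrite -leNgt.
by apply: le_trans (hN k Nk); rewrite dyadic_lnE -expRM_natl ler_expR; lra.
Qed.

Lemma convolution_exact_dim : {ae P, forall t,
  exact_dim (convolution (cascade_measure (lV t)) (cascade_measure (lW t))) D}.
Proof.
apply: filterS2 conv_dense_null conv_sparse_null => t lo up.
by apply: (@exact_dim_criterion _ (conv t)); [exact: D0|exact: lo|exact: up].
Qed.

End pair.

Theorem corollary1p9 (R : realType) (a b : nat) (ha : (2 <= a)%N) (hb : (2 <= b)%N)
  (d0 : measure_display) (T0 : measurableType d0) (P0 : probability T0 R)
  (V W : {RV P0 >-> R})
  (hVW : independent_RV2 P0 V W)
  (V_ge0 : forall t, 0 <= V t) (W_ge0 : forall t, 0 <= W t)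
  (EV : ('E_P0[V] = 1)%E) (EW : ('E_P0[W] = 1)%E)
  (hV : (entropy V < (ln (a%:R : R))%:E)%E)
  (hW : (entropy W < (ln (b%:R : R))%:E)%E)
  (d : measure_display) (Omega : measurableType d) (P : probability Omega R)
  (Vs : word a -> {RV P >-> R}) (Ws : word b -> {RV P >-> R})
  (Vs_iid : iid_copies Vs V) (Ws_iid : iid_copies Ws W)
  (Vs_Ws : independent_families P (fun u => Vs u : Omega -> R)
                                  (fun v => Ws v : Omega -> R))
  (ella : probability (seq_space a) R) (ella_unif : uniform_measure ella)
  (ellb : probability (seq_space b) R) (ellb_unif : uniform_measure ellb)
  (lV : Omega -> {finite_measure set (seq_space a) -> \bar R})
  (lV_lim : {ae P, forall w,
     weakly_converges (cascade_step ella (fun u => Vs u w)) (lV w)})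
  (lW : Omega -> {finite_measure set (seq_space b) -> \bar R})
  (lW_lim : {ae P, forall w,
     weakly_converges (cascade_step ellb (fun v => Ws v w)) (lW w)})
  (h_irr : irrational (ln (a%:R : R) / ln (b%:R : R))) :
  {ae P, forall w,
    (0 < cascade_measure (lV w) `[0%R, 1%R] * cascade_measure (lW w) `[0%R, 1%R])%E ->
    exists DV DW : R,
      [/\ exact_dim (cascade_measure (lV w)) DV,
          exact_dim (cascade_measure (lW w)) DW,
          exact_dim (convolution (cascade_measure (lV w))
                                 (cascade_measure (lW w)))
                    (Num.min 1 (DV + DW))
        & Num.min 1 (DV + DW) =
          Num.min 1 (2 - fine (entropy V) / ln a%:R - fine (entropy W) / ln b%:R)]}.
Proof.
have dV := cascade_exact_dim V_ge0 EV ha hV Vs_iid ella_unif lV_lim.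
have dW := cascade_exact_dim W_ge0 EW hb hW Ws_iid ellb_unif lW_lim.
have dVW := convolution_exact_dim V_ge0 W_ge0 EV EW ha hb hV hW Vs_iid Ws_iid Vs_Ws
  ella_unif ellb_unif lV_lim lW_lim.
apply: filterS3 dV dW dVW => w dV dW dVW _.
exists (@cascade_dim R d0 T0 P0 V a), (@cascade_dim R d0 T0 P0 W b); split => //.
rewrite (entropyE V_ge0 hV) (entropyE W_ge0 hW) /cascade_dim /=; congr Num.min; ring.
Qed.
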